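(* Let $V$ be a vertex operator algebra with central charge $c$ and let $W$, $M$ be irreducible ordinary $V$-modules of conformal weights $h_W,h_M$. Assume there exists a finite-dimensional graded subspace $U\subseteq W$ such that $W=U\oplus C_2(W)$ and $U\subseteq\sum_{i\in\Lambda}\mathcal U(\mathrm{Vir}_\omega).v^i$, where each $v^i\in W$ is a highest-weight vector for $\mathrm{Vir}_\omega=\mathrm{span}\{L(n),C:n\in\mathbb Z\}$, i.e. $L(0)v^i=h^iv^i$ and $L(n)v^i=0$ for all $n\ge1$. Let $I\in I\binom{M}{W\;M}$. Then for every $u\in W$ the formal power series $\mathrm{tr}|_Mo_I(u)q^{L(0)-\frac c{24}}\in\mathbb C[[q]]q^{h_M-\frac c{24}}$ converges locally uniformly on $\{q\in\mathbb C:|q|<1\}$ (that is, its $\mathbb C[[q]]$-factor does). In particular, for fixed $\tau\in\mathbb H$, with $q=e^{2\pi i\tau}$ and $q^{h_M-\frac c{24}}=e^{2\pi i\tau(h_M-\frac c{24})}$, one obtains a linear functional on the space of coinvariants $$\varphi_I(\tau):=\mathrm{tr}|_Mo_I(\cdot)q^{L(0)-\frac c{24}}:[W]_{(E_\tau,\mathsf p,z)}\to\mathbb C .$$ In other words, for fixed $\tau\in\mathbb H$, $\varphi_I(\tau)\in\mathscr C(E_\tau,\mathsf p,z,W)$ for all $I\in I\binom{M}{W\;M}$.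
   Context: A vertex operator algebra (VOA) is $(V,Y(\cdot,z),\mathbf 1,\omega)$, $V=\bigoplus_{n\ge0}V_n$, $\dim V_n<\infty$, with the usual axioms; $Y(a,z)=\sum a_{(n)}z^{-n-1}$, $Y(\omega,z)=\sum L(n)z^{-n-2}$, $\mathrm{wt}\,a$ is the $L(0)$-eigenvalue. An admissible module is a weak module $M=\bigoplus_{n\in\mathbb N}M(n)$ with $a_{(m)}M(n)\subseteq M(\mathrm{wt}\,a-m-1+n)$; it has conformal weight $h_M$ if $L(0)$ is semisimple with $M(n)$ the eigenspace of eigenvalue $h_M+n$, and is ordinary if also $\dim M(n)<\infty$ for all $n$. $C_2(W)=\mathrm{span}\{a_{(-2)}v:a\in V,v\in W\}$. Graded means compatible with $W=\bigoplus W(n)$. $I\binom{M}{W\;M}$ is the space of intertwining operators: linear maps $I(\cdot,w):W\to\mathrm{End}(M)[[w^{\pm1}]]w^{-h_W}$, $I(v,w)=\sum_{n\in\mathbb Z} v_{(n)}w^{-n-1-h_W}$, satisfying truncation, $I(L(-1)v,w)=\frac d{dw}I(v,w)$ and the Jacobi identity. For $v\in W(n)$ put $\deg v=n$, $o_I(v)=v_{(\deg v-1)}$ (extended linearly); it preserves each $M(n)$, and $\mathrm{tr}|_Mo_I(v)q^{L(0)-c/24}:=\sum_{n\ge0}\mathrm{tr}|_{M(n)}o_I(v)\,q^{n+h_M-c/24}$. $Y_W[a,z]=Y_W(a,e^{2\pi iz}-1)e^{2\pi iz\,\mathrm{wt}\,a}=\sum a[n]z^{-n-1}$, i.e. $a[m]=(2\pi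 i)^{-m-1}\mathrm{Res}_zY_W(a,z)(\ln(1+z))^m(1+z)^{\mathrm{wt}\,a-1}$. Let $E_\tau=\mathbb C/(\mathbb Z+\mathbb Z\tau)$, $\mathsf p=[0]$, $z$ the coordinate from $\mathbb C$, and $G_{2k}(\tau)=2\zeta(2k)+\frac{2(2\pi i)^{2k}}{(2k-1)!}\sum_{n\ge1}\sigma_{2k-1}(n)q^n$, $k\ge1$. The space of coinvariants $[W]_{(E_\tau,\mathsf p,z)}$ is the quotient of $W$ by the span of all $a[0]v$ and all $a[-m]v+(-1)^m\sum_{k\ge1}\binom{2k-1}{m-1}G_{2k}(\tau)a[2k-m]v$ with $a\in V$, $v\in W$, $m\ge2$. $\mathscr C(E_\tau,\mathsf p,z,W)$, the space of one-point conformal blocks on the torus, is its dual space (linear functionals on $W$ vanishing on these elements). *)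

(* Defs.v *)
(* The complex numbers are [R[i]], for R an arbitrary model of the reals. *)
From HB Require Import structures.
From mathcomp Require Import all_boot all_order all_algebra.
From mathcomp Require Import all_classical all_reals all_analysis.
From mathcomp Require Import complex.

Set Implicit Arguments.
Unset Strict Implicit.
Unset Printing Implicit Defensive.

Import Order.TTheory GRing.Theory Num.Theory.
Import numFieldNormedType.Exports.

Local Open Scope classical_set_scope.
Local Open Scope complex_scope.
Local Open Scope ring_scope.

(* R[i] gets the topology of its norm, which the library only puts on R[i]^o. *)
HB.instance Definition _ (R : realType) := NormedModule.copy R[i] R[i]^o.

Section Analysis.
Variable R : realType.
Local Notation C := R[i].

Definition expC (z : C) : C :=
  (expR (complex.Re z))%:C *
  Complex (cos (complex.Im z)) (sin (complex.Im z)).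

Definition twopii : C := Complex 0 (2 * pi).

Definition nome (tau : C) : C := expC (twopii * tau).

Definition unit_disc : set C := [set q | `|q| < 1].

Definition zeta (s : nat) : R := limn (series (fun n => (n.+1%:R ^- s : R))).

Definition sigma (s n : nat) : nat := \sum_(d <- divisors n) d ^ s.

(* [eisenstein k tau] is the series of weight 2k. *)
Definition eisenstein (k : nat) (tau : C) : C :=
  2 * (zeta (2 * k))%:C +
  2 * twopii ^+ (2 * k) / ((2 * k - 1)`!)%:R *
  limn (series
    (fun n => (sigma (2 * k - 1) n.+1)%:R * nome tau ^+ n.+1 : C)).

Definition cvg_locally_uniformly_on (D : set C) (F : nat -> C -> C) : Prop :=
  exists f : C -> C, forall q, D q ->
    exists2 U : set C, nbhs q U & {uniform U `&` D, F @ \oo --> f}.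

Definition binc (alpha : C) (k : nat) : C :=
  (\prod_(j < k) (alpha - j%:R)) / k`!%:R.

Definition fps_mul (f g : nat -> C) (n : nat) : C :=
  \sum_(i < n.+1) f i * g (n - i)%N.

Definition fps_exp (f : nat -> C) (k : nat) : nat -> C :=
  iter k (fps_mul f) (fun n => (n == 0%N)%:R).

(* For f with constant term 1, the power f^alpha, defined by Newton's binomial
   series in f - 1 (so that f^(-1) is the inverse of f). The summand vanishes
   for k > n, as f - 1 has no constant term. *)
Definition fps_pow (f : nat -> C) (alpha : C) (n : nat) : C :=
  \sum_(k < n.+1) binc alpha k * fps_exp (fun j => f j - (j == 0%N)%:R) k n.

(* ln(1+z) / z *)
Definition fps_ln1pz : nat -> C := fun k => (-1) ^+ k / k.+1%:R.

(* [bracket_coef m wt i] is the coefficient of z^(m+i) in the Laurent series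
   (ln(1+z))^m (1+z)^(wt-1) = z^m (ln(1+z)/z)^m (1+z)^(wt-1). *)
Definition bracket_coef (m : int) (wt : nat) : nat -> C :=
  fps_mul (fps_pow fps_ln1pz m%:~R) (binc (wt%:R - 1)).

End Analysis.

Section LinearAlgebra.
Variables (K : fieldType) (X : lmodType K).

Definition subspace (S : set X) : Prop :=
  S 0 /\ forall (k : K) (x y : X), S x -> S y -> S (k *: x + y).

Definition lspan (S : set X) : set X := smallest subspace S.

Definition is_basis (S : set X) (n : nat) (e : 'I_n -> X) : Prop :=
  (forall i, S (e i)) /\
  (forall x, S x -> exists! a : 'rV[K]_n, x = \sum_i a 0 i *: e i).

Definition fin_dim (S : set X) : Prop :=
  exists (n : nat) (e : 'I_n -> X), is_basis S e.

(* The trace of the restriction of f to a finite-dimensional subspace S stable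
   under f, read off the matrix of f in some basis of S. *)
Definition trace_on (S : set X) (f : X -> X) : K :=
  xget 0 [set t | exists (n : nat) (e : 'I_n -> X) (A : 'M[K]_n),
    [/\ is_basis S e,
        forall i, f (e i) = \sum_j A i j *: e j
      & t = \tr A]].

(* x = sum_n f n, a finite sum with f n in S n *)
Definition decomposition (S : nat -> set X) (x : X) (f : nat -> X) : Prop :=
  [/\ forall n, S n (f n),
      finite_set [set n | f n != 0]
    & x = \sum_(n \in [set: nat]) f n].

Definition direct_sum (S : nat -> set X) : Prop :=
  (forall n, subspace (S n)) /\
  (forall x, exists! f, decomposition S x f).

Definition component (S : nat -> set X) (n : nat) (x : X) : X :=
  xget (fun=> 0) [set f | decomposition S x f] n.

Lemma lspan_subspace (S : set X) : subspace (lspan S).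
Proof.
split=> [A [[A0 _] _] //|k x y Sx Sy A [Asub SA]].
by apply: (proj2 Asub); [exact: Sx | exact: Sy].
Qed.

Lemma lspanB (S : set X) x y : lspan S x -> lspan S y -> lspan S (x - y).
Proof.
by move=> Sx Sy; rewrite addrC -scaleN1r; apply: (proj2 (lspan_subspace S)).
Qed.

Lemma lspanD (S : set X) x y : lspan S x -> lspan S y -> lspan S (x + y).
Proof. by move=> Sx Sy; rewrite -[x]scale1r; apply: (proj2 (lspan_subspace S)). Qed.

Lemma lspanZ (S : set X) k x : lspan S x -> lspan S (k *: x).
Proof.
move=> Sx; rewrite -[k *: x]addr0; apply: (proj2 (lspan_subspace S)) => //.
exact: (proj1 (lspan_subspace S)).
Qed.

End LinearAlgebra.

Section Quotient.
Variables (K : fieldType) (X : lmodType K) (S : set X).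

Definition qequiv (x y : X) : bool := `[< lspan S (x - y) >].

Lemma qequiv_refl : reflexive qequiv.
Proof. by move=> x; apply/asboolP; rewrite subrr; exact: (proj1 (lspan_subspace S)). Qed.

Lemma qequiv_sym : symmetric qequiv.
Proof.
have sub x y : lspan S (x - y) -> lspan S (y - x).
  by move=> h; rewrite -(opprB x y) -scaleN1r; exact: lspanZ.
by move=> x y; apply/asbool_equiv_eq; split; exact: sub.
Qed.

Lemma qequiv_trans : transitive qequiv.
Proof.
move=> y x z /asboolP h1 /asboolP h2; apply/asboolP.
by rewrite -(subrKA y); exact: lspanD.
Qed.

Canonical qequiv_equiv := EquivRel qequiv qequiv_refl qequiv_sym qequiv_trans.

Definition lquot := {eq_quot qequiv}%qT.
HB.instance Definition _ := Choice.on lquot.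
HB.instance Definition _ := Quotient.on lquot.

Definition lclass (x : X) : lquot := (\pi_lquot x)%qT.

Lemma lclassP x y : lclass x = lclass y <-> lspan S (x - y).
Proof.
split=> [/eqP|h]; first by rewrite /lclass eqmodE => /asboolP.
by apply/eqP; rewrite /lclass eqmodE; apply/asboolP.
Qed.

Lemma lclassK (c : lquot) : lclass (repr c) = c.
Proof. exact: reprK. Qed.

Lemma lspan_repr x : lspan S (repr (lclass x) - x).
Proof. by apply/lclassP; rewrite lclassK. Qed.

Let add (c d : lquot) : lquot := lclass (repr c + repr d).
Let opp (c : lquot) : lquot := lclass (- repr c).
Let scale (k : K) (c : lquot) : lquot := lclass (k *: repr c).

Let addE x y : add (lclass x) (lclass y) = lclass (x + y).
Proof. by apply/lclassP; rewrite opprD addrACA; apply: lspanD; apply: lspan_repr. Qed.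

Let oppE x : opp (lclass x) = lclass (- x).
Proof.
by apply/lclassP; rewrite -opprD -[- (_ - _)]scaleN1r; apply: lspanZ; apply: lspan_repr.
Qed.

Let scaleE k x : scale k (lclass x) = lclass (k *: x).
Proof. by apply/lclassP; rewrite -scalerBr; apply: lspanZ; apply: lspan_repr. Qed.

Let addA : associative add.
Proof. by move=> a b c; rewrite -[a]lclassK -[b]lclassK -[c]lclassK !addE addrA. Qed.
Let addC : commutative add.
Proof. by move=> a b; rewrite -[a]lclassK -[b]lclassK !addE addrC. Qed.
Let add0 : left_id (lclass 0) add.
Proof. by move=> a; rewrite -[a]lclassK addE add0r. Qed.
Let addN : left_inverse (lclass 0) opp add.
Proof. by move=> a; rewrite -[a]lclassK oppE addE addNr. Qed.

HB.instance Definition _ := GRing.isZmodule.Build lquot addA addC add0 addN.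

Let scaleA a b v : scale a (scale b v) = scale (a * b) v.
Proof. by rewrite -[v]lclassK !scaleE scalerA. Qed.
Let scale1 : left_id 1 scale.
Proof. by move=> v; rewrite -[v]lclassK scaleE scale1r. Qed.
Let scaleDr : right_distributive scale +%R.
Proof.
move=> k u v; rewrite -[u]lclassK -[v]lclassK.
by rewrite [_ + _]addE !scaleE scalerDr [RHS]addE.
Qed.
Let scaleDl v : {morph scale^~ v : a b / a + b}.
Proof. by move=> a b; rewrite -[v]lclassK !scaleE scalerDl [RHS]addE. Qed.

HB.instance Definition _ :=
  GRing.Zmodule_isLmodule.Build K lquot scaleA scale1 scaleDr scaleDl.

Lemma lclass_linear : linear lclass.
Proof. by move=> k x y; rewrite -addE -scaleE. Qed.

End Quotient.

Section VOA.
Variable R : realType.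
Local Notation C := R[i].

Definition bimodes (A B D : lmodType C) (Y : A -> int -> B -> D) : Prop :=
  (forall n b, linear (fun a => Y a n b)) /\ (forall a n, linear (Y a n)).

Definition truncation (A B D : lmodType C) (Y : A -> int -> B -> D) : Prop :=
  forall a b, exists N : int, forall n : int, N <= n -> Y a n b = 0.

(* The Jacobi identity
     z0^-1 delta((z1-z2)/z0) Y3(a,z1) Y2(b,z2)
       - z0^-1 delta((z2-z1)/(-z0)) Y2(b,z2) Y3(a,z1)
     = z2^-1 delta((z1-z0)/z2) Y2(Y1(a,z0)b,z2),
   for Y1(a,z) on B, Y2(b,z) : D -> D and Y3(a,z) on D: equality of the
   coefficients of z0^(-r-1) z1^(-p-1) z2^(-q-1). The sums over i are finite by
   truncation. For an intertwining operator, both sides are first divided by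
   the common factor z2^(-hW). *)
Definition jacobi (A B D : lmodType C) (Y1 : A -> int -> B -> B)
    (Y2 : B -> int -> D -> D) (Y3 : A -> int -> D -> D) : Prop :=
  forall (a : A) (b : B) (d : D) (p q r : int),
    \sum_(i \in [set: nat]) binc p%:~R i *:
        Y2 (Y1 a (r + i%:Z) b) (p + q - i%:Z) d
    = \sum_(i \in [set: nat]) ((-1) ^+ i * binc r%:~R i) *:
        (Y3 a (p + r - i%:Z) (Y2 b (q + i%:Z) d)
         - (-1 : C) ^ r *: Y2 b (q + r - i%:Z) (Y3 a (p + i%:Z) d)).

Section VOAAxioms.
Variables (V : lmodType C) (Y : V -> int -> V -> V) (vac om : V) (c : C).
Local Notation L := (fun n : int => Y om (n + 1)).

Definition eigen_grading (n : nat) : set V := [set a | L 0 a = n%:R *: a].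

Record voa_axioms : Prop := {
  voa_bimodes : bimodes Y;
  voa_truncation : truncation Y;
  voa_vacuum : forall (n : int) (b : V),
    Y vac n b = if n == -1 then b else 0;
  voa_creation : forall a : V,
    Y a (-1) vac = a /\ (forall n : int, 0 <= n -> Y a n vac = 0);
  voa_jacobi : jacobi Y Y Y;
  voa_virasoro : forall (m n : int) (b : V),
    L m (L n b) - L n (L m b) =
      (m - n)%:~R *: L (m + n) b +
      (if m + n == 0 then ((m ^+ 3 - m)%:~R / 12 * c) *: b else 0);
  voa_derivative : forall (a : V) (n : int) (b : V),
    Y (L (-1) a) n b = - n%:~R *: Y a (n - 1) b;
  voa_grading : direct_sum eigen_grading;
  voa_fin_dim : forall n, fin_dim (eigen_grading n);
  voa_vac_weight : eigen_grading 0 vac;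
  voa_conf_weight : eigen_grading 2 om
}.

End VOAAxioms.

Record voa := Voa {
  voa_sort :> lmodType C;
  vmode : voa_sort -> int -> voa_sort -> voa_sort;
  vacuum : voa_sort;
  conformal_vector : voa_sort;
  central_charge : C;
  voaP : voa_axioms vmode vacuum conformal_vector central_charge
}.

Definition weight_space (V : voa) : nat -> set V :=
  eigen_grading (@vmode V) (conformal_vector V).

Record weak_module (V : voa) := WeakModule {
  wm_sort :> lmodType C;
  mmode : V -> int -> wm_sort -> wm_sort;
  wm_bimodes : bimodes mmode;
  wm_truncation : truncation mmode;
  wm_vacuum : forall (n : int) (x : wm_sort),
    mmode (vacuum V) n x = if n == -1 then x else 0;
  wm_jacobi : jacobi (@vmode V) mmode mmode
}.

Definition int_grading (X : lmodType C) (S : nat -> set X) (n : int) : set X :=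
  if n is Posz k then S k else [set 0].

Record admissible_module (V : voa) := AdmissibleModule {
  am_weak :> weak_module V;
  piece : nat -> set am_weak;
  am_direct_sum : direct_sum piece;
  am_shift : forall (k : nat) (a : V) (m : int) (n : nat) (x : am_weak),
    weight_space k a -> piece n x ->
    int_grading piece (k%:Z - m - 1 + n%:Z) (mmode a m x)
}.
Arguments piece {V} M n : rename.

Definition Lop (V : voa) (M : weak_module V) (n : int) : M -> M :=
  mmode (conformal_vector V) (n + 1).

(* Together with [am_direct_sum], this makes L(0) semisimple. *)
Definition has_conformal_weight (V : voa) (M : admissible_module V) (h : C) :=
  forall n, piece M n = [set x | Lop 0 x = (h + n%:R) *: x].

Definition ordinary (V : voa) (M : admissible_module V) (h : C) : Prop :=
  has_conformal_weight M h /\ forall n, fin_dim (piece M n).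

Definition submodule (V : voa) (M : weak_module V) (N : set M) : Prop :=
  subspace N /\ forall a n x, N x -> N (mmode a n x).

Definition irreducible (V : voa) (M : weak_module V) : Prop :=
  (exists x : M, x != 0) /\
  forall N : set M, submodule N -> N = [set 0] \/ N = setT.

Definition C2 (V : voa) (W : weak_module V) : set W :=
  lspan [set x | exists (a : V) (v : W), x = mmode a (-2) v].
Arguments C2 {V} W _.

Definition graded_subspace (V : voa) (W : admissible_module V) (U : set W) :=
  subspace U /\ forall n u, U u -> U (component (piece W) n u).

Definition direct_sum2 (W : lmodType C) (U1 U2 : set W) : Prop :=
  (forall x, exists u1 u2, [/\ U1 u1, U2 u2 & x = u1 + u2]) /\
  U1 `&` U2 = [set 0].

(* v is allowed to be 0 *)
Definition highest_weight_vector (V : voa) (W : weak_module V) (h : C) (v : W) :=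
  Lop 0 v = h *: v /\ forall n : int, 1 <= n -> Lop n v = 0.

(* sum_i U(Vir).v_i, as the span of the L(n_1)...L(n_k) v_i; the central
   element C of Vir acts as a scalar, hence contributes nothing more. *)
Definition virasoro_span (V : voa) (W : weak_module V) (Lam : Type)
    (v : Lam -> W) : set W :=
  lspan [set x | exists (i : Lam) (s : seq int),
    x = foldr (fun n y => Lop n y) (v i) s].

(* [io v n] is v_(n), the coefficient of w^(-n-1-hW) in I(v,w). *)
Record intertwining (V : voa) (W M : weak_module V) (hW : C) := Intertwining {
  io :> W -> int -> M -> M;
  io_bimodes : bimodes io;
  io_truncation : truncation io;
  io_derivative : forall (v : W) (n : int) (x : M),
    io (Lop (-1) v) n x = (- n%:~R - hW) *: io v (n - 1) x;
  io_jacobi : jacobi (@mmode V W) io (@mmode V M)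
}.

Definition o_int (V : voa) (W : admissible_module V) (M : weak_module V)
    (hW : C) (I : intertwining W M hW) (v : W) (x : M) : M :=
  \sum_(n \in [set: nat]) I (component (piece W) n v) (n%:Z - 1) x.

Section Trace.
Variables (V : voa) (W M : admissible_module V) (hW : C).
Variable I : intertwining W M hW.

(* Coefficient of q^(n + hM - c/24) in tr|_M o_I(u) q^(L(0) - c/24). *)
Definition trace_coef (u : W) (n : nat) : C :=
  trace_on (piece M n) (o_int I u).

Definition trace_partial_sum (u : W) (N : nat) (q : C) : C :=
  \sum_(n < N) trace_coef u n * q ^+ n.

(* tr|_M o_I(u) q^(L(0) - c/24) at q = e^(2 pi i tau). *)
Definition trace_function (hM tau : C) (u : W) : C :=
  expC (twopii R * tau * (hM - central_charge V / 24)) *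
  limn (fun N => trace_partial_sum u N (nome tau)).

End Trace.

Section Coinvariants.
Variables (V : voa) (W : weak_module V).

(* a[m]v, for a homogeneous of weight wt. *)
Definition bracket_homog (wt : nat) (a : V) (m : int) (v : W) : W :=
  twopii R ^ (- m - 1) *:
  \sum_(i \in [set: nat]) bracket_coef R m wt i *: mmode a (m + i%:Z) v.

Definition bracket (a : V) (m : int) (v : W) : W :=
  \sum_(k \in [set: nat]) bracket_homog k (component (@weight_space V) k a) m v.

Definition coinvariant_relations (tau : C) : set W :=
  [set x | exists (a : V) (v : W), x = bracket a 0 v] `|`
  [set x | exists (a : V) (v : W) (m : nat), (2 <= m)%N /\
     x = bracket a (- m%:Z) v +
         (-1) ^+ m *: \sum_(k \in [set k : nat | (1 <= k)%N])
           ('C(2 * k - 1, m - 1)%:R * eisenstein k tau) *: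
           bracket a ((2 * k)%:Z - m%:Z) v].

Definition coinvariants (tau : C) := lquot (coinvariant_relations tau).
HB.instance Definition _ tau := GRing.Lmodule.on (coinvariants tau).

Definition coinvariant_class (tau : C) : W -> coinvariants tau :=
  @lclass _ _ (coinvariant_relations tau).

Definition conformal_blocks (tau : C) : set (W -> C) :=
  [set phi | scalar phi /\
             forall x, lspan (coinvariant_relations tau) x -> phi x = 0].

End Coinvariants.

End VOA.
Arguments piece {R V} M n _ : rename.
Arguments C2 {R V} W _.
Arguments weight_space {R} V n _.
Arguments unit_disc R _ : clear implicits.
Arguments coinvariant_relations {R V} W tau _.
Arguments conformal_blocks {R V} W tau _.

(* Main.v *)
(* Write F(u) = sum_n tr|_M(n) o_I(u) q^n.  Moving a mode of a around the trace, by
   cyclicity and the commutator formula, turns each factor q^l into a Lambert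
   denominator; combined with the Jacobi identity this gives Zhu's recursion, which
   expresses F(Res (1 + z)^wt z^(-s-1) Y(a,z)u), up to the zero mode trace when
   s = 0, as a combination of the F(a_(i)u), i >= 0, with Lambert series as
   coefficients.

   Convergence.  For s = 1 the recursion trades a_(-2)v for terms of lower degree.
   As W = U + C_2(W), every F(u) is therefore a combination of the F(e_j), e_j a
   basis of U, over the ring of power series converging in the unit disc.  For s = 0
   and a = omega it computes q d/dq F(u), so the F(e_j) form a formal solution of a
   linear differential system with a regular singular point at q = 0, and such a
   solution converges.

   Coinvariants.  With t = ln(1 + z), the function t^(-m), m >= 2, is a combination of
   the (1 + z) z^(-s-1) and of a power series in t whose coefficients are Bernoulli
   numbers.  In the resulting formula for F(a[-m]u) the Lambert series give the
   nonconstant part of the Eisenstein series and the Bernoulli numbers give the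
   constant term, by Euler's formula for zeta(2k); the latter is obtained as the limit
   of Newton's identities for the numbers cot^2(pi k / N). *)

Require Import Defs.
From HB Require Import structures.
From mathcomp Require Import all_boot all_order all_algebra.
From mathcomp Require Import all_classical all_reals all_analysis.
From mathcomp Require Import complex.
From mathcomp Require Import ring lra zify.
Import Order.TTheory GRing.Theory Num.Theory.
Import numFieldNormedType.Exports.
Local Open Scope classical_set_scope.
Local Open Scope complex_scope.
Local Open Scope ring_scope.

Set Implicit Arguments.
Unset Strict Implicit.
Unset Printing Implicit Defensive.

Local Notation subspace := Defs.subspace.

(** * Formal power series *)

(** Convergence is the claim, so all that precedes it is formal in q: Lambert denominators are
    inverted as power series, the differential system is a recursion for coefficients, and it is
    settled by bounding coefficients, with no theory of analytic differential equations. Complex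
    values of q enter at the end, through an evaluation that is additive and multiplicative on
    series of radius of convergence at least 1.

    The bridge between the coordinates z and t = ln(1 + z) is the family (d/dt)^k ((1 + z)/z). In z
    it is a combination of the functions (1 + z) z^(-s-1) of the recursion, with coefficients for
    which the binomials in l add up to powers of l, hence to divisor sums. In t it is a multiple of
    t^(-k-1) plus a regular series, because 1/z = 1/(e^t - 1).

    The recursion is proved for homogeneous a and u, whose modes have a definite degree, and with an
    explicit bound N beyond which the modes of a kill u, so that all sums over modes are finite.
    General vectors are reached by linearity. *)

Lemma fsbig_nat (X : nmodType) (F : nat -> X) (N : nat) :
  (forall i, (N <= i)%N -> F i = 0) ->
  \sum_(i \in [set: nat]) F i = \sum_(i < N) F i.
Proof.
move=> F0; rewrite fsbig_ord; symmetry; apply: fsbig_widen => // i [_ /= iN].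
by apply: F0; rewrite leqNgt; apply/negP.
Qed.

Lemma big_ord_extend (X : nmodType) (F : nat -> X) (m N : nat) :
  (m <= N)%N -> (forall i, (m <= i)%N -> F i = 0) ->
  \sum_(i < N) F i = \sum_(i < m) F i.
Proof.
move=> mN F0; rewrite -(subnKC mN) big_split_ord /= [X in _ + X]big1 ?addr0 //.
by move=> i _; rewrite F0 // leq_addr.
Qed.

Section FormalPowerSeries.
Variable R : realType.
Local Notation C := R[i].

(** An alias of [nat -> C], so that the coefficient sequences of the statement, such as [binc y] or
    [fps_ln1pz], become ring elements by a mere cast. *)
Definition fps := nat -> C.
HB.instance Definition _ := GRing.Zmodule.on fps.

Definition fps_trunc (N : nat) (f : fps) : {poly C} := \poly_(i < N) f i.

Lemma coef_fps_trunc N f i : (fps_trunc N f)`_i = if (i < N)%N then f i else 0.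
Proof. exact: coef_poly. Qed.

(** Below degree [N] the product is one of polynomials; the ring laws are imported from [{poly C}]
    this way. *)
Lemma fps_mul_trunc (f g : fps) N i : (i < N)%N ->
  fps_mul f g i = (fps_trunc N f * fps_trunc N g)`_i.
Proof.
move=> iN; rewrite coefM; apply: eq_bigr => j _; rewrite !coef_fps_trunc.
have -> : (j < N)%N by rewrite (leq_ltn_trans _ iN) // -ltnS.
by rewrite (leq_ltn_trans _ iN) // leq_subr.
Qed.

Fact fps_mulC : commutative (@fps_mul R).
Proof.
by move=> f g; apply/funext => i; rewrite !(@fps_mul_trunc _ _ i.+1) // mulrC.
Qed.

Fact fps_mulA : associative (@fps_mul R).
Proof.
move=> f g h; apply/funext => i.
transitivity ((fps_trunc i.+1 f * (fps_trunc i.+1 g * fps_trunc i.+1 h))`_i).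
  rewrite coefM; apply: eq_bigr => j _; rewrite coef_fps_trunc ltn_ord.
  by congr (_ * _); apply: fps_mul_trunc; rewrite ltnS leq_subr.
rewrite mulrA coefM; apply: eq_bigr => j _; rewrite coef_fps_trunc ltnS leq_subr.
by congr (_ * _); symmetry; apply: fps_mul_trunc.
Qed.

Definition fps_one : fps := fun n => (n == 0)%:R.

Fact fps_mul1 : left_id fps_one (@fps_mul R).
Proof.
move=> f; apply/funext => i; rewrite /fps_mul big_ord_recl big1 ?addr0 => [|j _].
  by rewrite /fps_one eqxx mul1r subn0.
by rewrite /fps_one /= mul0r.
Qed.

Fact fps_mulDl : left_distributive (@fps_mul R) +%R.
Proof.
move=> f g h; apply/funext => i; rewrite [RHS]/GRing.add /= /fps_mul -big_split /=.
by apply: eq_bigr => j _; exact: mulrDl.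
Qed.

Fact fps_1neq0 : fps_one != 0.
Proof. by apply/eqP => /(congr1 (fun f : fps => f 0%N))/eqP; rewrite oner_eq0. Qed.

HB.instance Definition _ := GRing.Zmodule_isComNzRing.Build fps
  fps_mulA fps_mulC fps_mul1 fps_mulDl fps_1neq0.

Definition fpsC (c : C) : fps := fun n => c *+ (n == 0).

Lemma fpsE (f g : fps) n : (f + g) n = f n + g n. Proof. by []. Qed.
Lemma fpsN (f : fps) n : (- f) n = - f n. Proof. by []. Qed.
Lemma fps1 n : (1 : fps) n = (n == 0)%:R. Proof. by []. Qed.
Lemma fpsM (f g : fps) n : (f * g) n = \sum_(i < n.+1) f i * g (n - i)%N.
Proof. by []. Qed.
Lemma fps_sum (J : Type) (r : seq J) (P : pred J) (F : J -> fps) n :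
  (\sum_(j <- r | P j) F j) n = \sum_(j <- r | P j) F j n.
Proof. by elim/big_rec2: _ => // j x y _ <-. Qed.

Lemma fpsCM c (f : fps) n : (fpsC c * f) n = c * f n.
Proof.
rewrite fpsM big_ord_recl big1 ?addr0 => [|j _]; last by rewrite /fpsC mulr0n mul0r.
by rewrite /fpsC mulr1n subn0.
Qed.

Lemma fpsC_is_zmod_morphism : zmod_morphism fpsC.
Proof. by move=> a b; apply/funext => n; exact: mulrnBl. Qed.
Lemma fpsC_is_monoid_morphism : monoid_morphism fpsC.
Proof.
split; first by apply/funext => n.
by move=> a b; apply/funext => n; rewrite fpsCM /fpsC mulrnAr.
Qed.
HB.instance Definition _ := GRing.isZmodMorphism.Build C fps fpsC fpsC_is_zmod_morphism.
HB.instance Definition _ := GRing.isMonoidMorphism.Build C fps fpsC fpsC_is_monoid_morphism.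

End FormalPowerSeries.

(** * Logarithm and composition *)

Section Logarithm.
Variable R : realType.
Local Notation C := R[i].
Local Notation fps := (fps R).
Local Notation fpsC := (@fpsC R).
Implicit Types (f g : fps) (x y : C).

Definition fpsX : fps := fun n => (n == 1)%:R.

Lemma fpsXM0 f : (fpsX * f) 0%N = 0.
Proof. by rewrite fpsM big_ord1 mul0r. Qed.

Lemma fpsXMS f n : (fpsX * f) n.+1 = f n.
Proof.
rewrite fpsM 2!big_ord_recl big1 ?addr0 => [|i _]; last by rewrite /fpsX mul0r.
by rewrite /fpsX mul0r add0r mul1r subSS subn0.
Qed.

Lemma fpsXnM k f n : (fpsX ^+ k * f) n = if (n < k)%N then 0 else f (n - k)%N.
Proof.
elim: k n => [|k IH] n; first by rewrite mul1r ltn0 subn0.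
rewrite exprS -mulrA; case: n => [|n]; first by rewrite fpsXM0.
by rewrite fpsXMS IH ltnS subSS.
Qed.

Lemma fpsX_inj f g : fpsX * f = fpsX * g -> f = g.
Proof. by move=> E; apply/funext => n; rewrite -fpsXMS E fpsXMS. Qed.

Definition fps_deriv f : fps := fun n => n.+1%:R * f n.+1.

Lemma fps_derivD f g : fps_deriv (f + g) = fps_deriv f + fps_deriv g.
Proof. by apply/funext => n; rewrite fpsE /fps_deriv fpsE mulrDr. Qed.

Lemma fps_derivM f g : fps_deriv (f * g) = fps_deriv f * g + f * fps_deriv g.
Proof.
apply/funext => n; rewrite fpsE !fpsM /fps_deriv.
have -> : n.+1%:R * (f * g) n.+1 =
    \sum_(i < n.+2) (i%:R * f i * g (n.+1 - i)%N) +
    \sum_(i < n.+2) (f i * ((n.+1 - i)%:R * g (n.+1 - i)%N)).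
  rewrite -big_split fpsM mulr_sumr; apply: eq_bigr => i _ /=.
  have -> : n.+1%:R = i%:R + (n.+1 - i)%:R :> C.
    by rewrite -natrD subnKC // -ltnS.
  by ring.
congr (_ + _).
  by rewrite big_ord_recl !mul0r add0r; apply: eq_bigr => i _; rewrite subSS.
rewrite big_ord_recr /= subnn mul0r mulr0 addr0; apply: eq_bigr => i _.
by rewrite subSn // -ltnS.
Qed.

Lemma fps_derivC c : fps_deriv (fpsC c) = 0.
Proof. by apply/funext => n; rewrite /fps_deriv mulr0. Qed.

(* The derivation [d/dt] for [t = ln (1 + z)], the formal variable being [z]. *)
Definition fpsD f : fps := (1 + fpsX) * fps_deriv f.

Lemma fpsDD f g : fpsD (f + g) = fpsD f + fpsD g.
Proof. by rewrite /fpsD fps_derivD mulrDr. Qed.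

Lemma fpsDM f g : fpsD (f * g) = fpsD f * g + f * fpsD g.
Proof. by rewrite /fpsD fps_derivM; ring. Qed.

Lemma fpsDC c : fpsD (fpsC c) = 0.
Proof. by rewrite /fpsD fps_derivC mulr0. Qed.

Lemma fpsDCM c f : fpsD (fpsC c * f) = fpsC c * fpsD f.
Proof. by rewrite fpsDM fpsDC mul0r add0r. Qed.

Lemma fpsDexp f n : fpsD (f ^+ n.+1) = n.+1%:R * f ^+ n * fpsD f.
Proof.
elim: n => [|n IH]; first by rewrite expr1 mulr1 mul1r.
by rewrite exprS fpsDM IH [in RHS]mulrS exprS; ring.
Qed.

Lemma fpsD_coef f n : fpsD f n = n.+1%:R * f n.+1 + n%:R * f n.
Proof.
rewrite /fpsD mulrDl mul1r fpsE; congr (_ + _).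
by case: n => [|n]; rewrite ?fpsXM0 ?mul0r // fpsXMS.
Qed.

(** In degree n the equation reads (n + 1) f_(n+1) + n f_n = y f_n, so the constant term determines
    f. This uniqueness yields Vandermonde's identity [bincD] and the exponential form [binc_exp]. *)
Lemma fpsD_eq f g y : fpsD f = fpsC y * f -> fpsD g = fpsC y * g ->
  f 0%N = g 0%N -> f = g.
Proof.
move=> Df Dg e0; apply/funext; elim=> // n IH.
move: (congr1 (fun h : fps => h n) Df) (congr1 (fun h : fps => h n) Dg).
rewrite !fpsD_coef !fpsCM IH => <- /addIr E.
by apply: (mulfI _ (esym E)); rewrite pnatr_eq0.
Qed.

Lemma binc0 y : binc y 0 = 1.
Proof. by rewrite /binc big_ord0 divr1. Qed.

Lemma bincS y n : n.+1%:R * binc y n.+1 = (y - n%:R) * binc y n.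
Proof.
rewrite /binc big_ord_recr /= factS natrM; field.
by rewrite nat1r !pnatr_eq0 -lt0n fact_gt0.
Qed.

Lemma fpsD_binc y : fpsD (binc y) = fpsC y * binc y.
Proof. by apply/funext => n; rewrite fpsD_coef fpsCM bincS; ring. Qed.

Lemma binc_unique f y : fpsD f = fpsC y * f -> f 0%N = 1 -> f = binc y.
Proof. by move=> Df f0; apply: fpsD_eq Df (fpsD_binc y) _; rewrite binc0. Qed.

Lemma bincD x y : (binc (x + y) : fps) = (binc x : fps) * (binc y : fps).
Proof.
symmetry; apply: binc_unique; first by rewrite fpsDM !fpsD_binc rmorphD /=; ring.
by rewrite fpsM big_ord1 !binc0 mul1r.
Qed.

Lemma binc_nat1 : (binc 1 : fps) = 1 + fpsX.
Proof.
symmetry; apply: binc_unique; last by rewrite fpsE fps1 /fpsX /= addr0.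
apply/funext => n; rewrite fpsD_coef fpsCM mul1r !fpsE !fps1 /fpsX.
by case: n => [|[|n]] /=; ring.
Qed.

Definition fpslog : fps := fpsX * (@fps_ln1pz R : fps).
Local Notation ell := (@fps_ln1pz R : fps).

Lemma fpsD_log : fpsD fpslog = 1.
Proof.
apply/funext => n; rewrite /fpslog fpsD_coef fpsXMS fps1.
have E k : k.+1%:R * fps_ln1pz R k = (-1) ^+ k.
  by rewrite /fps_ln1pz mulrC divfK // pnatr_eq0.
case: n => [|n]; first by rewrite E mul0r addr0.
by rewrite fpsXMS !E exprS /=; ring.
Qed.

Lemma fpsC0 : fpsC 0 = 0. Proof. exact: rmorph0. Qed.
Lemma fpsC1 : fpsC 1 = 1. Proof. exact: rmorph1. Qed.

Section Composition.
Variables (g : fps) (g0 : g 0%N = 0).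

Lemma fps_shift f : f = fpsC (f 0%N) + fpsX * (fun n => f n.+1 : C).
Proof.
apply/funext => -[|n]; rewrite fpsE ?fpsXM0 ?addr0 // fpsXMS /fpsC /=.
by rewrite add0r.
Qed.

Lemma fps_factorX : g = fpsX * (fun n => g n.+1 : C).
Proof. by rewrite {1}(fps_shift g) g0 fpsC0 add0r. Qed.

Lemma fpsexp_coef0 n i : (i < n)%N -> (g ^+ n) i = 0.
Proof. by move=> lt; rewrite fps_factorX exprMn fpsXnM lt. Qed.

(** A finite sum suffices: as [g] has no constant term, its n-th power starts in degree n. *)
Definition fpscomp (c : fps) : fps := fun i => \sum_(n < i.+1) c n * (g ^+ n) i.

Lemma fpscompE c N i : (i < N)%N ->
  fpscomp c i = \sum_(n < N) c n * (g ^+ n) i.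
Proof.
move=> iN; symmetry; apply: (big_ord_extend (F := fun n => c n * (g ^+ n) i)) => // n ni.
by rewrite fpsexp_coef0 ?mulr0.
Qed.

Lemma fpscompD c d : fpscomp (c + d) = fpscomp c + fpscomp d.
Proof.
by apply/funext => i; rewrite fpsE -big_split; apply: eq_bigr => n _; rewrite mulrDl.
Qed.

Lemma fpscompCM x c : fpscomp (fpsC x * c) = fpsC x * fpscomp c.
Proof.
apply/funext => i; rewrite fpsCM mulr_sumr; apply: eq_bigr => n _.
by rewrite fpsCM mulrA.
Qed.

Lemma fpscompC x : fpscomp (fpsC x) = fpsC x.
Proof.
apply/funext => i; rewrite /fpscomp big_ord_recl big1 => [|n _].
  by rewrite expr0 addr0 fps1 /fpsC; case: i => [|i]; rewrite ?mulr1 ?mulr0.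
by rewrite /fpsC mul0r.
Qed.

Lemma fpscompXM c : fpscomp (fpsX * c) = g * fpscomp c.
Proof.
apply/funext => i; rewrite (@fpscompE _ i.+2) // big_ord_recl fpsXM0 mul0r add0r.
under eq_bigr => n _ do rewrite fpsXMS exprS fpsM mulr_sumr.
rewrite exchange_big /= fpsM; apply: eq_bigr => k _.
rewrite (@fpscompE _ i.+1) ?ltnS ?leq_subr // mulr_sumr.
by apply: eq_bigr => n _; rewrite mulrCA.
Qed.

Lemma fpscompXnM k c : fpscomp (fpsX ^+ k * c) = g ^+ k * fpscomp c.
Proof.
by elim: k => [|k IH]; rewrite ?mul1r // !exprS -!mulrA fpscompXM IH.
Qed.

(** Strong induction on the degree: splitting off the constant term of [c] leaves a multiple of [g],
    and the factor X in [g] lowers the degree. *)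
Lemma fpscompM c d : fpscomp (c * d) = fpscomp c * fpscomp d.
Proof.
apply/funext => i; have [m] := ubnP i; elim: m c i => // m IH c i /ltnSE im.
rewrite (fps_shift c); set c' : fps := fun n => c n.+1.
rewrite mulrDl !fpscompD fpscompCM -mulrA !fpscompXM fpscompC mulrDl !fpsE.
congr (_ + _); rewrite fps_factorX -!mulrA.
case: i im => [|i] im; first by rewrite !fpsXM0.
rewrite !fpsXMS !fpsM; apply: eq_bigr => k _; congr (_ * _).
by rewrite IH // (leq_ltn_trans _ im) // leq_subr.
Qed.

End Composition.

Lemma fps_expE (f : nat -> C) k : (fps_exp f k : fps) = (f : fps) ^+ k.
Proof.
rewrite /fps_exp; elim: k => [|k IH]; first by rewrite expr0; apply/funext.
by rewrite iterS exprS IH.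
Qed.

(** Newton's series is a composition with (1 + z)^y, so the laws of exponents reduce to those of
    [binc]. *)
Lemma fps_powE (f : fps) y : (fps_pow f y : fps) = fpscomp (f - 1) (binc y).
Proof.
apply/funext => n; apply: eq_bigr => k _; congr (_ * _).
exact: (congr1 (fun h : fps => h n) (fps_expE (f - 1) k)).
Qed.

Section Powers.
Variables (f : fps) (f0 : f 0%N = 1).

Let f10 : (f - 1) 0%N = 0.
Proof. by rewrite fpsE fpsN f0 fps1 subrr. Qed.

Lemma fps_powD x y : (fps_pow f (x + y) : fps) = (fps_pow f x : fps) * (fps_pow f y : fps).
Proof. by rewrite !fps_powE bincD fpscompM. Qed.

Lemma fps_pow1 : (fps_pow f 1 : fps) = f.
Proof.
rewrite fps_powE binc_nat1 -[fpsX]mulr1 -fpsC1 fpscompD fpscompXM //.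
by rewrite fpscompC fpsC1 mulr1 addrC subrK.
Qed.

Lemma fps_pow0 : (fps_pow f 0 : fps) = 1.
Proof.
rewrite fps_powE -[RHS]fpsC1 -(fpscompC (f - 1) 1); congr fpscomp.
apply/funext => -[|n]; first by rewrite binc0.
by rewrite /binc big_ord_recl subrr mul0r mul0r.
Qed.

Lemma fps_pow_nat n : (fps_pow f n%:R : fps) = f ^+ n.
Proof.
elim: n => [|n IH]; first by rewrite fps_pow0.
by rewrite mulrS fps_powD fps_pow1 IH exprS.
Qed.

Lemma fps_powN y : (fps_pow f y : fps) * (fps_pow f (- y) : fps) = 1.
Proof. by rewrite -fps_powD subrr fps_pow0. Qed.

End Powers.

Lemma fpslog0 : fpslog 0%N = 0. Proof. exact: fpsXM0. Qed.

(** Chain rule: [fpsD] maps ln(1 + z) to 1, so after the substitution it is differentiation in t.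
    Cutting the composition to a finite sum makes the Leibniz rule applicable. *)
Lemma fpsD_comp c : fpsD (fpscomp fpslog c) = fpscomp fpslog (fps_deriv c).
Proof.
have E N f i : (i < N)%N -> fpscomp fpslog f i = (\sum_(n < N) fpsC (f n) * fpslog ^+ n) i.
  by move=> iN; rewrite (@fpscompE _ fpslog0 _ N) // fps_sum; apply: eq_bigr => n _; rewrite fpsCM.
have fpsD0 : fpsD 0 = 0 by rewrite -(rmorph0 fpsC) fpsDC rmorph0.
(* [fpsD] at i involves the coefficient i + 1, hence the cut at i + 2. *)
apply/funext => i; rewrite [RHS](@fpscompE _ fpslog0 _ i.+1) // fpsD_coef !(@E i.+2) // -fpsD_coef.
rewrite (big_morph fpsD fpsDD fpsD0) big_ord_recl expr0 mulr1 fpsDC add0r.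
rewrite fps_sum; apply: eq_bigr => n _.
by rewrite fpsDCM fpsDexp fpsD_log mulr1 -(rmorph_nat fpsC) mulrA -rmorphM fpsCM /fps_deriv [c _ * _]mulrC.
Qed.

Lemma binc_exp y : (binc y : fps) = fpscomp fpslog (fun k => y ^+ k / k`!%:R).
Proof.
symmetry; apply: binc_unique; last first.
  by rewrite /fpscomp big_ord1 !expr0 fact0 divr1 mul1r fps1.
rewrite fpsD_comp -fpscompCM; congr fpscomp; apply/funext => n.
rewrite fpsCM /fps_deriv factS natrM exprS; field.
by rewrite nat1r !pnatr_eq0 -lt0n fact_gt0.
Qed.

Lemma fps_ln1pz0 : ell 0%N = 1.
Proof. by rewrite /fps_ln1pz expr0 divr1. Qed.

(** (e^t - 1)/t, the inverse of the generating series of the Bernoulli numbers over n!. *)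
Definition fps_expm1 : fps := fun n => n.+1`!%:R^-1.

(** At t = ln(1 + z) one has e^t - 1 = z, so b(t) becomes t/z. *)
Lemma bernoulli_comp (b : fps) : b * fps_expm1 = 1 -> fpscomp fpslog b = ell.
Proof.
have l0 := fpslog0.
have XE : fpsX = fpscomp fpslog (fpsX * fps_expm1).
  have -> : fpsX * fps_expm1 = (fun k => 1 ^+ k / k`!%:R : C) + fpsC (-1).
    apply/funext => -[|n]; rewrite fpsE ?fpsXM0 ?fpsXMS /fpsC /=.
      by rewrite expr0 fact0 divr1 subrr.
    by rewrite expr1n addr0 div1r.
  by rewrite fpscompD // fpscompC // -binc_exp binc_nat1 rmorphN /= fpsC1 addrAC subrr add0r.
move=> bE; apply: fpsX_inj; rewrite -/fpslog {1}XE -fpscompM // mulrC mulrCA bE mulr1.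
by rewrite -[in LHS](mulr1 fpsX) fpscompXM // -fpsC1 fpscompC // fpsC1 mulr1.
Qed.

End Logarithm.

(** * Negative powers of ln(1 + z) *)

Section LogarithmPowers.
Variable R : realType.
Local Notation C := R[i].
Local Notation fps := (fps R).
Local Notation fpsC := (@fpsC R).
Local Notation X := (fpsX R).
Local Notation ell := (@fps_ln1pz R : fps).
Implicit Types (f g : fps) (x y : C).

(* z^(k+1) (d/dt)^k ((1 + z)/z) *)
Fixpoint polar (k : nat) : fps :=
  if k is j.+1 then X * fpsD (polar j) - j.+1%:R * (1 + X) * polar j else 1 + X.

(* (d/dt)^k ((1 + z)/z) = sum_s polar_coef k s * z^(-s-1) (1 + z) *)
Fixpoint polar_coef (k s : nat) : C :=
  if k is j.+1 then - s%:R * (polar_coef j s.-1 + polar_coef j s) else (s == 0)%:R.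

Lemma polar_coef_large k s : (k < s)%N -> polar_coef k s = 0.
Proof.
elim: k s => [|k IH] [|s] //= ks.
by rewrite !IH ?addr0 ?mulr0 // ltnW.
Qed.

(** Summation by parts, moving the recursion of [polar_coef] onto the test sequence [Z]. *)
Lemma polar_coef_sum k (Z : nat -> C) :
  \sum_(s < k.+2) polar_coef k.+1 s * Z s =
  - \sum_(s < k.+1) polar_coef k s * (s.+1%:R * Z s.+1 + s%:R * Z s).
Proof.
pose A s := - s%:R * polar_coef k s.-1 * Z s.
pose B s := - s%:R * polar_coef k s * Z s.
transitivity (\sum_(s < k.+2) A s + \sum_(s < k.+2) B s).
  by rewrite -big_split; apply: eq_bigr => s _; rewrite /A /B /=; ring.
rewrite big_ord_recl [X in _ + X]big_ord_recr /= {1}/A {2}/B.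
rewrite (@polar_coef_large k k.+1) // mulr0 mul0r oppr0 !mul0r add0r addr0.
rewrite -big_split -sumrN; apply: eq_bigr => s _; rewrite /A /B /bump /= add1n /=.
by ring.
Qed.

(** The operator produced by the summation by parts has [binc y] as an eigenvector of eigenvalue -
    y. Applied with y = l and y = - l, this turns the binomials of Zhu's recursion into powers of
    l. *)
Lemma polar_coef_binc k y : \sum_(s < k.+1) polar_coef k s * binc y s = (- y) ^+ k.
Proof.
elim: k => [|k IH]; first by rewrite big_ord1 binc0 mulr1.
rewrite polar_coef_sum exprS -IH -sumrN mulr_sumr; apply: eq_bigr => s _.
by rewrite bincS; ring.
Qed.

Lemma fpsDX : fpsD X = 1 + X.
Proof.
rewrite /fpsD -[RHS]mulr1; congr (_ * _); apply/funext => n.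
rewrite fps1 /fps_deriv /fpsX eqSS; case: n => [|n]; first by rewrite mulr1.
by rewrite mulr0.
Qed.

Lemma fpsD1X : fpsD (1 + X) = 1 + X.
Proof. by rewrite fpsDD fpsDX -fpsC1 fpsDC add0r. Qed.

Lemma fpsDXn j : fpsD (X ^+ j) = j%:R * X ^+ j.-1 * (1 + X).
Proof.
case: j => [|j]; first by rewrite expr0 -fpsC1 fpsDC !mul0r.
by rewrite fpsDexp fpsDX.
Qed.

Lemma polarE k :
  polar k = \sum_(s < k.+1) fpsC (polar_coef k s) * (X ^+ (k - s) * (1 + X)).
Proof.
elim: k => [|k IH]; first by rewrite big_ord1 fpsC1 !mul1r.
have fpsD0 : fpsD 0 = 0 :> fps by rewrite -fpsC0 fpsDC fpsC0.
transitivity (\sum_(s < k.+1) fpsC (polar_coef k s) *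
    - (s.+1%:R * (X ^+ (k - s) * (1 + X)) + s%:R * (X ^+ (k.+1 - s) * (1 + X)))).
  rewrite [LHS]/= {}IH (big_morph _ (@fpsDD R) fpsD0) !mulr_sumr -sumrB.
  apply: eq_bigr => -[s /= sk] _; rewrite ltnS in sk.
  rewrite fpsDCM fpsDM fpsDXn fpsD1X subSn // exprS.
  have -> : k.+1%:R = (k - s)%:R + s.+1%:R :> fps by rewrite -natrD addnS subnK.
  case: (k - s)%N => [|j] /=; first by rewrite expr0; ring.
  by rewrite exprS; ring.
apply/funext => n; rewrite !fps_sum.
under [RHS]eq_bigr => s _ do rewrite fpsCM.
pose Z s := (X ^+ (k.+1 - s) * (1 + X)) n.
rewrite (polar_coef_sum k Z) -sumrN; apply: eq_bigr => s _.
rewrite fpsCM fpsN fpsE mulrN; congr (- (_ * (_ + _))).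
  by rewrite -(rmorph_nat fpsC) fpsCM /Z subSS.
by rewrite -(rmorph_nat fpsC) fpsCM.
Qed.

Variable b : fps.
Hypothesis bE : b * fps_expm1 R = 1.

(** (1 + z)/z = (b(t) + t)/t, and (d/dt)^k multiplies t^(n-1) by (n - 1) ... (n - k); the factor
    t^(k+1) clears the pole. In the induction the recursion of [polar] becomes t d/dt - (k + 1). *)
Lemma polar_log k :
  ell ^+ k.+1 * polar k =
  fpscomp (fpslog R) (fun n => (b n + (n == 1)%:R) * \prod_(i < k) (n%:R - i.+1%:R)).
Proof.
have l0 := fpslog0 R.
elim: k => [|k IH].
  rewrite (_ : (fun n => _) = b + X * 1); last first.
    by apply/funext => n; rewrite big_ord0 !mulr1.
  rewrite fpscompD (bernoulli_comp bE) fpscompXM //.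
  by rewrite -fpsC1 fpscompC fpsC1 /fpslog /=; ring.
set c : fps := fun n => _ in IH.
transitivity (fpscomp (fpslog R) (X * fps_deriv c + fpsC (- k.+1%:R) * c)); last first.
  congr fpscomp; apply/funext => n; rewrite big_ord_recr /= fpsE fpsCM.
  transitivity ((n%:R - k.+1%:R) * c n); last by rewrite /c; ring.
  by rewrite mulrBl mulNr; congr (_ - _); case: n => [|n]; rewrite ?fpsXM0 ?mul0r ?fpsXMS.
rewrite fpscompD fpscompXM // fpscompCM -fpsD_comp -IH fpsDM fpsDexp.
rewrite rmorphN rmorph_nat /fpslog /= [ell ^+ k.+2]exprS.
have XD : X * fpsD ell = 1 - (1 + X) * ell.
  by rewrite -[Y in Y - _](fpsD_log R) /fpslog fpsDM fpsDX; ring.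
transitivity (ell ^+ k.+1 * ell * X * fpsD (polar k) + k.+1%:R * ell ^+ k.+1 *
  polar k * (X * fpsD ell - 1)); first by rewrite XD; ring.
by rewrite exprS; ring.
Qed.

Definition polar_regular k : fps :=
  fun j => b (k.+1 + j)%N * \prod_(i < k) ((k.+1 + j)%:R - i.+1%:R).

Lemma bernoulli_coef0 : b 0%N = 1.
Proof.
have /(congr1 (fun f : fps => f 0%N)) := bE.
by rewrite fpsM big_ord1 /fps_expm1 factS fact0 invr1 mulr1.
Qed.

(* With [b_n] the Bernoulli numbers over [n!], [1 / z = sum_n b_n t^(n - 1)] for
   [t = ln (1 + z)]; applying [(d/dt)^k] isolates [t^(- k - 1)]. *)
Lemma polar_log_decomposition k : (0 < k)%N ->
  polar k = fpsC ((-1) ^+ k * k`!%:R) * (fps_pow ell (- k.+1%:R) : fps) +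
            X ^+ k.+1 * fpscomp (fpslog R) (polar_regular k).
Proof.
move=> k0; have l0 := fpslog0 R; have e0 := fps_ln1pz0 R.
have -> : polar k = (fps_pow ell (- k.+1%:R) : fps) * (ell ^+ k.+1 * polar k).
  by rewrite -(fps_pow_nat e0) mulrA [_ * (fps_pow _ _ : fps)]mulrC fps_powN // mul1r.
rewrite polar_log (_ : (fun n => _) =
    fpsC ((-1) ^+ k * k`!%:R) + X ^+ k.+1 * polar_regular k); last first.
  apply/funext => n; rewrite fpsE fpsXnM /fpsC; case: ltnP => [|kn].
    rewrite ltnS addr0; case: n => [_|n nk].
      rewrite bernoulli_coef0 addr0 mul1r mulr1n.
      under eq_bigr => i _ do rewrite sub0r -mulN1r.
      rewrite big_split /= prodr_const card_ord; congr (_ * _).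
      by rewrite fact_prod natr_prod big_add1 big_mkord.
    (* Degrees 1 to k carry a vanishing factor, so nothing lies between the pole and the regular
       part. *)
    by rewrite (bigD1 (Ordinal nk)) //= subrr mul0r mulr0.
  rewrite /polar_regular subnKC //.
  (* As k is positive, the correction in degree 1 does not reach the regular part. *)
  have n1 : (1 < n)%N by rewrite (leq_trans _ kn).
  by rewrite (gtn_eqF n1) (gtn_eqF (ltnW n1)) addr0 mulr0n add0r.
rewrite fpscompD fpscompC mulrDr mulrC; congr (_ + _).
rewrite fpscompXnM // exprMn -(fps_pow_nat e0) -!mulrA mulrCA; congr (_ * _).
by rewrite mulrA [_ * (fps_pow _ k.+1%:R : fps)]mulrC fps_powN // mul1r.
Qed.

End LogarithmPowers.

(** * Euler's formula for the even zeta values *)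

(** Induction on the list: with a new factor 1 + yX, the powers of y alone contribute y E_j, by the
    telescoping sum [tele]; what is left is the identity for E. *)
Lemma newton_identity (F : comNzRingType) (ys : seq F) (j : nat) :
  let E := \prod_(y <- ys) (1 + y *: 'X) : {poly F} in
  j.+1%:R * E`_j.+1 =
  \sum_(i < j.+1) (-1) ^+ i * (\sum_(y <- ys) y ^+ i.+1) * E`_(j - i).
Proof.
elim: ys j => [|y ys IH] j /=.
  rewrite !big_nil coef1 mulr0 big1 // => i _.
  by rewrite big_nil mulr0 mul0r.
set E := \prod_(z <- ys) _ in IH *; set E' := \prod_(z <- _) _.
have E'E : E' = E + y *: ('X * E).
  by rewrite /E' big_cons mulrDl mul1r -scalerAl.
have E'0 : E'`_0 = E`_0 by rewrite E'E coefD coefZ coefXM mulr0 addr0.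
have E'S m : E'`_m.+1 = E`_m.+1 + y * E`_m by rewrite E'E coefD coefZ coefXM.
have tele m : \sum_(i < m.+1) (-1) ^+ i * y ^+ i.+1 * E'`_(m - i) = y * E`_m.
  elim: m => [|m IHm]; first by rewrite big_ord1 mul1r E'0.
  rewrite big_ord_recl mul1r expr1 subn0 E'S mulrDr.
  under eq_bigr => i _ do rewrite lift0 subSS !exprS.
  rewrite (eq_bigr (fun i : 'I_m.+1 => - y * ((-1) ^+ i * y ^+ i.+1 * E'`_(m - i)))).
    by rewrite -mulr_sumr IHm; ring.
  by move=> i _; rewrite exprS; ring.
under eq_bigr => i _ do rewrite big_cons mulrDr mulrDl.
rewrite big_split /= tele E'S mulrDr IH.
case: j => [|j]; first by rewrite !big_ord1 E'0; ring.
pose p i := \sum_(y <- ys) y ^+ i.+1.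
have key : \sum_(i < j.+1) (-1) ^+ i * p i * E'`_(j.+1 - i) =
    \sum_(i < j.+1) (-1) ^+ i * p i * E`_(j.+1 - i) + y * (j.+1%:R * E`_j.+1).
  rewrite IH mulr_sumr -big_split; apply: eq_bigr => i _ /=.
  by rewrite /p subSn ?E'S -1?ltnS //; ring.
rewrite ![\sum_(i < j.+2) _]big_ord_recr /= !subnn E'0 -/(p j.+1) key.
by ring.
Qed.

Lemma poly_prod_roots (F : fieldType) (p : {poly F}) (rs : seq F) :
  p`_0 = 1 -> size p = (size rs).+1 -> all (root p) rs -> uniq rs ->
  0 \notin rs -> p = \prod_(r <- rs) (1 + (- r^-1) *: 'X).
Proof.
move=> p0 sp rp ur r0.
have E := all_roots_prod_XsubC sp rp; rewrite uniq_rootsE in E; have {}E := E ur.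
have F1 r : r \in rs -> 'X - r%:P = (- r)%:P * (1 + (- r^-1) *: 'X).
  move=> rrs; have rn0 : r != 0 by apply: contraNneq r0 => <-.
  rewrite mulrDr mulr1 -mul_polyC mulrA -polyCM mulrNN divff // polyC1 mul1r.
  by rewrite polyCN addrC.
have E2 : \prod_(z <- rs) ('X - z%:P) =
    (\prod_(z <- rs) (- z))%:P * \prod_(r <- rs) (1 + (- r^-1) *: 'X).
  by rewrite rmorph_prod -big_split; apply: eq_big_seq => r /F1.
have c0 : (\prod_(r <- rs) (1 + (- r^-1) *: 'X))`_0 = 1.
  rewrite -horner_coef0 horner_prod big1 // => r _.
  by rewrite hornerD hornerZ hornerX hornerC mulr0 addr0.
rewrite [LHS]E E2 -mul_polyC mulrA -polyCM.
suff -> : lead_coef p * \prod_(z <- rs) - z = 1 by rewrite polyC1 mul1r.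
transitivity p`_0 => //; have -> : p`_0 = (lead_coef p *: \prod_(z <- rs) ('X - z%:P))`_0 by rewrite -E.
rewrite E2 -mul_polyC mulrA -polyCM.
by rewrite coefCM c0 mulr1.
Qed.

(** * Cotangents at the angles pi k / N *)

Section Cotangents.
Variable R : realType.
Implicit Types x : R.

Lemma sum_odd_binomials n (s : R) :
  \sum_(j < n.+2) 'C(n.+1, j.*2.+1)%:R * s ^+ j =
  \sum_(j < n.+1) 'C(n, j.*2.+1)%:R * s ^+ j + \sum_(j < n.+1) 'C(n, j.*2)%:R * s ^+ j.
Proof.
rewrite big_ord_recr /= bin_small ?mul0r ?addr0; last by lia.
by rewrite -big_split; apply: eq_bigr => j _; rewrite binS natrD mulrDl.
Qed.

Lemma sum_even_binomials n (s : R) :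
  \sum_(j < n.+2) 'C(n.+1, j.*2)%:R * s ^+ j =
  \sum_(j < n.+1) 'C(n, j.*2)%:R * s ^+ j +
  s * \sum_(j < n.+1) 'C(n, j.*2.+1)%:R * s ^+ j.
Proof.
rewrite big_ord_recl [in RHS]big_ord_recl /= !bin0 mul1r expr0 -addrA; congr (_ + _).
rewrite mulr_sumr.
have -> : \sum_(i < n) 'C(n, (bump 0 i).*2)%:R * s ^+ bump 0 i =
    \sum_(i < n.+1) 'C(n, i.+1.*2)%:R * s ^+ i.+1.
  by rewrite [RHS]big_ord_recr /= bin_small ?mul0r ?addr0 //; lia.
rewrite -big_split; apply: eq_bigr => j _; rewrite /bump /= add1n doubleS binS natrD.
by rewrite exprS; ring.
Qed.

(** De Moivre's formula divided by cos^n x, in real and imaginary parts; [s] is the square of i tan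
    x, and Pascal's rule drives the induction. *)
Lemma multiple_angle x n : cos x != 0 ->
  let s := - tan x ^+ 2 in
  cos (n%:R * x) = cos x ^+ n * \sum_(j < n.+1) 'C(n, j.*2)%:R * s ^+ j /\
  sin (n%:R * x) = cos x ^+ n * tan x * \sum_(j < n.+1) 'C(n, j.*2.+1)%:R * s ^+ j.
Proof.
move=> cx s; elim: n => [|n [IHc IHs]].
  rewrite mul0r cos0 sin0 !big_ord1 /= bin0 bin_small // mul0r !mulr0.
  by rewrite expr0 !mulr1.
have tE : sin x = tan x * cos x by rewrite /tan divfK.
rewrite -natr1 mulrDl mul1r cosD sinD IHc IHs sum_odd_binomials sum_even_binomials.
by rewrite tE exprS /s; split; ring.
Qed.

Lemma sin_le_id x : 0 <= x -> sin x <= x.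
Proof.
move=> x0.
have [|c _] := @MVT_segment R (fun y => y - sin y) (fun y => 1 - cos y) 0 x x0.
  apply: continuous_subspaceT => y; apply: continuousB; first exact: cvg_id.
  exact: continuous_sin.
rewrite sin0 !subr0 => E; rewrite -subr_ge0 E mulr_ge0 // subr_ge0.
Qed.

Lemma id_le_tan x : 0 <= x < pi / 2 -> x <= tan x.
Proof.
move=> /andP[x0 xpi].
have pos y : 0 <= y <= x -> 0 < cos y.
  move=> /andP[y0 yx]; apply: cos_gt0_pihalf; rewrite (le_lt_trans yx) // andbT.
  by rewrite (lt_le_trans _ y0) // oppr_lt0 divr_gt0 ?pi_gt0.
have [z zI||c cI] :=
    @MVT_segment R (fun y => tan y - y) (fun y => (cos y) ^- 2 - 1) 0 x x0.
- apply: is_deriveB; apply: is_derive_tan; rewrite gt_eqF // pos //.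
  by move: zI; rewrite in_itv /= => /andP[z0 zx]; rewrite !ltW.
- apply/continuous_in_subspaceT => z; rewrite (@mem_setE R) in_itv /= => zI.
  by apply: continuousB; [apply: continuous_tan; rewrite gt_eqF // pos | exact: cvg_id].
rewrite tan0 !subr0 => E; rewrite -subr_ge0 E mulr_ge0 // cos2_tan2.
  by rewrite addrAC subrr add0r sqr_ge0.
by rewrite gt_eqF // pos //; move: cI; rewrite in_itv.
Qed.

Lemma expr_sub_le (a c : R) K : 0 <= c -> c <= a -> a <= 1 ->
  0 <= a ^+ K - c ^+ K <= K%:R * (a - c).
Proof.
move=> c0 ca a1; have a0 := le_trans c0 ca.
rewrite subr_ge0 lerXn2r //=; elim: K => [|K IH]; first by rewrite subrr mul0r.
rewrite (_ : _ - _ = a * (a ^+ K - c ^+ K) + c ^+ K * (a - c)); last by rewrite !exprS; ring.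
rewrite -natr1 mulrDl mul1r lerD //.
  apply: le_trans IH; rewrite ler_piMl // subr_ge0 lerXn2r //.
rewrite ler_piMl ?subr_ge0 // exprn_ile1 //; exact: le_trans ca a1.
Qed.

Definition angle (M k : nat) : R := pi * k.+1%:R / M.*2.+1%:R.

(** cot^2 of the angle over (2N)^2, N = 2M + 1. This scaling gives the limit (2 pi (k + 1))^(-2) as
    M grows and keeps the values in [0, 1] for k < M. *)
Definition cotsq (M k : nat) : R := (M.*2.+1.*2%:R * tan (angle M k)) ^- 2.

Definition cotsq_sum (K M : nat) : R := \sum_(k < M) cotsq M k ^+ K.

(** The elementary symmetric functions of the numbers [cotsq M k], k < M, read off the expansion of
    sin(N x) / (N cos^N x tan x) in powers of - tan^2 x. *)
Definition cotsq_coef (j M : nat) : R :=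
  'C(M.*2.+1, j.*2.+1)%:R / (M.*2.+1%:R * M.*2.+1.*2%:R ^+ j.*2).

Lemma angle_itv M k : (k < M)%N -> 0 < angle M k < pi / 2.
Proof.
move=> kM; rewrite /angle divr_gt0 ?mulr_gt0 ?pi_gt0 //=.
rewrite -mulrA ltr_pM2l ?pi_gt0 // ltr_pdivrMr // mulrC ltr_pdivlMr //.
by rewrite -natrM ltr_nat; lia.
Qed.

Lemma sin_natpi k : sin (pi *+ k) = 0 :> R.
Proof.
elim: k => [|k IH]; first by rewrite mulr0n sin0.
by rewrite mulrSr sinDpi IH oppr0.
Qed.

Lemma cotsq_sin M k : (k < M)%N ->
  \sum_(j < M.+1) 'C(M.*2.+1, j.*2.+1)%:R * (- tan (angle M k) ^+ 2) ^+ j = 0.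
Proof.
move=> kM; have /andP[a0 a2] := angle_itv kM.
have c0 : cos (angle M k) != 0.
  by rewrite gt_eqF // cos_gt0_pihalf // a2 andbT (lt_trans _ a0) // oppr_lt0 divr_gt0 ?pi_gt0.
have t0 : tan (angle M k) != 0 by rewrite gt_eqF // (lt_le_trans a0) // id_le_tan // ltW.
have [_ /esym] := multiple_angle M.*2.+1 c0.
rewrite (_ : _%:R * angle M k = pi *+ k.+1); last first.
  by rewrite /angle mulrC divfK // mulr_natr.
rewrite sin_natpi.
have ct0 : cos (angle M k) ^+ M.*2.+1 * tan (angle M k) != 0.
  by rewrite mulf_neq0 // expf_neq0.
rewrite -[X in _ = X -> _](mulr0 (cos (angle M k) ^+ M.*2.+1 * tan (angle M k))).
move/(mulfI ct0).
rewrite (@big_ord_extend _ (fun j => 'C(M.*2.+1, j.*2.+1)%:R * (- tan (angle M k) ^+ 2) ^+ j) M.+1) //.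
  by lia.
by move=> i Mi; rewrite bin_small ?mul0r //; lia.
Qed.

End Cotangents.

(** * Even zeta values as limits of cotangent sums *)

Section EulerZeta.
Variable R : realType.

Lemma tan_angle_gt0 M k : (k < M)%N -> 0 < tan (angle R M k).
Proof.
move=> kM; have /andP[a0 a2] := angle_itv R kM.
by rewrite (lt_le_trans a0) // id_le_tan // ltW.
Qed.

(* The roots of the left-hand side come from [sin (N x) = 0] at [x = pi (k + 1) / N],
   [N = 2 M + 1]. *)
Lemma cotsq_product M :
  \poly_(j < M.+1) cotsq_coef R j M = \prod_(y <- [seq cotsq R M k | k <- iota 0 M]) (1 + y *: 'X).
Proof.
pose r k := - (M.*2.+1.*2%:R * tan (angle R M k)) ^+ 2.
rewrite (@poly_prod_roots _ (\poly_(j < M.+1) cotsq_coef R j M) [seq r k | k <- iota 0 M]).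
- rewrite !big_map; apply: eq_bigr => k _.
  by rewrite /r /cotsq invrN opprK.
- rewrite coef_poly /= /cotsq_coef bin1 expr0 mulr1 divff //.
- rewrite size_map size_iota size_poly_eq // /cotsq_coef binn mul1r invr_eq0.
  by rewrite mulf_neq0 // expf_neq0.
- apply/allP => x /mapP[k]; rewrite mem_iota add0n => kM ->; apply/rootP.
  rewrite horner_poly.
  transitivity (M.*2.+1%:R^-1 * \sum_(j < M.+1) 'C(M.*2.+1, j.*2.+1)%:R * (- tan (angle R M k) ^+ 2) ^+ j).
    rewrite mulr_sumr; apply: eq_bigr => j _.
    set Y : R := M.*2.+1.*2%:R.
    have -> : r k ^+ j = Y ^+ j.*2 * (- tan (angle R M k) ^+ 2) ^+ j.
      by rewrite -mul2n exprM -exprMn /r -/Y; congr (_ ^+ j); ring.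
    have Yj : Y ^+ j.*2 != 0 by rewrite expf_neq0 // pnatr_eq0.
    rewrite /cotsq_coef -/Y invfM !mulrA; congr (_ * _).
    by rewrite mulrVK ?unitfE // mulrC.
  by rewrite cotsq_sin ?mulr0.
- rewrite map_inj_in_uniq ?iota_uniq // => i k.
  rewrite !mem_iota !add0n => iM kM /oppr_inj /eqP.
  have P l : (l < M)%N -> 0 <= M.*2.+1.*2%:R * tan (angle R M l).
    by move=> lM; apply: mulr_ge0 => //; apply/ltW/tan_angle_gt0.
  rewrite (eqrXn2 _ (P _ iM) (P _ kM)) // => /eqP /mulfI.
  rewrite pnatr_eq0 => /(_ isT) /tan_inj.
  have I l : (l < M)%N -> angle R M l \in `]- (pi / 2), pi / 2[.
    move=> /(angle_itv R) /andP[l0 l2]; rewrite in_itv /= l2 andbT (lt_trans _ l0) //.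
    by rewrite oppr_lt0 divr_gt0 ?pi_gt0.
  move=> /(_ (I _ iM) (I _ kM)); rewrite /angle => /mulIf.
  rewrite invr_eq0 pnatr_eq0 => /(_ isT) /mulfI.
  rewrite gt_eqF ?pi_gt0 // => /(_ isT) /eqP.
  by rewrite eqr_nat eqSS => /eqP.
- apply/mapP => -[k]; rewrite mem_iota add0n => kM /esym/eqP.
  by rewrite oppr_eq0 expf_eq0 /= mulf_eq0 pnatr_eq0 /= gt_eqF // tan_angle_gt0.
Qed.

Lemma cotsq_newton M j :
  j.+1%:R * cotsq_coef R j.+1 M =
  \sum_(i < j.+1) (-1) ^+ i * cotsq_sum R i.+1 M * cotsq_coef R (j - i) M.
Proof.
have C i : (\poly_(j < M.+1) cotsq_coef R j M)`_i = cotsq_coef R i M.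
  rewrite coef_poly; case: ltnP => // iM.
  by rewrite /cotsq_coef bin_small ?mul0r //; lia.
have := newton_identity [seq cotsq R M k | k <- iota 0 M] j.
rewrite /= -cotsq_product C => ->; apply: eq_bigr => i _.
rewrite C; congr (_ * _ * _).
by rewrite big_map /cotsq_sum -[X in iota 0 X]subn0 -/(index_iota 0 M) big_mkord.
Qed.

Lemma cvg_inv_odd : (fun M => (M.*2.+1%:R : R)^-1) @ \oo --> (0 : R).
Proof.
apply: (@squeeze_cvgr _ _ _ _ (cst 0) (@harmonic R)); last 2 first.
- exact: cvg_cst.
- exact: cvg_harmonic.
near=> M; rewrite invr_ge0 ler0n /= lef_pV2 ?posrE // ler_nat; lia.
Unshelve. all: by end_near. Qed.

Lemma cvg_bin_odd m :
  (fun M => 'C(M.*2.+1, m)%:R / M.*2.+1%:R ^+ m : R) @ \oo --> (m`!%:R^-1 : R).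
Proof.
elim: m => [|m IH].
  rewrite (_ : (fun M => _) = cst 1) ?fact0 ?invr1; first exact: cvg_cst.
  by apply/funext => M; rewrite bin0 expr0 divr1.
have -> : (fun M => 'C(M.*2.+1, m.+1)%:R / M.*2.+1%:R ^+ m.+1 : R) =
    (fun M => 'C(M.*2.+1, m)%:R / M.*2.+1%:R ^+ m * (1 - m%:R * M.*2.+1%:R^-1) / m.+1%:R).
  apply/funext => M; set N := M.*2.+1.
  have N0 : N%:R != 0 :> R by rewrite pnatr_eq0.
  have E : m.+1%:R * 'C(N, m.+1)%:R = (N%:R - m%:R) * 'C(N, m)%:R :> R.
    have [mN|Nm] := leqP m N; first by rewrite -natrB // -!natrM mul_bin_left.
    by rewrite !bin_small ?mulr0 // ltnW.
  apply: (mulfI (_ : m.+1%:R != 0 :> R)); first by rewrite pnatr_eq0.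
  rewrite mulrA E exprS; field.
  by rewrite expf_neq0 // N0 nat1r pnatr_eq0.
rewrite factS natrM invfM mulrC -[X in X / _]mulr1 -[X in _ * X / _]subr0 -(mulr0 m%:R).
apply: cvgM; last exact: cvg_cst.
apply: cvgM => //; apply: cvgB; first exact: cvg_cst.
by apply: cvgM; [exact: cvg_cst | exact: cvg_inv_odd].
Qed.

(** The coefficient of X^(2j) in sinh(X/2)/(X/2), which is the limit of [cotsq_coef j]. *)
Definition sinh_coef (j : nat) : R := (j.*2.+1`!%:R * 4 ^+ j)^-1.

Lemma cvg_cotsq_coef j : cotsq_coef R j @ \oo --> sinh_coef j.
Proof.
have -> : cotsq_coef R j =
    (fun M => 'C(M.*2.+1, j.*2.+1)%:R / M.*2.+1%:R ^+ j.*2.+1 * (4 ^+ j)^-1).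
  apply/funext => M; rewrite /cotsq_coef -[M.*2.+1.*2]muln2 natrM exprMn.
  rewrite exprS -[in 2 ^+ j.*2]mul2n exprM (_ : 2 ^+ 2 = 4); last by ring.
  by field; rewrite !expf_neq0 //= nat1r pnatr_eq0.
rewrite /sinh_coef invfM; apply: cvgM; [exact: cvg_bin_odd | exact: cvg_cst].
Qed.

Lemma cvg_big_sum (n : nat) (F : nat -> nat -> R) (l : nat -> R) :
  (forall i, (i < n)%N -> F i @ \oo --> l i) ->
  (fun M => \sum_(i < n) F i M) @ \oo --> \sum_(i < n) l i.
Proof.
elim: n => [_|n IH H].
  under eq_fun do rewrite big_ord0; rewrite big_ord0; exact: cvg_cst.
under eq_fun do rewrite big_ord_recr /=.
rewrite big_ord_recr; apply: cvgD; last exact: H.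
by apply: IH => i i_n; apply: H; rewrite ltnW.
Qed.

Definition cotsq_limit (K : nat) : R := limn (cotsq_sum R K).

(** Strong induction: since [cotsq_coef 0] is 1, Newton's identity expresses the power sum of order
    K + 1 through lower ones and convergent coefficients. *)
Lemma cvg_cotsq_sum K : cotsq_sum R K.+1 @ \oo --> cotsq_limit K.+1.
Proof.
suff [l cl] : exists l : R, cotsq_sum R K.+1 @ \oo --> l.
  by rewrite /cotsq_limit (cvg_lim (@norm_hausdorff _ _) cl).
have [m] := ubnP K; elim: m K => // m IH K /ltnSE Km.
have F0 M : cotsq_coef R 0 M = 1 by rewrite /cotsq_coef bin1 mulr1 divff.
have -> : cotsq_sum R K.+1 = (fun M => (-1) ^+ K * (K.+1%:R * cotsq_coef R K.+1 M -
    \sum_(i < K) (-1) ^+ i * cotsq_sum R i.+1 M * cotsq_coef R (K - i) M)).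
  apply/funext => M; rewrite cotsq_newton big_ord_recr /= subnn F0 addrAC subrr add0r.
  by rewrite mulr1 mulrA -expr2 sqrr_sign mul1r.
pose l i := limn (cotsq_sum R i.+1).
exists ((-1) ^+ K * (K.+1%:R * sinh_coef K.+1 -
    \sum_(i < K) (-1) ^+ i * l i * sinh_coef (K - i))).
apply: cvgM; first exact: cvg_cst.
apply: cvgB; first by apply: cvgM; [exact: cvg_cst | exact: cvg_cotsq_coef].
apply: (@cvg_big_sum K (fun i M => (-1) ^+ i * cotsq_sum R i.+1 M * cotsq_coef R (K - i) M)
  (fun i => (-1) ^+ i * l i * sinh_coef (K - i))) => i iK.
apply: cvgM; last exact: cvg_cotsq_coef.
apply: cvgM; first exact: cvg_cst.
by have [x cx] := IH i (leq_trans iK Km); rewrite /l (cvg_lim (@norm_hausdorff _ _) cx).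
Qed.

(** Newton's identities in the limit. As generating functions they identify the limits, up to sign,
    with the coefficients of a logarithmic derivative of sinh(X/2)/(X/2). *)
Lemma cotsq_limit_newton j :
  j.+1%:R * sinh_coef j.+1 =
  \sum_(i < j.+1) (-1) ^+ i * cotsq_limit i.+1 * sinh_coef (j - i).
Proof.
have c1 : (fun M => j.+1%:R * cotsq_coef R j.+1 M) @ \oo --> j.+1%:R * sinh_coef j.+1.
  by apply: cvgM; [exact: cvg_cst | exact: cvg_cotsq_coef].
have c2 : (fun M => \sum_(i < j.+1) (-1) ^+ i * cotsq_sum R i.+1 M * cotsq_coef R (j - i) M)
    @ \oo --> \sum_(i < j.+1) (-1) ^+ i * cotsq_limit i.+1 * sinh_coef (j - i).
  apply: (@cvg_big_sum j.+1
    (fun i M => (-1) ^+ i * cotsq_sum R i.+1 M * cotsq_coef R (j - i) M)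
    (fun i => (-1) ^+ i * cotsq_limit i.+1 * sinh_coef (j - i))) => i _.
  apply: cvgM; last exact: cvg_cotsq_coef.
  by apply: cvgM; [exact: cvg_cst | exact: cvg_cotsq_sum].
rewrite -(cvg_lim (@norm_hausdorff _ _) c1) -(cvg_lim (@norm_hausdorff _ _) c2).
by congr (limn _); apply/funext => M; rewrite cotsq_newton.
Qed.

Lemma cotsq_bounds M k : (k < M)%N ->
  let a := (2 * pi * k.+1%:R : R) ^- 2 in
  [/\ 0 <= cotsq R M k, cotsq R M k <= a, a <= 1 &
   a - cotsq R M k <= M.*2.+1%:R ^- 2].
Proof.
move=> kM a; have /andP[x0 x2] := angle_itv R kM.
have t0 := tan_angle_gt0 kM; set x := angle R M k in x0 x2 t0.
set Y : R := M.*2.+1.*2%:R.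
have Y0 : 0 < Y by rewrite ltr0n.
have aE : a = Y ^- 2 * x ^- 2.
  rewrite -invfM -exprMn /a; congr (_ ^- 2).
  rewrite /x /angle /Y -muln2 natrM; field.
  by rewrite nat1r pnatr_eq0.
have cE : cotsq R M k = Y ^- 2 * tan x ^- 2 by rewrite -invfM -exprMn.
have xt : x <= tan x by apply: id_le_tan; rewrite ltW.
have s0 : 0 < sin x by apply: sin_gt0_pihalf; rewrite x0.
have sx : sin x <= x by apply: sin_le_id; exact: ltW.
have tE : tan x ^- 2 = (sin x) ^- 2 - 1.
  have -> : tan x ^- 2 = cos x ^+ 2 / sin x ^+ 2 by rewrite /tan expr_div_n invf_div.
  have -> : cos x ^+ 2 = 1 - sin x ^+ 2 by rewrite -(cos2Dsin2 x) addrK.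
  by rewrite mulrBl mul1r divff // expf_neq0 // gt_eqF.
have Yi : 0 <= Y ^- 2 by rewrite invr_ge0 sqr_ge0.
have p1 : 1 <= 2 * pi * k.+1%:R :> R.
  by apply: mulr_ege1; [have := pi_ge2 R; lra | rewrite ler1n].
split.
- by rewrite cE mulr_ge0 // invr_ge0 sqr_ge0.
- rewrite cE aE ler_wpM2l // lef_pV2 ?posrE ?exprn_gt0 //.
  by rewrite lerXn2r // nnegrE ltW.
- by rewrite /a invf_le1 ?exprn_ege1 // exprn_gt0 // (lt_le_trans _ p1).
- have h : x ^- 2 <= sin x ^- 2.
    by rewrite lef_pV2 ?posrE ?exprn_gt0 // lerXn2r // nnegrE ltW.
  rewrite aE cE -mulrBr tE; apply: (@le_trans _ _ (Y ^- 2 * 1)).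
    by rewrite ler_wpM2l //; lra.
  rewrite mulr1 lef_pV2 ?posrE ?exprn_gt0 ?ltr0n //.
  by rewrite lerXn2r // ?nnegrE // ler_nat; lia.
Qed.

(* [cot^2 x <= x^(-2) <= 1 + cot^2 x] squeezes the cotangent sums. *)
Lemma zeta_cotsq K : zeta R (2 * K.+1) = (2 * pi) ^+ (2 * K.+1) * cotsq_limit K.+1.
Proof.
set s := (2 * K.+1)%N; pose p : R := 2 * pi.
have p0 : p != 0 by rewrite mulf_neq0 // gt_eqF ?pi_gt0.
pose z M : R := \sum_(k < M) ((p * k.+1%:R) ^- 2) ^+ K.+1.
have zE : series (fun n => n.+1%:R ^- s : R) = (fun M => p ^+ s * z M).
  apply/funext => M; rewrite seriesEord /z mulr_sumr; apply: eq_bigr => k _.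
  rewrite exprVn -exprM -/s [(p * _) ^+ s]exprMn [(p ^+ s * _)^-1]invfM mulrA mulfV ?mul1r //.
  by rewrite expf_neq0.
suff cz : z @ \oo --> cotsq_limit K.+1.
  rewrite /zeta zE; apply: (cvg_lim (@norm_hausdorff _ _)).
  by apply: cvgM => //; exact: cvg_cst.
have -> : z = (fun M => cotsq_sum R K.+1 M + (z M - cotsq_sum R K.+1 M)).
  by apply/funext => M; rewrite addrC subrK.
rewrite -[X in _ --> X]addr0; apply: cvgD; first exact: cvg_cotsq_sum.
(* Each of the M terms is off by at most (K + 1)/N^2 with N = 2M + 1, so the total is at most (K +
   1)/N. *)
apply: (@squeeze_cvgr _ _ _ _ (cst 0) (fun M => K.+1%:R * M.*2.+1%:R^-1)); last 2 first.
- exact: cvg_cst.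
- rewrite -[X in _ --> X](mulr0 K.+1%:R).
  by apply: cvgM; [exact: cvg_cst | exact: cvg_inv_odd].
apply: nearW => M; rewrite /z /cotsq_sum -sumrB.
have B (k : 'I_M) := cotsq_bounds (ltn_ord k).
apply/andP; split.
  apply: sumr_ge0 => k _; have [c0 ca a1 _] := B k.
  by have /andP[] := expr_sub_le K.+1 c0 ca a1.
apply: (@le_trans _ _ (\sum_(k < M) K.+1%:R * M.*2.+1%:R ^- 2)).
  apply: ler_sum => k _; have [c0 ca a1 ac] := B k.
  have /andP[_ h] := expr_sub_le K.+1 c0 ca a1; apply: le_trans h _.
  by rewrite ler_wpM2l.
rewrite sumr_const card_ord -mulrnAr ler_wpM2l // -mulr_natl expr2 invfM mulrA.
by rewrite ler_piMl // ler_pdivrMr // mul1r ler_nat; lia.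
Qed.

End EulerZeta.

(** * The generating series of the Bernoulli numbers *)

Section Bernoulli.
Variable R : realType.
Local Notation C := R[i].
Local Notation fps := (fps R).
Local Notation fpsC := (@fpsC R).
Local Notation X := (fpsX R).
Local Notation fps_deriv := (@fps_deriv R).

Definition fps_exp_lin (x : C) : fps := fun n => x ^+ n / n`!%:R.

Lemma fps_exp_linD x y : fps_exp_lin (x + y) = fps_exp_lin x * fps_exp_lin y.
Proof.
apply/funext => n; rewrite fpsM /fps_exp_lin addrC exprDn mulr_suml.
apply: eq_bigr => i _; rewrite -mulr_natr.
have fn0 k : k`!%:R != 0 :> C by rewrite pnatr_eq0 -lt0n fact_gt0.
have ni : (i <= n)%N by rewrite -ltnS.
have <- : 'C(n, i)%:R * (i`!%:R * (n - i)`!%:R) = n`!%:R :> C.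
  by rewrite -!natrM bin_fact.
have c0 : 'C(n, i)%:R != 0 :> C by rewrite pnatr_eq0 -lt0n bin_gt0.
by field; rewrite c0 !fn0.
Qed.

Lemma fps_exp_lin0 : fps_exp_lin 0 = 1.
Proof.
apply/funext => -[|n]; rewrite /fps_exp_lin fps1; first by rewrite expr0 fact0 divr1.
by rewrite expr0n mul0r.
Qed.

Lemma fps_deriv_exp_lin x : fps_deriv (fps_exp_lin x) = fpsC x * fps_exp_lin x.
Proof.
apply/funext => n; rewrite fpsCM /fps_deriv /fps_deriv /fps_exp_lin factS natrM exprS.
by field; rewrite nat1r !pnatr_eq0 -lt0n fact_gt0.
Qed.

(* sinh(X/2) / (X/2) *)
Let H : fps := fun n => if odd n then 0 else (sinh_coef R n./2)%:C.

(** Half of (X/2) coth(X/2) - 1, as [H_log_derivative] shows. *)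
Definition cot_series : fps := fun n =>
  if odd n || (n == 0) then 0 else ((-1) ^+ (n./2).-1 * cotsq_limit R n./2)%:C.

Lemma XH : X * H = fps_exp_lin (1/2) - fps_exp_lin (- (1/2)).
Proof.
apply/funext => -[|n]; rewrite fpsE fpsN /fps_exp_lin ?fpsXM0 ?fpsXMS; first by rewrite !expr0 subrr.
rewrite /H -mulrBl exprNn -signr_odd /=; case on: (odd n) => /=.
  by rewrite div1r expr0 mul1r subrr mul0r.
rewrite expr1 mulN1r opprK /sinh_coef.
have nE : n = (n./2).*2 by rewrite -[LHS]odd_double_half on.
move: (n./2) nE => j ->; rewrite fmorphV rmorphM rmorphXn /= !rmorph_nat.
rewrite invfM mulrC; congr (_ / _).
rewrite div1r exprVn exprS -mul2n exprM (_ : 2 ^+ 2 = 4 :> C); last by ring.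
by field; rewrite expf_neq0 // pnatr_eq0.
Qed.

(** The limit of Newton's identities; the factor 2 arises because X d/dX counts the degree 2j where
    the identities count j. *)
Lemma H_log_derivative : X * fps_deriv H = fpsC 2 * cot_series * H.
Proof.
apply/funext => n; rewrite -mulrA fpsCM.
have -> : (X * fps_deriv H) n = n%:R * H n.
  by case: n => [|n]; rewrite ?fpsXM0 ?mul0r // fpsXMS.
have [on|en] := boolP (odd n).
  rewrite /H on mulr0 fpsM big1 ?mulr0 // => i _; rewrite /cot_series.
  case: ifP => [_|/norP[ei _]]; first by rewrite mul0r.
  by rewrite oddB ?on ?(negPf ei) ?mulr0 // -ltnS.
rewrite -(odd_double_half n) (negPf en) add0n; set j := n./2.
rewrite fpsM; pose F i := cot_series i * H (j.*2 - i)%N.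
have -> : \sum_(i < j.*2.+1) F i = \sum_(i < j.+1) F i.*2.
  suff E k : \sum_(i < k.*2.+1) F i = \sum_(i < k.+1) F i.*2 by exact: E.
  elim: k => [|k IH]; first by rewrite !big_ord1.
  rewrite doubleS 2!big_ord_recr IH [in RHS]big_ord_recr /=; congr (_ + _).
  by rewrite {2}/F /cot_series /= odd_double /= mul0r addr0.
rewrite {}/F.
rewrite big_ord_recl {1}/cot_series mul0r add0r.
case: j => [|j]; first by rewrite big_ord0 mulr0 mul0r.
rewrite -mul2n natrM -mulrA; congr (_ * _); rewrite mul2n.
rewrite {1}/H odd_double doubleK -(rmorph_nat (real_complex R)) -rmorphM /=.
rewrite cotsq_limit_newton rmorph_sum; apply: eq_bigr => i _.
rewrite /cot_series /H /bump /= add1n !odd_double doubleK orbF /= rmorphM.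
by rewrite -doubleB odd_double doubleK subSS.
Qed.

(** X/(e^X - 1) written as (X/2) coth(X/2) - X/2, so that its even coefficients are visibly zeta
    values. *)
Definition bernoulli_series : fps := 1 - fpsC (1/2) * X + fpsC 2 * cot_series.

(** Factor (e^X - 1)/X = e^(X/2) H with H = sinh(X/2)/(X/2). It remains to see that
    [bernoulli_series] times H is e^(-X/2); here H + X H' is the derivative of X H, that is
    cosh(X/2), and X H = 2 sinh(X/2). *)
Lemma bernoulli_expm1 : bernoulli_series * fps_expm1 R = 1.
Proof.
have eE : fps_expm1 R = fps_exp_lin (1/2) * H.
  apply: fpsX_inj; rewrite mulrCA XH mulrBr -!fps_exp_linD subrr fps_exp_lin0.
  apply/funext => -[|n]; rewrite ?fpsXM0 ?fpsXMS fpsE fpsN fps1 /fps_exp_lin.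
    by rewrite expr0 divr1 subrr.
  by rewrite -splitr expr1n div1r subr0.
have XDH : H + X * fps_deriv H =
    fpsC (1/2) * (fps_exp_lin (1/2) + fps_exp_lin (- (1/2))).
  have dX : fps_deriv X = 1.
    apply/funext => n; rewrite fps1 /fps_deriv /fps_deriv /fpsX eqSS.
    by case: n => [|n]; rewrite ?mulr1 ?mulr0.
  have := fps_derivM X H; rewrite dX mul1r => <-; rewrite XH.
  rewrite (_ : fps_exp_lin (1/2) - _ =
      fps_exp_lin (1/2) + fpsC (-1) * fps_exp_lin (- (1/2))); last first.
    by rewrite rmorphN /= fpsC1 mulN1r.
  rewrite fps_derivD fps_derivM fps_derivC mul0r add0r !fps_deriv_exp_lin !rmorphN /= fpsC1.
  by ring.
rewrite eE mulrCA /bernoulli_series.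
have -> : (1 - fpsC (1 / 2) * X + fpsC 2 * cot_series) * H = fps_exp_lin (- (1/2)).
  transitivity ((H + X * fps_deriv H) - fpsC (1/2) * (X * H)).
    by rewrite H_log_derivative; ring.
  rewrite XDH XH.
  have h2 : fpsC (1/2) + fpsC (1/2) = 1 by rewrite -rmorphD /= -splitr fpsC1.
  transitivity ((fpsC (1/2) + fpsC (1/2)) * fps_exp_lin (- (1/2))); first by ring.
  by rewrite h2 mul1r.
by rewrite -fps_exp_linD subrr fps_exp_lin0.
Qed.

Lemma bernoulli_seriesE n : (1 < n)%N -> bernoulli_series n = 2 * cot_series n.
Proof.
case: n => [|[|n]] // _; rewrite /bernoulli_series fpsE fpsE fpsN !fpsCM fps1 /fpsX /=.
by rewrite mulr0 subr0 add0r.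
Qed.

Lemma twopii_sqr : twopii R ^+ 2 = - ((2 * pi) ^+ 2)%:C.
Proof.
by rewrite expr2 /twopii; apply/eqP; rewrite eq_complex /=; apply/andP; split; apply/eqP; ring.
Qed.

Lemma bernoulli_even K :
  bernoulli_series (2 * K.+1) = - (2 * (zeta R (2 * K.+1))%:C) / twopii R ^+ (2 * K.+1).
Proof.
rewrite bernoulli_seriesE; last by lia.
have e2 : odd (2 * K.+1) = false by rewrite mul2n odd_double.
have h2 : (2 * K.+1)./2 = K.+1 by rewrite mul2n doubleK.
rewrite /cot_series e2 h2 muln_eq0 /= zeta_cotsq !exprM twopii_sqr.
set x := (2 * pi) ^+ 2; have x0 : (x%:C) != 0.
  by rewrite fmorph_eq0 expf_neq0 // mulf_neq0 // gt_eqF // pi_gt0.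
clearbody x; rewrite !rmorphM !rmorphXn /= rmorphN rmorph1 [(- x%:C) ^+ _]exprNn.
have xK : x%:C ^+ K.+1 != 0 by rewrite expf_neq0.
rewrite [(-1) ^+ K.+1]exprS; rewrite -signr_odd; case: (odd K).
  by rewrite expr1; field.
by rewrite expr0; field.
Qed.

Lemma bernoulli_odd n : (1 < n)%N -> odd n -> bernoulli_series n = 0.
Proof. by move=> n1 on; rewrite bernoulli_seriesE // /cot_series on mulr0. Qed.

End Bernoulli.

(** * Traces *)

Section Subspaces.
Variables (K : fieldType) (X : lmodType K).
Implicit Types (S : set X).

Lemma subspace0 S : subspace S -> S 0. Proof. by case. Qed.

Lemma subspaceZ S k x : subspace S -> S x -> S (k *: x).
Proof. by move=> [S0 SL] Sx; rewrite -[_ *: _]addr0; apply: SL. Qed.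

Lemma subspaceD S x y : subspace S -> S x -> S y -> S (x + y).
Proof. by move=> [_ SL] Sx Sy; rewrite -[x]scale1r; apply: SL. Qed.

Lemma subspace_sum S (J : Type) (r : seq J) (P : pred J) (F : J -> X) :
  subspace S -> (forall j, P j -> S (F j)) -> S (\sum_(j <- r | P j) F j).
Proof.
move=> sS SF; elim/big_ind: _ => //; first exact: subspace0.
by move=> x y; apply: subspaceD.
Qed.

Definition preserves S (f : X -> X) := forall x, S x -> S (f x).

Lemma basis_coord S n (e : 'I_n -> X) x : is_basis S e -> S x ->
  exists a : 'rV[K]_n, x = \sum_i a 0 i *: e i.
Proof. by move=> [_ B] /B[a [-> _]]; exists a. Qed.

Lemma basis_coord_unique S n (e : 'I_n -> X) (a b : 'rV[K]_n) : subspace S ->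
  is_basis S e -> \sum_i a 0 i *: e i = \sum_i b 0 i *: e i -> a = b.
Proof.
move=> sS [eS B] ab.
have /B[c [_ cu]] : S (\sum_i a 0 i *: e i).
  by apply: subspace_sum => // i _; apply: subspaceZ.
by rewrite -(cu a) // -(cu b).
Qed.

Lemma basis_matrix S n (e : 'I_n -> X) m (y : 'I_m -> X) : is_basis S e ->
  (forall i, S (y i)) ->
  exists A : 'M[K]_(m, n), forall i, y i = \sum_j A i j *: e j.
Proof.
move=> B yS; have H i : {a : 'rV[K]_n | y i = \sum_j a 0 j *: e j}.
  by apply: cid; apply: basis_coord B (yS i).
exists (\matrix_(i, j) sval (H i) 0 j) => i; rewrite [LHS](svalP (H i)).
by apply: eq_bigr => j _; rewrite mxE.
Qed.

Lemma linear_sumZ (Y : lmodType K) (f : X -> Y) n (c : 'I_n -> K) (e : 'I_n -> X) :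
  linear f -> f (\sum_i c i *: e i) = \sum_i c i *: f (e i).
Proof.
move=> lf; pose g := HB.pack f (GRing.isLinear.Build _ _ _ _ f lf) : {linear X -> Y}.
by rewrite -[f]/(g : X -> Y) linear_sum; apply: eq_bigr => i _; rewrite linearZ.
Qed.

Lemma basis_matrix_mul m n p (z : 'I_n -> X) (e : 'I_p -> X)
    (A : 'M[K]_(m, n)) (B : 'M[K]_(n, p)) (i : 'I_m) :
  (forall j, z j = \sum_k B j k *: e k) ->
  \sum_j A i j *: z j = \sum_k (A *m B) i k *: e k.
Proof.
move=> zE; under eq_bigr => j _ do rewrite zE scaler_sumr.
rewrite exchange_big; apply: eq_bigr => k _; rewrite mxE scaler_suml.
by apply: eq_bigr => j _; rewrite scalerA.
Qed.

Lemma basis_matrix_inj S m n (e : 'I_n -> X) (A B : 'M[K]_(m, n)) : subspace S ->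
  is_basis S e ->
  (forall i, \sum_j A i j *: e j = \sum_j B i j *: e j) -> A = B.
Proof.
move=> sS Be AB; apply/row_matrixP => i; apply: (basis_coord_unique sS Be).
by under eq_bigr do rewrite mxE; under [RHS]eq_bigr do rewrite mxE.
Qed.

Section Trace.
Variables (S : set X) (sS : subspace S).

(** [trace_on] reads the trace in an unspecified basis; matrices in two bases are conjugate under
    the change of basis, so any basis may be used. *)
Lemma trace_onE (f : X -> X) n (e : 'I_n -> X) (A : 'M[K]_n) : linear f ->
  is_basis S e -> (forall i, f (e i) = \sum_j A i j *: e j) -> trace_on S f = \tr A.
Proof.
move=> lf Be fA; apply: xget_unique; first by exists n, e, A; split.
move=> _ [n' [e' [A' [Be' fA' ->]]]].
have [P eP] := basis_matrix Be' (proj1 Be).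
have [Q eQ] := basis_matrix Be (proj1 Be').
have QP : Q *m P = 1%:M.
  apply: (basis_matrix_inj sS Be') => i.
  rewrite -(basis_matrix_mul Q i eP) -eQ (bigD1 i) //= mxE eqxx scale1r big1 ?addr0 //.
  by move=> j /negPf ji; rewrite mxE eq_sym ji scale0r.
have A'E : A' = Q *m A *m P.
  apply: (basis_matrix_inj sS Be') => i.
  rewrite -fA' eQ linear_sumZ // -(basis_matrix_mul (Q *m A) i eP).
  exact: basis_matrix_mul fA.
rewrite A'E mxtrace_mulC mulmxA.
suff -> : P *m Q = 1%:M by rewrite mul1mx.
apply: (basis_matrix_inj sS Be) => i.
rewrite -(basis_matrix_mul P i eQ) -eP (bigD1 i) //= mxE eqxx scale1r big1 ?addr0 //.
by move=> j /negPf ji; rewrite mxE eq_sym ji scale0r.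
Qed.

Hypothesis fS : fin_dim S.

Lemma trace_on_exists (f : X -> X) : linear f -> preserves S f ->
  forall n (e : 'I_n -> X), is_basis S e ->
  exists2 A : 'M[K]_n, trace_on S f = \tr A & forall i, f (e i) = \sum_j A i j *: e j.
Proof.
move=> lf pf n e Be.
have [|A fA] := basis_matrix (y := f \o e) Be; first by move=> i; apply/pf/(proj1 Be).
by exists A => //; apply: trace_onE fA.
Qed.

Lemma trace_onP (f g : X -> X) k : linear f -> linear g ->
  preserves S f -> preserves S g ->
  trace_on S (fun x => k *: f x + g x) = k * trace_on S f + trace_on S g.
Proof.
move=> lf lg pf pg; have [n [e Be]] := fS.
have [A -> fA] := trace_on_exists lf pf Be; have [B -> gB] := trace_on_exists lg pg Be.
rewrite -mxtraceZ -mxtraceD; apply: (@trace_onE _ _ e) => // [c x y|i].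
  by rewrite lf lg !scalerDr !scalerA addrACA mulrC.
rewrite fA gB scaler_sumr -big_split; apply: eq_bigr => j _.
by rewrite !mxE scalerDl scalerA.
Qed.

Lemma eq_trace_on (f g : X -> X) : linear f -> linear g -> preserves S f ->
  (forall x, S x -> f x = g x) -> trace_on S f = trace_on S g.
Proof.
move=> lf lg pf fg; have [n [e Be]] := fS.
have [A -> fA] := trace_on_exists lf pf Be; symmetry; apply: (trace_onE lg Be _) => i.
by rewrite -fA fg //; apply: (proj1 Be).
Qed.

Lemma trace_on0 (f : X -> X) : linear f -> (forall x, S x -> f x = 0) -> trace_on S f = 0.
Proof.
move=> lf f0; have [n [e Be]] := fS.
rewrite (trace_onE (A := 0) lf Be) ?mxtrace0 // => i.
rewrite f0; last exact: (proj1 Be).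
by rewrite big1 // => j _; rewrite mxE scale0r.
Qed.

Lemma trace_on_sum (n : nat) (c : nat -> K) (f : nat -> X -> X) :
  (forall i, linear (f i)) -> (forall i, preserves S (f i)) ->
  trace_on S (fun x => \sum_(i < n) c i *: f i x) = \sum_(i < n) c i * trace_on S (f i).
Proof.
move=> lf pf; have lsum m : linear (fun x => \sum_(i < m) c i *: f i x).
  move=> k x y; rewrite scaler_sumr -big_split; apply: eq_bigr => i _.
  by rewrite lf scalerDr !scalerA mulrC.
elim: n => [|n IH].
  by rewrite big_ord0 trace_on0 // => x _; rewrite big_ord0.
rewrite big_ord_recr /= -IH addrC -trace_onP //; first last.
- by move=> x Sx; apply: subspace_sum => // i _; apply: subspaceZ => //; exact: pf.
apply: eq_trace_on => //.
- exact: lsum.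
- by move=> k x y; rewrite !lf lsum !scalerDr !scalerA addrACA mulrC.
- by move=> x Sx; apply: subspace_sum => // i _; apply: subspaceZ => //; exact: pf.
- by move=> x _; rewrite big_ord_recr addrC.
Qed.

End Trace.

(** Two different spaces are allowed because a mode of nonzero degree maps one graded piece of the
    module to another. *)
Lemma trace_onC (S S' : set X) (f g : X -> X) : subspace S -> subspace S' ->
  fin_dim S -> fin_dim S' -> linear f -> linear g ->
  (forall x, S x -> S' (g x)) -> (forall x, S' x -> S (f x)) ->
  trace_on S (f \o g) = trace_on S' (g \o f).
Proof.
move=> sS sS' [n [e Be]] [n' [e' Be']] lf lg gS fS.
have lfg : linear (f \o g) by move=> k x y; rewrite /= lg lf.
have lgf : linear (g \o f) by move=> k x y; rewrite /= lf lg.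
have [|B gB] := basis_matrix (y := g \o e) Be'; first by move=> i; apply/gS/(proj1 Be).
have [|A fA] := basis_matrix (y := f \o e') Be; first by move=> i; apply/fS/(proj1 Be').
rewrite (trace_onE sS (A := B *m A) lfg Be) => [|i]; last first.
  by rewrite /= [g _]gB linear_sumZ // -(basis_matrix_mul B i fA).
rewrite (trace_onE sS' (A := A *m B) lgf Be') => [|i]; last first.
  by rewrite /= [f _]fA linear_sumZ // -(basis_matrix_mul A i gB).
exact: mxtrace_mulC.
Qed.

End Subspaces.

(** * Graded modules and modes *)

Section DirectSums.
Variables (K : fieldType) (X : lmodType K) (S : nat -> set X).
Hypothesis dS : direct_sum S.

Lemma decomposition_bound x f : decomposition S x f ->
  exists N, (forall n, (N <= n)%N -> f n = 0) /\ x = \sum_(n < N) f n.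
Proof.
move=> [_ /finite_seqP[s sE] ->].
have f0 n : ((\max_(i <- s) i).+1 <= n)%N -> f n = 0.
  move=> sn; apply/eqP; apply: contraTT sn => fn; rewrite -ltnNge ltnS.
  have ns : n \in s by have : [set n | f n != 0] n by []; rewrite sE.
  exact: (leq_bigmax_seq (F := fun i => i) n ns).
by exists (\max_(i <- s) i).+1; split=> //; apply: fsbig_nat.
Qed.

Lemma bounded_decomposition x f N : (forall n, S n (f n)) ->
  (forall n, (N <= n)%N -> f n = 0) -> x = \sum_(n < N) f n -> decomposition S x f.
Proof.
move=> Sf f0 ->; split=> //; last by rewrite (fsbig_nat f0).
apply: (@sub_finite_set _ _ `I_N) => [n /= fn|]; last exact: finite_II.
by rewrite ltnNge; apply: contra fn => /f0 ->.
Qed.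

Lemma piece_subspace n : subspace (S n). Proof. exact: (proj1 dS). Qed.

Lemma componentP x : decomposition S x (fun n => component S n x).
Proof.
have [f [fd _]] := proj2 dS x; rewrite /component.
by case: xgetP => [g _ //|/(_ f)].
Qed.

Lemma component_unique x f n : decomposition S x f -> component S n x = f n.
Proof.
move=> fd; have [g [_ gu]] := proj2 dS x.
by rewrite -(gu _ fd) (gu _ (componentP x)).
Qed.

Lemma component_piece n x : S n (component S n x).
Proof. by have [] := componentP x. Qed.

Lemma component_bound x : exists N, (forall n, (N <= n)%N -> component S n x = 0) /\
  x = \sum_(n < N) component S n x.
Proof. exact: decomposition_bound (componentP x). Qed.

Lemma component_linear n : linear (component S n).
Proof.
move=> k x y; have [N [xN xE]] := component_bound x; have [N' [yN yE]] := component_bound y.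
apply: (component_unique (f := fun n => k *: component S n x + component S n y)).
apply: (bounded_decomposition (N := maxn N N')) => [m|m|].
- by apply: subspaceD (piece_subspace m) _ _; [apply: subspaceZ (piece_subspace m) _|];
    exact: component_piece.
- by rewrite geq_max => /andP[mN mN']; rewrite xN // yN // scaler0 addr0.
rewrite big_split -scaler_sumr /=.
rewrite (@big_ord_extend _ (fun m => component S m x) N) ?leq_maxl // -xE.
by rewrite (@big_ord_extend _ (fun m => component S m y) N') ?leq_maxr // -yE.
Qed.

Lemma component_homog m n x : S n x -> component S m x = if m == n then x else 0.
Proof.
move=> Sx; apply: (component_unique (f := fun m => if m == n then x else 0)).
apply: (bounded_decomposition (N := n.+1)) => [k|k nk|].
- by case: eqP => [->//|_]; exact: subspace0 (piece_subspace k).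
- by rewrite gtn_eqF.
by rewrite big_ord_recr /= eqxx big1 ?add0r // => i _; rewrite ltn_eqF.
Qed.

Lemma component_id n x : S n x -> component S n x = x.
Proof. by move=> Sx; rewrite (component_homog _ Sx) eqxx. Qed.

Lemma component0 n : component S n 0 = 0.
Proof. by rewrite (component_homog n (subspace0 (piece_subspace n))) if_same. Qed.

Lemma component_linear_eq0 (Y : lmodType K) (f : X -> Y) : linear f ->
  (forall n x, S n x -> f x = 0) -> forall x, f x = 0.
Proof.
move=> lf f0 x; have [N [_ ->]] := component_bound x.
have := linear_sumZ (fun=> 1) (fun n : 'I_N => component S n x) lf.
under eq_bigr do rewrite scale1r; move=> ->; rewrite big1 // => i _.
by rewrite (f0 i) ?scaler0 //; exact: component_piece.
Qed.

End DirectSums.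

Section Gradings.
Variable R : realType.
Local Notation C := R[i].

Lemma int_grading_nat (X : lmodType C) (S : nat -> set X) (n : nat) (z : int) x :
  int_grading S z x -> z = n%:Z -> S n x.
Proof. by move=> + zn; rewrite zn. Qed.

Lemma int_grading_neg (X : lmodType C) (S : nat -> set X) (z : int) x :
  int_grading S z x -> z < 0 -> x = 0.
Proof. by case: z. Qed.

Lemma int_grading_component (X : lmodType C) (S : nat -> set X) (dS : direct_sum S)
    (z : int) x n : int_grading S z x -> n%:Z != z -> component S n x = 0.
Proof.
case: z => [k|k] /=; last by move=> -> _; exact: component0.
by move=> Sx nk; rewrite (component_homog dS _ Sx) -eqz_nat (negPf nk).
Qed.

Variable V : voa R.

(** Comparing components gives (n - z) x_n = 0 for every n. The degrees of the modes of an
    intertwining operator are obtained from their L(0)-eigenvalues in this way. *)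
Lemma module_eigenvector (M : admissible_module V) (h : C) (z : int) (x : M) :
  has_conformal_weight M h -> Lop 0 x = (h + z%:~R) *: x -> int_grading (piece M) z x.
Proof.
move=> Mh xE; have dM := am_direct_sum M.
have lL : linear (@Lop R V M 0) by exact: (proj2 (wm_bimodes M)).
have [N [xN xS]] := component_bound dM x.
pose g n := ((h + n%:R) - (h + z%:~R)) *: component (piece M) n x.
have g0 n : g n = 0.
  have z0 : Lop 0 x - (h + z%:~R) *: x = 0 by rewrite xE subrr.
  rewrite -(component0 dM n) -z0; symmetry; apply: (component_unique dM (f := g)).
  apply: (bounded_decomposition (N := N)) => [m|m mN|].
  - by apply: subspaceZ (piece_subspace dM m) _; exact: component_piece.
  - by rewrite /g xN // scaler0.
  rewrite {1 2}xS scaler_sumr.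
  have := linear_sumZ (fun=> 1) (fun n : 'I_N => component (piece M) n x) lL.
  under eq_bigr do rewrite scale1r; move=> ->.
  rewrite -sumrB; apply: eq_bigr => i _; rewrite /g scale1r scalerBl; congr (_ - _).
  by have := component_piece dM i x; rewrite {1}Mh.
have comp0 n : n%:Z != z -> component (piece M) n x = 0.
  move=> nz; apply/eqP; have /eqP := g0 n; rewrite /g scaler_eq0 => /orP[|//].
  by rewrite opprD addrACA subrr add0r subr_eq0 -[n%:R]/(n%:Z%:~R) eqr_int (negPf nz).
case: z {xE g g0} comp0 => [k|k] comp0 /=.
  suff -> : x = component (piece M) k x by exact: component_piece.
  rewrite {1}xS; have [kN|Nk] := ltnP k N.
    rewrite (bigD1 (Ordinal kN)) //= big1 ?addr0 // => i ik; apply: comp0.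
    by apply: contra ik => /eqP[ek]; apply/eqP/val_inj.
  rewrite xN // big1 // => i _; apply: comp0.
  by rewrite eqz_nat ltn_eqF // (leq_trans _ Nk).
by rewrite xS big1 // => i _; apply: comp0.
Qed.

Variables (W M : admissible_module V) (hW hM : C).
Hypotheses (Wh : has_conformal_weight W hW) (Mh : has_conformal_weight M hM).
Variable I : intertwining W M hW.

Lemma io_linear_l n (x : M) : linear (fun u : W => I u n x).
Proof. exact: (proj1 (io_bimodes I)). Qed.
Lemma io_linear_r (u : W) n : linear (I u n).
Proof. exact: (proj2 (io_bimodes I)). Qed.
Lemma mmode_linear_l (N : weak_module V) n (x : N) : linear (fun a : V => mmode a n x).
Proof. exact: (proj1 (wm_bimodes N)). Qed.
Lemma mmode_linear_r (N : weak_module V) (a : V) n : linear (@mmode R V N a n).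
Proof. exact: (proj2 (wm_bimodes N)). Qed.

Lemma linear0 (X Y : lmodType C) (f : X -> Y) : linear f -> f 0 = 0.
Proof. by move=> lf; have := lf (-1) 0 0; rewrite scaleN1r oppr0 addr0 scaleN1r addNr. Qed.
Lemma linearZ_Prop (X Y : lmodType C) (f : X -> Y) : linear f -> forall k x, f (k *: x) = k *: f x.
Proof. by move=> lf k x; rewrite -[k *: x]addr0 lf (linear0 lf) addr0. Qed.
Lemma linearD_Prop (X Y : lmodType C) (f : X -> Y) : linear f -> forall x y, f (x + y) = f x + f y.
Proof. by move=> lf x y; rewrite -[x]scale1r lf !scale1r. Qed.

Lemma binc_0 i : binc (0 : C) i = (i == 0)%:R.
Proof.
case: i => [|i]; first by rewrite /binc big_ord0 divr1.
by rewrite /binc big_ord_recl subrr !mul0r.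
Qed.

Lemma io_commutator (a : V) (u : W) (p q : int) (N : nat) (x : M) :
  (forall r : int, N%:Z <= r -> mmode a r u = 0) ->
  mmode a p (I u q x) - I u q (mmode a p x) =
  \sum_(i < N) binc p%:~R i *: I (mmode a i%:Z u) (p + q - i%:Z) x.
Proof.
move=> au0; have := io_jacobi I a u x p q 0.
rewrite (fsbig_nat (N := N)) => [->|i Ni]; last first.
  rewrite add0r au0 ?lez_nat //.
  by rewrite (linear0 (io_linear_l _ _)) scaler0.
rewrite (fsbig_nat (N := 1)) => [|i i1]; last first.
  by rewrite binc_0 (gtn_eqF i1) mulr0 scale0r.
by rewrite big_ord1 binc_0 mulr1 expr0 scale1r expr0z scale1r !addr0.
Qed.

Lemma mode_bound (N : weak_module V) (a : V) (x : N) :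
  exists k : nat, forall r : int, k%:Z <= r -> mmode a r x = 0.
Proof.
have [k h] := wm_truncation a x; exists `|k|%N => r kr; apply: h.
by apply: le_trans kr; rewrite abszE ler_norm.
Qed.

(** The commutator of L(0) with a mode of u has two terms, from L(-1)u and L(0)u. By the derivative
    axiom they add up to the factor d - m - 1: the weight [hW] cancels between them. *)
Lemma io_shift (d n : nat) (m : int) (u : W) (x : M) : piece W d u -> piece M n x ->
  int_grading (piece M) (d%:Z - m - 1 + n%:Z) (I u m x).
Proof.
move=> du nx; apply: (module_eigenvector Mh).
have [N au0] := mode_bound (conformal_vector V) u.
(* A bound of at least 2 makes both terms, i = 0 and i = 1, appear explicitly in the commutator
   sum. *)
have {}au0 r : N.+2%:Z <= r -> mmode (conformal_vector V) r u = 0.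
  by move=> Nr; apply: au0; apply: le_trans Nr; lia.
have := io_commutator 1 m x au0.
have uE : mmode (conformal_vector V) 1 u = (hW + d%:R) *: u.
  by move: du; rewrite Wh.
have xE : mmode (conformal_vector V) 1 x = (hM + n%:R) *: x.
  by move: nx; rewrite Mh.
rewrite 2!big_ord_recl big1 => [|i _]; last first.
  by rewrite /binc 2!big_ord_recl /= subrr mul0r mulr0 mul0r scale0r.
rewrite !addr0 /= /bump /= addn0 [1 + m - _](_ : _ = m); last by lia.
rewrite [mmode _ 1 u]uE (linearZ_Prop (io_linear_l _ _)).
have -> : binc 1 0 = 1 :> C by rewrite /binc big_ord0 divr1.
have -> : binc 1 1 = 1 :> C by rewrite /binc big_ord1 subr0 divr1.
have := io_derivative I u (1 + m) x; rewrite /Lop addNr => ->.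
rewrite xE (linearZ_Prop (io_linear_r _ _)) !scale1r => /eqP; rewrite subr_eq => /eqP.
rewrite /Lop add0r => ->; rewrite [1 + m - 1](_ : _ = m); last by lia.
rewrite -!scalerDl; congr (_ *: _).
by rewrite !(rmorphD, rmorphB, rmorphN) /= -!pmulrn; ring.
Qed.

End Gradings.

(** * Trace functions *)

Section TraceCoefficients.
Variable R : realType.
Local Notation C := R[i].
Variables (V : voa R) (W M : admissible_module V) (hW hM : C).
Hypotheses (Wh : has_conformal_weight W hW) (Mord : ordinary M hM).
Variable I : intertwining W M hW.

Let Mh : has_conformal_weight M hM := proj1 Mord.
Let dW := am_direct_sum W.
Let dM := am_direct_sum M.
Let sM n : subspace (piece M n) := piece_subspace dM n.
Let fM n : fin_dim (piece M n) := proj2 Mord n.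

Lemma o_int_sum (y : W) (x : M) N : (forall n, (N <= n)%N -> component (piece W) n y = 0) ->
  o_int I y x = \sum_(n < N) I (component (piece W) n y) (n%:Z - 1) x.
Proof.
by move=> yN; apply: fsbig_nat => n Nn; rewrite yN // (linear0 (io_linear_l _ _ _)).
Qed.

Lemma o_int_homog (y : W) (x : M) (D : int) : int_grading (piece W) D y ->
  o_int I y x = I y (D - 1) x.
Proof.
case: D => [k|k] /= yk.
  rewrite (@o_int_sum y x k.+1) => [|n kn]; last first.
    by rewrite (component_homog dW _ yk) gtn_eqF.
  rewrite big_ord_recr big1 => [|i _]; first by rewrite /= add0r (component_id dW yk).
  rewrite (component_homog dW _ yk) ltn_eqF ?(linear0 (io_linear_l _ _ _)) //.
  exact: (ltn_ord i).
rewrite yk (@o_int_sum 0 x 0) => [|n _]; last exact: component0.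
by rewrite big_ord0 (linear0 (io_linear_l _ _ _)).
Qed.

Lemma o_int_linear_l (x : M) : linear (fun y : W => o_int I y x).
Proof.
move=> k y z; have [N [yN _]] := component_bound dW y.
have [N' [zN _]] := component_bound dW z.
have mN n : (maxn N N' <= n)%N -> component (piece W) n y = 0 /\ component (piece W) n z = 0.
  by rewrite geq_max => /andP[/yN -> /zN ->].
rewrite !(@o_int_sum _ x (maxn N N')).
- rewrite scaler_sumr -big_split; apply: eq_bigr => i _ /=.
  by rewrite (component_linear dW) io_linear_l.
- by move=> n /mN[].
- by move=> n /mN[].
- by move=> n /mN[y0 z0]; rewrite (component_linear dW) y0 z0 scaler0 addr0.
Qed.

Lemma o_int_linear_r (y : W) : linear (o_int I y).
Proof.
move=> k x z; have [N [yN _]] := component_bound dW y.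
rewrite !(@o_int_sum y _ N) // scaler_sumr -big_split.
by apply: eq_bigr => i _ /=; rewrite io_linear_r.
Qed.

Lemma o_int_preserves (y : W) n : preserves (piece M n) (o_int I y).
Proof.
move=> x nx; have [N [yN _]] := component_bound dW y.
rewrite (@o_int_sum y x N) //; apply: subspace_sum => // i _.
apply: (int_grading_nat (io_shift Wh Mh I _ (component_piece dW i y) nx)).
by lia.
Qed.

Lemma trace_coef_linear n : scalar (fun y : W => trace_coef I y n).
Proof.
move=> k y z; rewrite /trace_coef.
have lo w := o_int_linear_r w; have po w := @o_int_preserves w n.
rewrite -(trace_onP (sM n) (fM n)) //; congr trace_on; apply/funext => x.
exact: o_int_linear_l.
Qed.

Definition trace_series (y : W) : fps R := trace_coef I y.

Lemma trace_seriesP k (y z : W) :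
  trace_series (k *: y + z) = fpsC k * trace_series y + trace_series z.
Proof. by apply/funext => n; rewrite fpsE fpsCM; exact: trace_coef_linear. Qed.

Lemma trace_series0 : trace_series 0 = 0.
Proof.
have := trace_seriesP (-1) 0 0; rewrite scaler0 addr0 => ->.
by rewrite rmorphN /= fpsC1 mulN1r addNr.
Qed.

Lemma trace_seriesZ k (y : W) : trace_series (k *: y) = fpsC k * trace_series y.
Proof. by rewrite -[k *: y]addr0 trace_seriesP trace_series0 addr0. Qed.

Lemma trace_series_sum (J : Type) (r : seq J) (c : J -> C) (y : J -> W) :
  trace_series (\sum_(j <- r) c j *: y j) = \sum_(j <- r) fpsC (c j) * trace_series (y j).
Proof.
elim: r => [|j r IH]; first by rewrite !big_nil trace_series0.
by rewrite !big_cons trace_seriesP IH.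
Qed.

(** Cyclicity moves the trace from degree n to degree n - l, which is multiplication by q^l on
    generating series; below degree l the map [g] already vanishes. *)
Lemma trace_cycle (f g : M -> M) (l n : nat) : linear f -> linear g ->
  (forall m x, piece M m x -> int_grading (piece M) (m%:Z - l%:Z) (g x)) ->
  (forall m x, piece M m x -> piece M (m + l)%N (f x)) ->
  trace_on (piece M n) (f \o g) =
  if (n < l)%N then 0 else trace_on (piece M (n - l)) (g \o f).
Proof.
move=> lf lg gS fS; case: ltnP => nl.
  apply: (trace_on0 (sM n) (fM n)) => [k x y|x nx]; first by rewrite /= lg lf.
  by rewrite /= (int_grading_neg (gS _ _ nx)) ?(linear0 lf) //; lia.
apply: trace_onC => // x nx; first by apply: int_grading_nat (gS _ _ nx) _; lia.
by rewrite -(subnK nl); exact: fS.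
Qed.

Section Homogeneous.
Variables (a : V) (wt : nat) (u : W) (d : nat) (N : nat).
Hypotheses (awt : weight_space V wt a) (ud : piece W d u).
Hypothesis (auN : forall r : int, N%:Z <= r -> mmode a r u = 0).

(* The formal residue of [f(z) z^(-s) Y(a,z) u]. *)
Definition residue (f : nat -> C) (s : nat) : W :=
  \sum_(i < N + s) f i *: mmode a (i%:Z - s%:Z) u.

(* [amode j] and [umode j] lower degrees by [j]. *)
Definition amode (j : int) : M -> M := mmode a (wt%:Z - 1 + j).
Definition umode (j : int) : M -> M := I u (d%:Z - 1 + j).

Lemma amode_linear j : linear (amode j). Proof. exact: mmode_linear_r. Qed.
Lemma umode_linear j : linear (umode j). Proof. exact: io_linear_r. Qed.

Lemma amode_shift j n x : piece M n x -> int_grading (piece M) (n%:Z - j) (amode j x).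
Proof.
move=> nx; have := am_shift (wt%:Z - 1 + j) awt nx.
by rewrite (_ : _ - _ - 1 + _ = n%:Z - j) //; lia.
Qed.

Lemma umode_shift j n x : piece M n x -> int_grading (piece M) (n%:Z - j) (umode j x).
Proof.
move=> nx; have := io_shift Wh Mh I (d%:Z - 1 + j) ud nx.
by rewrite (_ : _ - _ - 1 + _ = n%:Z - j) //; lia.
Qed.

Definition trace_au (j : int) (n : nat) : C := trace_on (piece M n) (amode j \o umode (- j)).
Definition trace_ua (j : int) (n : nat) : C := trace_on (piece M n) (umode (- j) \o amode j).

Lemma trace_au_cycle (l n : nat) :
  trace_au (- l%:Z) n = if (n < l)%N then 0 else trace_ua (- l%:Z) (n - l).
Proof.
rewrite /trace_au /trace_ua; apply: trace_cycle.
- exact: amode_linear.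
- exact: umode_linear.
- by move=> m x mx; rewrite opprK; exact: umode_shift.
- by move=> m x mx; apply: int_grading_nat (amode_shift _ mx) _; lia.
Qed.

Lemma trace_ua_cycle (l n : nat) :
  trace_ua l%:Z n = if (n < l)%N then 0 else trace_au l%:Z (n - l).
Proof.
rewrite /trace_au /trace_ua; apply: trace_cycle.
- exact: umode_linear.
- exact: amode_linear.
- by move=> m x mx; exact: amode_shift.
- by move=> m x mx; apply: int_grading_nat (umode_shift _ mx) _; lia.
Qed.

Lemma mmode_degree (r : int) : int_grading (piece W) (wt%:Z + d%:Z - r - 1) (mmode a r u).
Proof. by have := am_shift r awt ud; rewrite (_ : _ - _ - 1 + _ = wt%:Z + d%:Z - r - 1) //; lia. Qed.

Lemma o_int_residue f s (x : M) :
  o_int I (residue f s) x =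
  \sum_(i < N + s) f i *: I (mmode a (i%:Z - s%:Z) u) (wt%:Z + d%:Z + s%:Z - 2 - i%:Z) x.
Proof.
rewrite /residue (linear_sumZ _ _ (o_int_linear_l x)); apply: eq_bigr => i _.
by rewrite (o_int_homog _ (mmode_degree _)); congr (_ *: I _ _ _); lia.
Qed.

Lemma au_preserves j n : preserves (piece M n) (amode j \o umode (- j)).
Proof.
move=> x nx /=; have := umode_shift (- j) nx; rewrite opprK.
case zE: (n%:Z + j) => [k|k] /= kx.
  by apply: int_grading_nat (amode_shift j kx) _; rewrite -zE addrK.
by rewrite kx (linear0 (amode_linear j)); exact: subspace0 (sM n).
Qed.

Lemma ua_preserves j n : preserves (piece M n) (umode (- j) \o amode j).
Proof.
move=> x nx /=; have := amode_shift j nx.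
case zE: (n%:Z - j) => [k|k] /= kx.
  by apply: int_grading_nat (umode_shift (- j) kx) _; rewrite -zE opprK subrK.
by rewrite kx (linear0 (umode_linear _)); exact: subspace0 (sM n).
Qed.

(** The binomials in the commutator formula for the mode wt - 1 + j of [a] are the coefficients of
    (1 + z)^(wt-1+j). *)
Lemma trace_commutator (j : int) n :
  trace_au j n - trace_ua j n =
  trace_series (residue (binc (wt%:R - 1 + j%:~R)) 0) n.
Proof.
rewrite /trace_series /trace_coef.
have lau : linear (amode j \o umode (- j)).
  by move=> k x y; rewrite /= umode_linear amode_linear.
have lua : linear (umode (- j) \o amode j).
  by move=> k x y; rewrite /= amode_linear umode_linear.
have pau := @au_preserves j n; have pua := @ua_preserves j n.
rewrite /trace_au /trace_ua addrC -[- trace_on _ _]mulN1r.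
rewrite -(trace_onP (sM n) (fM n)) //; congr trace_on.
apply/funext => x; rewrite scaleN1r addrC /amode /umode /=.
rewrite (io_commutator I _ _ x auN) o_int_residue addn0; apply: eq_bigr => i _.
rewrite subr0; congr (binc _ _ *: I _ _ _); last by lia.
by rewrite !(rmorphD, rmorphB, rmorphN) /= -!pmulrn.
Qed.

Lemma jacobi_trace (s n : nat) :
  trace_series (residue (binc wt%:R) s.+1) n =
  \sum_(i < n.+1) ((-1) ^+ i * binc (- s.+1%:R) i) *
    (trace_au (- (s + i)%N%:Z) n + (-1) ^+ s * trace_ua i.+1%:Z n).
Proof.
pose c i : C := (-1) ^+ i * binc (- s.+1%:R) i.
pose f i x := (-1) ^+ s *: (umode (- i.+1%:Z) \o amode i.+1%:Z) x +
  (amode (- (s + i)%N%:Z) \o umode (- - (s + i)%N%:Z)) x.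
have lau j j' : linear (amode j \o umode j').
  by move=> k x y; rewrite /= umode_linear amode_linear.
have lua j j' : linear (umode j' \o amode j).
  by move=> k x y; rewrite /= amode_linear umode_linear.
have lf i : linear (f i).
  by move=> k x y; rewrite /f lau lua !scalerDr !scalerA addrACA [(-1) ^+ s * k]mulrC.
have pf i : preserves (piece M n) (f i).
  move=> x nx; apply: subspaceD => //; last exact: au_preserves.
  by apply: subspaceZ => //; exact: ua_preserves.
transitivity (trace_on (piece M n) (fun x => \sum_(i < n.+1) c i *: f i x)); last first.
  rewrite (trace_on_sum (sM n) (fM n)) //; apply: eq_bigr => i _; congr (_ * _).
  rewrite addrC -(trace_onP (sM n) (fM n)) //; first exact: ua_preserves.
  exact: au_preserves.
rewrite /trace_series /trace_coef; apply: (eq_trace_on (sM n) (fM n)).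
- exact: o_int_linear_r.
- move=> k x y; rewrite scaler_sumr -big_split; apply: eq_bigr => i _ /=.
  by rewrite lf scalerDr !scalerA mulrC.
- exact: o_int_preserves.
move=> x nx; rewrite o_int_residue.
(* The indices p = wt and r = -s-1 produce (1 + z)^wt z^(-s-1); the middle one makes every mode on
   the left preserve the degree. *)
have := io_jacobi I a u x wt%:Z (d%:Z + s%:Z - 1) (- s.+1%:Z).
rewrite (fsbig_nat (N := N + s.+1)) => [jac|i Ni]; last first.
  by rewrite auN ?(linear0 (io_linear_l _ _ _)) ?scaler0 //; lia.
transitivity (\sum_(i < N + s.+1) binc wt%:Z%:~R i *: I (mmode a (- s.+1%:Z + i%:Z) u)
    (wt%:Z + (d%:Z + s%:Z - 1) - i%:Z) x).
  apply: eq_bigr => i _; congr (_ *: I (mmode _ _ _) _ _); lia.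
(* For i > n the inner mode of either product lowers the degree by more than n, so it kills M(n). *)
rewrite jac (fsbig_nat (N := n.+1)) => [|i ni]; last first.
  have -> : I u (d%:Z + s%:Z - 1 + i%:Z) x = 0.
    have := umode_shift (s + i)%N%:Z nx; rewrite /umode [d%:Z - 1 + _](_ : _ = d%:Z + s%:Z - 1 + i%:Z); last by lia.
    by move/int_grading_neg; apply; lia.
  have -> : mmode a (wt%:Z + i%:Z) x = 0.
    have := amode_shift i.+1%:Z nx; rewrite /amode [wt%:Z - 1 + _](_ : _ = wt%:Z + i%:Z); last by lia.
    by move/int_grading_neg; apply; lia.
  by rewrite !(linear0 (mmode_linear_r _ _), linear0 (io_linear_r _ _ _)) scaler0 subrr scaler0.
apply: eq_bigr => i _; rewrite /c rmorphN /= -pmulrn; congr (_ *: _).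
rewrite /f /= addrC /amode /umode; congr (_ + _).
  rewrite -scaleNr; congr (_ *: I _ _ (mmode _ _ _)).
  - by rewrite -exprnN -exprVn invrN1 exprS; ring.
  - lia.
  - lia.
by rewrite opprK; congr (mmode _ _ (I _ _ _)); lia.
Qed.

End Homogeneous.
End TraceCoefficients.

(** * Zhu's recursion *)

Section Lambert.
Variable R : realType.
Local Notation C := R[i].
Local Notation fps := (fps R).
Local Notation fpsC := (@fpsC R).

Lemma binc_nat n k : binc (n%:R : C) k = 'C(n, k)%:R.
Proof.
elim: k => [|k IH]; first by rewrite binc0 bin0.
have k0 : k.+1%:R != 0 :> C by rewrite pnatr_eq0.
apply: (mulfI k0); rewrite bincS IH -!natrM.
have [kn|nk] := leqP k n; first by rewrite mul_bin_left -natrB // -natrM.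
by rewrite !bin_small ?muln0 ?mulr0 // ltnW.
Qed.

Lemma binc_opp m k : binc (- m.+1%:R : C) k = (-1) ^+ k * 'C(m + k, k)%:R.
Proof.
elim: k => [|k IH]; first by rewrite binc0 bin0 mulr1.
have k0 : k.+1%:R != 0 :> C by rewrite pnatr_eq0.
apply: (mulfI k0); rewrite bincS IH [RHS]mulrCA -natrM.
have -> : (k.+1 * 'C(m + k.+1, k.+1) = (m + k).+1 * 'C(m + k, k))%N.
  by rewrite addnS -mul_bin_diag.
by rewrite exprS natrM -[(m + k).+1%:R]natr1 natrD -natr1; ring.
Qed.

(* q^l / (1 - q^l) *)
Definition geom (l : nat) : fps := fun n => ((0 < n)%N && (l %| n)%N)%:R.

Lemma geomE l : (0 < l)%N -> geom l = fpsX R ^+ l * (1 + geom l).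
Proof.
move=> l0; apply/funext => n; rewrite fpsXnM fpsE fps1 /geom; case: (ltnP n l) => nl.
  by case: n nl => //= n nl; rewrite gtnNdvd.
rewrite (leq_trans l0 nl) /= subn_gt0.
have -> : (l %| n)%N = (l %| n - l)%N by rewrite -{1}(subnK nl) dvdn_addl.
rewrite subn_eq0 leqNgt; case: (ltnP l n) => // ln; rewrite ?add0r //.
have -> : n = l by apply/eqP; rewrite eqn_leq nl ln.
by rewrite subnn dvdn0 addr0.
Qed.

(** The hypothesis says f = q^l (f + G); solving it for f creates the denominator 1 - q^l. *)
Lemma geom_recursion l (f G : fps) : (0 < l)%N ->
  (forall n, f n = if (n < l)%N then 0 else f (n - l)%N + G (n - l)%N) -> f = geom l * G.
Proof.
move=> l0 fE; apply/funext => n; have [m] := ubnP n; elim: m n => // m IH n /ltnSE nm.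
rewrite fE (geomE l0) -mulrA fpsXnM; case: ltnP => // ln.
rewrite mulrDl mul1r fpsE addrC -IH //.
by rewrite (leq_trans _ nm) // ltn_subrL l0 (leq_trans l0 ln).
Qed.

Lemma geom_small l (G : fps) n : (n < l)%N -> (geom l * G) n = 0.
Proof.
move=> nl; rewrite (geomE (leq_ltn_trans (leq0n n) nl)) -mulrA fpsXnM nl //.
Qed.

(* sum_(l >= 1) c_l q^l / (1 - q^l) *)
Definition lambert (c : nat -> C) : fps := fun n => \sum_(l < n) c l.+1 * geom l.+1 n.

Lemma lambertM (c : nat -> C) (G : fps) n :
  \sum_(l < n) c l.+1 * (geom l.+1 * G) n = (lambert c * G) n.
Proof.
rewrite fpsM; under eq_bigr => l _ do rewrite fpsM mulr_sumr.
rewrite exchange_big; apply: eq_bigr => j _ /=.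
rewrite /lambert mulr_suml.
rewrite (@big_ord_extend _ (fun l => c l.+1 * (geom l.+1 j * G (n - j)%N)) j).
- by apply: eq_bigr => l _; rewrite mulrA.
- by rewrite -ltnS.
move=> i ji; rewrite /geom; case: (nat_of_ord j) ji => [|k] ji; first by rewrite mul0r mulr0.
by rewrite gtnNdvd // ?mul0r ?mulr0.
Qed.

Lemma lambert_sigma p n : (0 < n)%N -> lambert (fun l => l%:R ^+ p) n = (sigma p n)%:R.
Proof.
move=> n0; rewrite /lambert /sigma natr_sum.
rewrite -(big_mkord xpredT (fun l => (l.+1%:R ^+ p : C) * geom l.+1 n)).
rewrite -(big_add1 _ _ 0 n.+1 xpredT (fun l => (l%:R ^+ p : C) * geom l n)).
transitivity (\sum_(1 <= l < n.+1) (if (l %| n)%N then (l ^ p)%:R else 0) : C).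
  apply: eq_bigr => l _.
  by rewrite /geom n0 natrX; case: (l %| n)%N; rewrite ?mulr1 ?mulr0.
rewrite -big_mkcond /= -big_filter; apply: perm_big; apply: uniq_perm.
- by rewrite filter_uniq // iota_uniq.
- exact: divisors_uniq.
move=> l; rewrite mem_filter mem_index_iota -dvdn_divisors // ltnS.
by case: (boolP (l %| n)%N) => //= ln; rewrite (dvdn_gt0 n0) // dvdn_leq.
Qed.

Variables (V : voa R) (W M : admissible_module V) (hW hM : C).
Hypotheses (Wh : has_conformal_weight W hW) (Mord : ordinary M hM).
Variable I : intertwining W M hW.
Variables (a : V) (wt : nat) (u : W) (d : nat) (N : nat).
Hypotheses (awt : weight_space V wt a) (ud : piece W d u).
Hypothesis (auN : forall r : int, N%:Z <= r -> mmode a r u = 0).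

Local Notation F := (trace_series I).
Local Notation res := (residue a u N).
Local Notation G := (fun j : int => F (res (binc (wt%:R - 1 + j%:~R)) 0)).

(** For j = 0 cyclicity does not shift the degree, so the two traces agree. This is the source of
    the vanishing on a[0]v. *)
Lemma trace_commutator0 : G 0 = 0.
Proof.
apply/funext => n; rewrite -(trace_commutator Wh Mord I awt ud auN).
have := trace_ua_cycle Wh Mord I awt ud 0 n; rewrite ltn0 subn0 => ->.
by rewrite subrr.
Qed.

Lemma trace_ua_geom l : (trace_ua I a wt u d l.+1%:Z : fps) = geom l.+1 * G l.+1%:Z.
Proof.
apply: geom_recursion => // n; rewrite (trace_ua_cycle Wh Mord I awt ud); case: ifP => // _.
by rewrite -(trace_commutator Wh Mord I awt ud auN) addrC subrK.
Qed.

Lemma trace_au_geom l : (trace_au I a wt u d (- l.+1%:Z) : fps) = - (geom l.+1 * G (- l.+1%:Z)).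
Proof.
rewrite -mulrN; apply: geom_recursion => // n.
rewrite (trace_au_cycle Wh Mord I awt ud); case: ifP => // _.
by rewrite fpsN -(trace_commutator Wh Mord I awt ud auN) opprB addrC subrK.
Qed.

(* Zhu's recursion, for the functions [(1 + z)^wt / z^(s+1)]. *)
Lemma zhu_recursion s n :
  F (res (binc wt%:R) s.+1) n =
  (s == 0)%:R * trace_au I a wt u d 0 n +
  \sum_(l < n) (binc (- l.+1%:R) s * (geom l.+1 * G l.+1%:Z) n
                - binc l.+1%:R s * (geom l.+1 * G (- l.+1%:Z)) n).
Proof.
rewrite (jacobi_trace Wh Mord I awt ud auN).
have cE i : (-1) ^+ i * binc (- s.+1%:R : C) i = 'C(s + i, s)%:R.
  by rewrite binc_opp mulrA -expr2 sqrr_sign mul1r -bin_sub ?leq_addl // addnK.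
under eq_bigr => i _ do rewrite cE mulrDr.
rewrite big_split /= sumrB addrCA addrC; congr (_ + _).
  (* The last term, l = n + 1, starts in degree n + 1 and drops out. *)
  rewrite big_ord_recr /= trace_ua_geom geom_small // !mulr0 addr0.
  apply: eq_bigr => l _; rewrite trace_ua_geom binc_opp addnC -bin_sub ?leq_addl // addnK.
  by ring.
have big0 l : (n < l)%N -> trace_au I a wt u d (- l%:Z) n = 0.
  by rewrite (trace_au_cycle Wh Mord I awt ud) => ->.
(* With l = s + i the sum may run over all l: those below s have a zero binomial, those above n
   vanish by [big0]. The term l = 0 is the zero mode, with coefficient C(0, s). *)
transitivity (\sum_(l < n.+1) 'C(l, s)%:R * trace_au I a wt u d (- l%:Z) n); last first.
  rewrite big_ord_recl /= bin0n -sumrN; congr (_ + _).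
  by apply: eq_bigr => l _; rewrite -[bump 0 l]/(l.+1) trace_au_geom fpsN binc_nat mulrN.
have -> : \sum_(l < n.+1) 'C(l, s)%:R * trace_au I a wt u d (- l%:Z) n =
    \sum_(l < s + n.+1) 'C(l, s)%:R * trace_au I a wt u d (- l%:Z) n.
  symmetry; apply: (big_ord_extend (F := fun l => 'C(l, s)%:R * trace_au I a wt u d (- l%:Z) n)).
    exact: leq_addl.
  by move=> l nl; rewrite big0 ?mulr0.
rewrite big_split_ord /= [X in _ = X + _]big1 ?add0r // => i _.
by rewrite bin_small ?mul0r.
Qed.

End Lambert.

(** * Convergent power series *)

Section ComplexModulus.
Variable R : realType.
Local Notation C := R[i].
Implicit Types z w : C.

(** The norm of [R[i]] takes its values in [R[i]]; estimates are made with this real modulus. *)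
Definition cabs z : R := complex.Re `|z|.

Lemma cabsE z : `|z| = (cabs z)%:C. Proof. by rewrite /cabs normc_def. Qed.

Lemma cabs_ge0 z : 0 <= cabs z.
Proof. by rewrite -lecR -cabsE normr_ge0. Qed.

Lemma cabsM z w : cabs (z * w) = cabs z * cabs w.
Proof. by apply: complexI; rewrite rmorphM /= -!cabsE normrM. Qed.

Lemma cabsX z n : cabs (z ^+ n) = cabs z ^+ n.
Proof. by apply: complexI; rewrite rmorphXn /= -!cabsE normrX. Qed.

Lemma cabsD z w : cabs (z + w) <= cabs z + cabs w.
Proof. by rewrite -lecR rmorphD /= -!cabsE ler_normD. Qed.

Lemma cabsN z : cabs (- z) = cabs z.
Proof. by apply: complexI; rewrite -!cabsE normrN. Qed.

Lemma cabs_nat n : cabs n%:R = n%:R.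
Proof. by apply: complexI; rewrite -cabsE normr_nat rmorph_nat. Qed.

Lemma cabs0 : cabs 0 = 0. Proof. exact: (cabs_nat 0). Qed.
Lemma cabs1 : cabs 1 = 1. Proof. exact: (cabs_nat 1). Qed.

Lemma cabs_sum (J : Type) (r : seq J) (P : pred J) (f : J -> C) :
  cabs (\sum_(j <- r | P j) f j) <= \sum_(j <- r | P j) cabs (f j).
Proof.
elim/big_rec2: _ => [|j x y _ xy]; first by rewrite cabs0.
by apply: le_trans (cabsD _ _) _; rewrite lerD2l.
Qed.

Lemma cabs_Re z : `|complex.Re z| <= cabs z.
Proof. by rewrite -lecR -cabsE normc_ge_Re. Qed.

Lemma cabs_le_ReIm z : cabs z <= `|complex.Re z| + `|complex.Im z|.
Proof.
case: z => a b; rewrite -(@ler_pXn2r _ 2) ?nnegrE ?addr_ge0 ?cabs_ge0 //=.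
rewrite /cabs /= sqr_sqrtr ?addr_ge0 ?sqr_ge0 // sqrrD !real_normK ?num_real //.
have : 0 <= `|a| * `|b| by rewrite mulr_ge0.
by lra.
Qed.

Lemma cabs_Im z : `|complex.Im z| <= cabs z.
Proof.
case: z => a b; rewrite -(@ler_pXn2r _ 2) ?nnegrE ?cabs_ge0 //=.
by rewrite /cabs /= sqr_sqrtr ?addr_ge0 ?sqr_ge0 // -normrX ger0_norm ?sqr_ge0 // lerDr sqr_ge0.
Qed.

End ComplexModulus.

Section GeometricGrowth.
Variable R : realType.
Local Notation C := R[i].
Local Notation fps := (fps R).

(** With x = y^2, one factor y^n bounds the coefficients and the spare one absorbs a factor n +
    1. *)
Lemma sqrt_root (x : R) : 0 < x < 1 -> exists2 y : R, 0 < y < 1 & x = y ^+ 2.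
Proof.
move=> /andP[x0 x1]; exists (Num.sqrt x); last by rewrite sqr_sqrtr ?ltW.
by rewrite sqrtr_gt0 x0 -sqrtr1 ltr_sqrt.
Qed.

Lemma geometric_sum_le (y : R) n : 0 <= y < 1 -> \sum_(i < n) y ^+ i <= (1 - y)^-1.
Proof.
move=> /andP[y0 y1]; have y1' : 0 < 1 - y by rewrite subr_gt0.
rewrite -[leRHS]mul1r ler_pdivlMr //.
have -> : (\sum_(i < n) y ^+ i) * (1 - y) = 1 - y ^+ n.
  elim: n => [|n IH]; first by rewrite big_ord0 mul0r subrr.
  by rewrite big_ord_recr /= mulrDl IH exprS; ring.
by rewrite gerBl exprn_ge0.
Qed.

Lemma linear_geometric_le (y : R) n : 0 <= y < 1 -> n.+1%:R * y ^+ n <= (1 - y)^-1.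
Proof.
move=> y01; apply: le_trans (geometric_sum_le n.+1 y01); have /andP[y0 y1] := y01.
rewrite mulr_natl -[X in _ *+ X]card_ord -sumr_const; apply: ler_sum => i _.
by apply: ler_wiXn2l => //; [exact: ltW | rewrite -ltnS].
Qed.

(* Radius of convergence at least 1. *)
Definition conv (f : nat -> C) :=
  forall x : R, 0 < x < 1 -> exists K : R, forall n, cabs (f n) * x ^+ n <= K.

Lemma conv_le (f : nat -> C) (g : nat -> R) :
  (forall n, cabs (f n) <= g n) ->
  (forall x : R, 0 < x < 1 -> exists K : R, forall n, g n * x ^+ n <= K) -> conv f.
Proof.
move=> fg gK x x01; have [K h] := gK x x01; exists K => n; apply: le_trans (h n).
by rewrite ler_wpM2r // exprn_ge0 //; case/andP: x01 => /ltW.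
Qed.

Lemma convD (f g : fps) : conv f -> conv g -> conv (f + g).
Proof.
move=> cf cg x x01; have [K fK] := cf x x01; have [L gL] := cg x x01.
exists (K + L) => n; apply: le_trans (lerD (fK n) (gL n)).
rewrite -mulrDl ler_wpM2r ?cabsD // exprn_ge0 //; by case/andP: x01 => /ltW.
Qed.

Lemma conv_pointwise (f g : nat -> C) : conv f -> conv g -> conv (fun n => f n * g n).
Proof.
move=> cf cg x /sqrt_root[y y01 ->].
have [K fK] := cf y y01; have [L gL] := cg y y01; case/andP: y01 => /ltW y0 _.
exists (K * L) => n; rewrite cabsM exprAC expr2 mulrACA.
by apply: ler_pM => //; rewrite mulr_ge0 ?cabs_ge0 ?exprn_ge0.
Qed.

Lemma conv_const c : conv (fun=> c).
Proof.
move=> x /andP[x0 x1]; exists (cabs c) => n.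
by rewrite ler_piMr ?cabs_ge0 // exprn_ile1 // ltW.
Qed.

Lemma conv_nat : conv (fun n => n%:R).
Proof.
apply: (conv_le (g := fun n => n.+1%:R)) => [n|x /andP[x0 x1]].
  by rewrite cabs_nat ler_nat.
by exists (1 - x)^-1 => n; apply: linear_geometric_le; rewrite ltW.
Qed.

Lemma conv_prod m (f : nat -> nat -> C) :
  (forall j, conv (f j)) -> conv (fun n => \prod_(j < m) f j n).
Proof.
move=> cf; elim: m => [|m IH].
  rewrite (_ : (fun n => _) = fun=> 1); first exact: conv_const.
  by apply/funext => n; rewrite big_ord0.
rewrite (_ : (fun n => _) = fun n => (\prod_(j < m) f j n) * f m n).
  exact: conv_pointwise.
by apply/funext => n; rewrite big_ord_recr.
Qed.

Lemma conv_binc (e c : C) k : conv (fun n => binc (e * n%:R + c) k).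
Proof.
apply: conv_pointwise; last exact: conv_const.
apply: (@conv_prod k (fun j n => e * n%:R + c - j%:R)) => j.
rewrite (_ : (fun n => _) = (fun n => e * n%:R : C) + (fun=> c - j%:R)).
  by apply: convD; [apply: conv_pointwise; [exact: conv_const|exact: conv_nat]|exact: conv_const].
by apply/funext => n; rewrite -addrA.
Qed.

Lemma convM (f g : fps) : conv f -> conv g -> conv (f * g).
Proof.
move=> cf cg x /sqrt_root[y y01 ->].
have [K fK] := cf y y01; have [L gL] := cg y y01; case/andP: (y01) => /ltW y0 y1.
exists (K * L * (1 - y)^-1) => n.
have KL0 : 0 <= K * L.
  by apply: mulr_ge0; [apply: le_trans (fK 0%N) | apply: le_trans (gL 0%N)];
    rewrite mulr_ge0 ?cabs_ge0 ?exprn_ge0 //.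
apply: (@le_trans _ _ (K * L * (n.+1%:R * y ^+ n))); last first.
  by rewrite ler_wpM2l // linear_geometric_le // y0.
rewrite -exprM mulnC exprM expr2 !mulrA ler_wpM2r ?exprn_ge0 //.
apply: (@le_trans _ _ ((\sum_(i < n.+1) cabs (f i * g (n - i)%N)) * y ^+ n)).
  by rewrite ler_wpM2r ?exprn_ge0 // fpsM cabs_sum.
rewrite mulr_suml mulr_natr -[X in _ *+ X]card_ord -sumr_const; apply: ler_sum => i _.
rewrite cabsM -[in y ^+ n](@subnKC i n) -1?ltnS // exprD mulrACA.
by apply: ler_pM => //; rewrite mulr_ge0 ?cabs_ge0 ?exprn_ge0 //.
Qed.

Lemma conv_fpsC c : conv (fpsC c).
Proof.
apply: (conv_le (g := fun=> cabs c)) => [n|x x01]; last exact: conv_const c x x01.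
by rewrite /fpsC; case: n => [|n]; rewrite ?mulr1n ?mulr0n ?cabs0 ?cabs_ge0.
Qed.

Lemma convN (f : fps) : conv f -> conv (- f).
Proof.
move=> cf x x01; have [K fK] := cf x x01; exists K => n.
by rewrite fpsN cabsN.
Qed.

Lemma conv0 : conv (0 : fps). Proof. by rewrite -fpsC0; exact: conv_fpsC. Qed.

Lemma conv_sum (J : Type) (r : seq J) (P : pred J) (f : J -> fps) :
  (forall j, P j -> conv (f j)) -> conv (\sum_(j <- r | P j) f j).
Proof. by move=> cf; elim/big_ind: _ => //; [exact: conv0 | exact: convD]. Qed.

Lemma conv_lambert c : conv c -> conv (lambert c).
Proof.
move=> cc x /sqrt_root[y y01 ->]; have [K cK] := cc y y01; case/andP: (y01) => /ltW y0 y1.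
have K0 : 0 <= K.
  by apply: le_trans (cK 0%N); rewrite mulr_ge0 ?cabs_ge0 ?exprn_ge0 //.
exists (K * (1 - y)^-1) => n.
apply: (@le_trans _ _ (K * (n.+1%:R * y ^+ n))); last first.
  by rewrite ler_wpM2l // linear_geometric_le // y0.
rewrite -exprM mulnC exprM expr2 !mulrA ler_wpM2r ?exprn_ge0 //.
apply: (@le_trans _ _ ((\sum_(l < n) cabs (c l.+1)) * y ^+ n)).
  rewrite ler_wpM2r ?exprn_ge0 // /lambert; apply: le_trans (cabs_sum _ _ _) _.
  apply: ler_sum => l _; rewrite cabsM ler_piMr ?cabs_ge0 // /geom.
  by case: (_ && _); rewrite ?cabs1 ?cabs0.
apply: (@le_trans _ _ (K * n%:R)); last by rewrite ler_wpM2l // ler_nat.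
rewrite mulr_suml mulr_natr -[X in _ *+ X]card_ord -sumr_const; apply: ler_sum => l _.
apply: le_trans (cK l.+1); rewrite ler_wpM2l ?cabs_ge0 //.
by apply: ler_wiXn2l => //; rewrite ltW.
Qed.

End GeometricGrowth.

(** * Formal solutions at a regular singular point *)

Section RegularSingular.
Variable R : realType.
Local Notation C := R[i].
Local Notation fps := (fps R).

Lemma nat_above (x : R) : exists n : nat, x < n%:R.
Proof.
exists (Num.truncn x).+1; exact: truncnS_gt.
Qed.

Lemma finite_upper_bound (f : nat -> R) N : exists B, forall n, (n < N)%N -> f n <= B.
Proof.
elim: N => [|N [B BP]]; first by exists 0.
exists (Num.max B (f N)) => n; rewrite ltnS leq_eqVlt => /predU1P[->|/BP fB].
  by rewrite le_max lexx orbT.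
by rewrite le_max fB.
Qed.

(** Solved for the last term, the inequality reads (n - K) y_n <= K (y_0 + ... + y_(n-1)). A bound
    y_k <= B rho^(-k) propagates as soon as n - K exceeds the constant K/(1 - rho) of the geometric
    sum. *)
Lemma gronwall_discrete (y : nat -> R) (K rho : R) :
  (forall n, 0 <= y n) -> 0 <= K -> 0 < rho < 1 ->
  (forall n, n%:R * y n <= K * \sum_(k < n.+1) y k) ->
  exists B, forall n, y n * rho ^+ n <= B.
Proof.
move=> y0 K0 /andP[r0 r1] yK; have r1' : 0 < 1 - rho by rewrite subr_gt0.
(* From [N0] on, n - K is positive and at least K/(1 - rho); the finitely many earlier indices are
   absorbed in B. *)
have [N0 NP] := nat_above (K + K / (1 - rho)).
have [B0 BP] := finite_upper_bound (fun n => y n * rho ^+ n) N0.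
pose B := Num.max B0 0; have B_ge0 : 0 <= B by rewrite le_max lexx orbT.
exists B => n; have [m] := ubnP n; elim: m n => // m IH n /ltnSE nm.
have [nN|Nn] := ltnP n N0; first by rewrite le_max BP.
have nK : 0 < n%:R - K.
  rewrite subr_gt0; apply: lt_le_trans (_ : N0%:R <= _); last by rewrite ler_nat.
  by apply: le_lt_trans NP; rewrite lerDl divr_ge0 // ltW.
have NK : K / (1 - rho) <= n%:R - K.
  rewrite lerBrDl; apply: le_trans (ltW NP) _; by rewrite ler_nat.
have h : (n%:R - K) * y n <= K * \sum_(k < n) y k.
  by have := yK n; rewrite big_ord_recr /= mulrDr mulrBl; lra.
have rn0 k : 0 <= rho ^+ k by rewrite exprn_ge0 // ltW.
rewrite -(ler_pM2l nK); apply: (@le_trans _ _ (K / (1 - rho) * B)); last first.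
  by rewrite ler_wpM2r.
rewrite mulrA; apply: (@le_trans _ _ (K * (\sum_(k < n) y k) * rho ^+ n)).
  by rewrite ler_wpM2r.
rewrite -!mulrA ler_wpM2l // mulr_suml.
apply: (@le_trans _ _ (\sum_(k < n) B * rho ^+ (n - k.+1)%N)).
  apply: ler_sum => k _; apply: (@le_trans _ _ (y k * rho ^+ k * rho ^+ (n - k.+1)%N)).
    rewrite -mulrA -exprD ler_wpM2l //; apply: ler_wiXn2l; [exact: ltW|exact: ltW|].
    by have := ltn_ord k; lia.
  by rewrite ler_wpM2r // IH // (leq_trans (ltn_ord k)).
rewrite -mulr_sumr mulrC ler_wpM2r //.
have -> : \sum_(k < n) rho ^+ (n - k.+1)%N = \sum_(k < n) rho ^+ k.
  rewrite (reindex_inj rev_ord_inj); apply: eq_bigr => k _ /=.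
  by congr (_ ^+ _); have := ltn_ord k; lia.
by apply: geometric_sum_le; rewrite ltW.
Qed.

(** With weights y^n all coefficients of A are bounded by one K, so [Phi], the weighted sum of the
    moduli of the F_j, satisfies the discrete Gronwall inequality with constant m K. Of x = y^2, one
    y serves as weight and the other as [rho]. *)
Lemma conv_regular_singular m (F : 'I_m -> fps) (A : 'I_m -> 'I_m -> fps) :
  (forall i j, conv (A i j)) ->
  (forall i n, n%:R * F i n = (\sum_j A i j * F j) n) ->
  forall i, conv (F i).
Proof.
move=> cA FA i x /sqrt_root[y y01 ->]; case/andP: (y01) => /ltW y0 y1.
have yn0 k : 0 <= y ^+ k by rewrite exprn_ge0.
have [K KP] : exists K : R, forall i j n, cabs (A i j n) * y ^+ n <= K.
  have H i' j : {K : R | forall n, cabs (A i' j n) * y ^+ n <= K} by apply/cid/cA.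
  pose s i' j := sval (H i' j).
  have sP i' j n : cabs (A i' j n) * y ^+ n <= s i' j by exact: (svalP (H i' j)).
  have s0 i' j : 0 <= s i' j by apply: le_trans (sP i' j 0%N); rewrite mulr_ge0 ?cabs_ge0.
  exists (\sum_i' \sum_j s i' j) => i' j n; apply: le_trans (sP i' j n) _.
  rewrite (bigD1 i') //= (bigD1 j) //= -addrA lerDl addr_ge0 ?sumr_ge0 // => k _.
  by apply: sumr_ge0.
have K0 : 0 <= K by apply: le_trans (KP i i 0%N); rewrite mulr_ge0 ?cabs_ge0.
pose Phi n := \sum_j cabs (F j n) * y ^+ n.
have Phi0 n : 0 <= Phi n by apply: sumr_ge0 => j _; rewrite mulr_ge0 ?cabs_ge0.
have PhiK n : n%:R * Phi n <= m%:R * K * \sum_(k < n.+1) Phi k.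
  rewrite [Phi n]/Phi mulr_sumr.
  apply: (@le_trans _ _ (\sum_(j < m) K * \sum_(k < n.+1) Phi k)); last first.
    by rewrite sumr_const card_ord -mulrA mulr_natl.
  apply: ler_sum => j _; rewrite mulrA -{1}(@cabs_nat R) -cabsM FA fps_sum.
  apply: (@le_trans _ _ (\sum_l \sum_(k < n.+1) K * (cabs (F l k) * y ^+ k))); last first.
    rewrite exchange_big mulr_sumr; apply: ler_sum => k _.
    by rewrite mulr_sumr.
  apply: (@le_trans _ _ ((\sum_l cabs ((A j l * F l) n)) * y ^+ n)).
    by rewrite ler_wpM2r // cabs_sum.
  rewrite mulr_suml; apply: ler_sum => l _; rewrite mulrC [A j l * F l]mulrC.
  apply: (@le_trans _ _ (y ^+ n * \sum_(k < n.+1) cabs (F l k * A j l (n - k)%N))).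
    by rewrite ler_wpM2l // fpsM cabs_sum.
  rewrite mulr_sumr; apply: ler_sum => k _.
  rewrite cabsM -[in y ^+ n](@subnK k n) -1?ltnS // exprD.
  apply: (@le_trans _ _ ((cabs (A j l (n - k)%N) * y ^+ (n - k)) * (cabs (F l k) * y ^+ k))).
    by rewrite le_eqVlt; apply/orP; left; apply/eqP; ring.
  by rewrite ler_wpM2r // mulr_ge0 ?cabs_ge0.
have [B BP] := gronwall_discrete Phi0 (mulr_ge0 (ler0n _ m) K0) y01 PhiK.
exists B => n; apply: le_trans (BP n); rewrite -exprM mulnC exprM expr2 mulrA.
rewrite ler_wpM2r // /Phi (bigD1 i) //= lerDl sumr_ge0 // => j _.
by rewrite mulr_ge0 ?cabs_ge0.
Qed.

End RegularSingular.

(** * Evaluation of power series in the unit disc *)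

Section Evaluation.
Variable R : realType.
Local Notation C := R[i].
Local Notation fps := (fps R).

Lemma cvg_cabs (u : nat -> C) (L : C) (b : nat -> R) :
  (forall N, cabs (L - u N) <= b N) -> b @ \oo --> (0 : R) -> u @ \oo --> L.
Proof.
move=> ub b0; apply/cvgrPdist_le => e e0.
have [er eE] : exists er : R, e = er%:C.
  by exists (complex.Re e); rewrite RRe_real // gtr0_real.
have er0 : 0 < er by move: e0; rewrite eE ltcR.
have /cvgrPdist_le/(_ _ er0) := b0; apply: filterS => N.
rewrite sub0r normrN => h; rewrite cabsE eE lecR; apply: le_trans (ub N) _.
exact: le_trans (ler_norm _) h.
Qed.

Lemma geometric_tail (r : R) (N k : nat) : 0 <= r < 1 ->
  \sum_(n < k) r ^+ (N + n) <= r ^+ N / (1 - r).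
Proof.
move=> r01; under eq_bigr do rewrite exprD.
rewrite -mulr_sumr ler_wpM2l ?geometric_sum_le // exprn_ge0 //; by case/andP: r01.
Qed.

Lemma cvg_geometric0 (r K : R) : 0 <= r < 1 -> (fun N => K * r ^+ N) @ \oo --> (0 : R).
Proof.
move=> /andP[r0 r1]; rewrite -[X in _ --> X](mulr0 K); apply: cvgM; first exact: cvg_cst.
by apply: cvg_expr; rewrite ger0_norm.
Qed.

Lemma real_series_limit (a : nat -> R) (K r : R) : 0 <= r < 1 ->
  (forall n, `|a n| <= K * r ^+ n) ->
  exists L : R, (fun N => \sum_(n < N) a n) @ \oo --> L.
Proof.
move=> /andP[r0 r1] aK.
have K0 : 0 <= K by have := aK 0%N; rewrite mulr1; apply: le_trans.
have -> : (fun N => \sum_(n < N) a n) = series a.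
  by apply/funext => N; rewrite seriesEord.
exists (limn (series a)); apply: (normed_cvg (V := R)).
apply: (series_le_cvg (v_ := geometric K r)) => [n|n|n|].
- exact: normr_ge0.
- by rewrite /= mulr_ge0 ?exprn_ge0.
- exact: aK.
by apply: is_cvg_geometric_series; rewrite ger0_norm.
Qed.

Lemma series_limit (a : nat -> C) (K r : R) : 0 <= r < 1 ->
  (forall n, cabs (a n) <= K * r ^+ n) ->
  exists L : C, forall N, cabs (L - \sum_(n < N) a n) <= K / (1 - r) * r ^+ N.
Proof.
move=> r01 aK; have K0 : 0 <= K by have := aK 0%N; rewrite mulr1; apply: le_trans (cabs_ge0 _).
have [|x ax] := @real_series_limit (fun n => complex.Re (a n)) K r r01.
  by move=> n; apply: le_trans (aK n); exact: cabs_Re.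
have [|y ay] := @real_series_limit (fun n => complex.Im (a n)) K r r01.
  by move=> n; apply: le_trans (aK n); exact: cabs_Im.
exists (Complex x y) => N; apply/ler_addgt0Pr => e e0.
have e2 : 0 < e / 2 by rewrite divr_gt0.
have /cvgrPdist_le/(_ _ e2) [Nx _ Px] := ax.
have /cvgrPdist_le/(_ _ e2) [Ny _ Py] := ay.
(* The partial sum of length N + k, with k past both ranks, is within e of the limit; its distance
   to the sum of length N is a geometric tail. *)
pose k := (Nx + Ny)%N; pose S m := \sum_(n < m) a n.
have SE m : S m = Complex (\sum_(n < m) complex.Re (a n)) (\sum_(n < m) complex.Im (a n)).
  elim: m => [|m IH]; first by rewrite /S !big_ord0.
  by rewrite /S big_ord_recr -/(S m) IH !big_ord_recr; case: (a m).
rewrite -/(S N) (_ : _ - _ = (Complex x y - S (N + k)%N) + (S (N + k)%N - S N)); last first.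
  by rewrite addrA subrK.
apply: le_trans (cabsD _ _) _; rewrite addrC lerD //.
  rewrite /S big_split_ord /= addrAC subrr add0r; apply: le_trans (cabs_sum _ _ _) _.
  apply: (@le_trans _ _ (\sum_(n < k) K * r ^+ (N + n))); first exact: ler_sum.
  by rewrite -mulr_sumr -mulrA ler_wpM2l // mulrC geometric_tail.
rewrite SE; apply: le_trans (cabs_le_ReIm _) _; rewrite [e]splitr lerD //.
  by apply: Px => /=; rewrite /k; lia.
by apply: Py => /=; rewrite /k; lia.
Qed.

Definition psum (f : fps) (N : nat) (q : C) : C := \sum_(n < N) f n * q ^+ n.

Definition fps_eval (f : fps) (q : C) : C := limn (fun N => psum f N q).

Lemma conv_term_bound (f : fps) (x r : R) : conv f -> 0 < x < 1 -> 0 <= r ->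
  exists K : R, forall q : C, cabs q <= x * r -> forall n,
    cabs (f n * q ^+ n) <= K * r ^+ n.
Proof.
move=> cf x01 r0; have [K fK] := cf x x01; exists K => q qx n.
rewrite cabsM cabsX; case/andP: x01 => /ltW x0 _.
apply: (@le_trans _ _ (cabs (f n) * (x * r) ^+ n)).
  by rewrite ler_wpM2l ?cabs_ge0 // lerXn2r // nnegrE ?cabs_ge0 // mulr_ge0.
by rewrite exprMn mulrA ler_wpM2r // exprn_ge0.
Qed.

(** K is independent of q on the disc of radius x r; local uniformity rests on this. *)
Lemma psum_limit (f : fps) (x r : R) : conv f -> 0 < x < 1 -> 0 <= r < 1 ->
  exists K : R, forall q : C, cabs q <= x * r -> forall N,
    cabs (fps_eval f q - psum f N q) <= K * r ^+ N.
Proof.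
move=> cf x01 r01; have [r0 _] := andP r01.
have [K fK] := conv_term_bound cf x01 r0; exists (K / (1 - r)) => q qx.
have [L LP] := series_limit r01 (fK q qx).
suff -> : fps_eval f q = L by [].
apply: (cvg_lim (@norm_hausdorff _ _)).
exact: (cvg_cabs LP (cvg_geometric0 _ r01)).
Qed.

Lemma disc_radii (t : R) : 0 <= t < 1 ->
  exists x r : R, [/\ 0 < x < 1, 0 <= r < 1 & t < x * r].
Proof.
(* The square of (1 + t)/2 exceeds t by ((1 - t)/2)^2. *)
move=> /andP[t0 t1]; exists ((1 + t) / 2 ), ((1 + t) / 2); split.
- by apply/andP; split; lra.
- by apply/andP; split; lra.
- by nra.
Qed.

Lemma psum_cvg (f : fps) (q : C) : conv f -> cabs q < 1 ->
  (fun N => psum f N q) @ \oo --> fps_eval f q.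
Proof.
move=> cf q1; have q01 : 0 <= cabs q < 1 by rewrite cabs_ge0.
have [x [r [x01 r01 qx]]] := disc_radii q01.
have [K KP] := psum_limit cf x01 r01.
exact: (cvg_cabs (KP q (ltW qx)) (cvg_geometric0 _ r01)).
Qed.

Lemma fps_eval_unique (f : fps) (q L : C) :
  (fun N => psum f N q) @ \oo --> L -> fps_eval f q = L.
Proof. exact: (cvg_lim (@norm_hausdorff _ _)). Qed.

Lemma fps_evalD (f g : fps) (q : C) : conv f -> conv g -> cabs q < 1 ->
  fps_eval (f + g) q = fps_eval f q + fps_eval g q.
Proof.
move=> cf cg q1; apply: fps_eval_unique.
rewrite (_ : (fun N => _) = (fun N => psum f N q + psum g N q)).
  by apply: cvgD; exact: psum_cvg.
by apply/funext => N; rewrite /psum -big_split; apply: eq_bigr => n _; rewrite fpsE mulrDl.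
Qed.

Lemma fps_evalCM (k : C) (f : fps) (q : C) : conv f -> cabs q < 1 ->
  fps_eval (fpsC k * f) q = k * fps_eval f q.
Proof.
move=> cf q1; apply: fps_eval_unique.
rewrite (_ : (fun N => _) = (fun N => k * psum f N q)).
  by apply: cvgM; [exact: cvg_cst | exact: psum_cvg].
by apply/funext => N; rewrite /psum mulr_sumr; apply: eq_bigr => n _; rewrite fpsCM mulrA.
Qed.

Lemma fps_eval0 (q : C) : fps_eval 0 q = 0.
Proof.
apply: fps_eval_unique; rewrite (_ : (fun N => _) = cst 0); first exact: cvg_cst.
by apply/funext => N; rewrite /psum big1 // => n _; rewrite mul0r.
Qed.

Lemma fps_eval_sum (J : Type) (s : seq J) (f : J -> fps) (q : C) :
  (forall j, conv (f j)) -> cabs q < 1 ->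
  fps_eval (\sum_(j <- s) f j) q = \sum_(j <- s) fps_eval (f j) q.
Proof.
move=> cf q1; elim: s => [|j s IH]; first by rewrite !big_nil fps_eval0.
by rewrite !big_cons fps_evalD // ?IH //; exact: conv_sum.
Qed.

(** The product of the partial sums and the partial sum of the product agree below degree N. The
    excess has degrees N to 2N - 1 and terms at most K L (n + 1) r^n; writing r = y^2 bounds it by a
    multiple of y^N. *)
Lemma fps_evalM (f g : fps) (q : C) : conv f -> conv g -> cabs q < 1 ->
  fps_eval (f * g) q = fps_eval f q * fps_eval g q.
Proof.
move=> cf cg q1; have q01 : 0 <= cabs q < 1 by rewrite cabs_ge0.
have [x [r [x01 r01 qx]]] := disc_radii q01; have [r0 r1] := andP r01.
have rp : 0 < r.
  rewrite lt_neqAle r0 andbT; apply: contraTneq qx => <-.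
  by rewrite mulr0 -leNgt cabs_ge0.
have [|y y01 rE] := @sqrt_root R r; first by rewrite rp.
have [y0 y1] := andP y01; have y01' : 0 <= y < 1 by rewrite ltW.
have [K fK] := conv_term_bound cf x01 r0; have {}fK := fK q (ltW qx).
have [L gL] := conv_term_bound cg x01 r0; have {}gL := gL q (ltW qx).
have K0 : 0 <= K by have := fK 0%N; rewrite !mulr1; apply: le_trans (cabs_ge0 _).
have L0 : 0 <= L by have := gL 0%N; rewrite !mulr1; apply: le_trans (cabs_ge0 _).
have cfg : (fun N => psum f N q * psum g N q) @ \oo --> fps_eval f q * fps_eval g q.
  by apply: cvgM; exact: psum_cvg.
rewrite -[RHS](cvg_lim (@norm_hausdorff _ _) cfg).
rewrite /fps_eval; symmetry; apply: (cvg_lim (@norm_hausdorff _ _)).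
set E := limn _.
have E_cvg : (fun N => psum (f * g) N q) @ \oo --> E by apply: psum_cvg => //; exact: convM.
pose B := K * L * (1 - y)^-1 / (1 - y).
have tail N : cabs (psum f N q * psum g N q - psum (f * g) N q) <= B * y ^+ N.
  have pE (h : fps) : psum h N q = (fps_trunc N h).[q] by rewrite horner_poly.
  rewrite !pE -hornerM.
  have sz : (size (fps_trunc N f * fps_trunc N g)%R <= N + N)%N.
    apply: leq_trans (size_polyMleq _ _) _; apply: leq_trans (leq_pred _) _.
    by apply: leq_add; exact: size_poly.
  rewrite (horner_coef_wide _ sz) big_split_ord /= horner_poly.
  rewrite (_ : \sum_(i < N) _ = \sum_(i < N) (f * g) i * q ^+ i); last first.
    by apply: eq_bigr => i _; rewrite -fps_mul_trunc.
  rewrite addrAC subrr add0r; apply: le_trans (cabs_sum _ _ _) _.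
  apply: (@le_trans _ _ (\sum_(i < N) K * L * (1 - y)^-1 * y ^+ (N + i))); last first.
    by rewrite -mulr_sumr /B -!mulrA !ler_wpM2l ?invr_ge0 ?subr_ge0 ?(ltW y1) // mulrC geometric_tail.
  apply: ler_sum => i _; set n := (N + i)%N.
  apply: (@le_trans _ _ (K * L * (n.+1%:R * y ^+ n) * y ^+ n)); last first.
    rewrite ler_wpM2r ?exprn_ge0 ?(ltW y0) // ler_wpM2l ?mulr_ge0 //.
    exact: linear_geometric_le.
  rewrite coefM mulr_suml; apply: le_trans (cabs_sum _ _ _) _.
  apply: (@le_trans _ _ (\sum_(j < n.+1) K * L * r ^+ n)); last first.
    by rewrite sumr_const card_ord -mulr_natl rE -exprM mulnC exprM expr2 le_eqVlt;
      apply/orP; left; apply/eqP; ring.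
  apply: ler_sum => j _.
  have trunc_le (h : fps) H k : 0 <= H -> (forall k, cabs (h k * q ^+ k) <= H * r ^+ k) ->
      cabs ((fps_trunc N h)`_k * q ^+ k) <= H * r ^+ k.
    move=> H0 hH; rewrite coef_fps_trunc; case: ifP => _ //.
    by rewrite mul0r cabs0 mulr_ge0 // exprn_ge0.
  rewrite -[in q ^+ n](@subnKC j n) -1?ltnS // exprD mulrACA cabsM.
  rewrite -[in r ^+ n](@subnKC j n) -1?ltnS // exprD mulrACA.
  by apply: ler_pM; rewrite ?cabs_ge0 ?trunc_le.
have d0 : (fun N => psum f N q * psum g N q - psum (f * g) N q) @ \oo --> (0 : C).
  apply: (cvg_cabs (b := fun N => B * y ^+ N)) => [N|]; last exact: cvg_geometric0.
  by rewrite sub0r cabsN.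
rewrite -[E]addr0 (_ : (fun N => _) = (fun N => psum (f * g) N q +
    (psum f N q * psum g N q - psum (f * g) N q))); first exact: (cvgD E_cvg d0).
by apply/funext => N; rewrite [RHS]addrC subrK.
Qed.

Lemma conv_locally_uniform (f : fps) : conv f ->
  cvg_locally_uniformly_on (unit_disc R) (psum f).
Proof.
move=> cf; exists (fps_eval f) => q0 q01.
have q0r : 0 <= cabs q0 < 1.
  by rewrite cabs_ge0 -ltcR -cabsE.
have [x [r [x01 r01 qx]]] := disc_radii q0r.
have [K KP] := psum_limit cf x01 r01.
exists [set q | cabs q < x * r].
  have e0 : 0 < (x * r - cabs q0)%:C by rewrite ltcR subr_gt0.
  apply/nbhs_ballP; exists (x * r - cabs q0)%:C => //= q.
  rewrite -ball_normE /= cabsE ltcR -cabsN opprB ltrBrDr => h.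
  by apply: le_lt_trans h; rewrite -{1}(subrK q0 q) cabsD.
move=> P /uniform_nbhs [E [entE EP]]; apply: filterS EP _.
move: entE; rewrite -entourage_ballE => -[e /= e0 eE].
have [er eEr] : exists er : R, e = er%:C.
  by exists (complex.Re e); rewrite RRe_real // gtr0_real.
have er0 : 0 < er by move: e0; rewrite eEr ltcR.
have /cvgrPdist_lt/(_ _ er0) := cvg_geometric0 K r01.
apply: filterS => N; rewrite sub0r normrN => h q [qxr _]; apply: eE.
rewrite /= -ball_normE /= cabsE eEr ltcR.
apply: le_lt_trans (KP q (ltW qxr) N) _; exact: le_lt_trans (ler_norm _) h.
Qed.

End Evaluation.

(** * Convergence of the trace functions *)

Section Convergence.
Variable R : realType.
Local Notation C := R[i].
Local Notation fps := (fps R).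
Variables (V : voa R) (W M : admissible_module V) (hW hM : C).
Hypotheses (Wh : has_conformal_weight W hW) (Mord : ordinary M hM).
Variable I : intertwining W M hW.
Local Notation F := (trace_series I).

Definition zhu_coef (wt s i l : nat) : C :=
  binc (- l%:R) s * binc (wt%:R - 1 + l%:R) i - binc l%:R s * binc (wt%:R - 1 - l%:R) i.

(** The coefficients are polynomial in l, since [binc] is polynomial in its first argument. *)
Lemma conv_zhu_coef wt s i : conv (lambert (zhu_coef wt s i)).
Proof.
apply: conv_lambert.
have c1 : conv (fun l => binc (- l%:R : C) s).
  rewrite (_ : (fun l => _) = (fun n => binc ((-1) * n%:R + 0) s)); first exact: conv_binc.
  by apply/funext => l; rewrite mulN1r addr0.
have c2 : conv (fun l => binc (wt%:R - 1 + l%:R : C) i).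
  rewrite (_ : (fun l => _) = (fun n => binc (1 * n%:R + (wt%:R - 1)) i)); first exact: conv_binc.
  by apply/funext => l; rewrite mul1r addrC.
have c3 : conv (fun l => binc (l%:R : C) s).
  rewrite (_ : (fun l => _) = (fun n => binc (1 * n%:R + 0) s)); first exact: conv_binc.
  by apply/funext => l; rewrite mul1r addr0.
have c4 : conv (fun l => binc (wt%:R - 1 - l%:R : C) i).
  rewrite (_ : (fun l => _) = (fun n => binc ((-1) * n%:R + (wt%:R - 1)) i)); first exact: conv_binc.
  by apply/funext => l; rewrite mulN1r addrC.
apply: (@convD _ (fun l => binc (- l%:R) s * binc (wt%:R - 1 + l%:R) i)
  (- (fun l => binc l%:R s * binc (wt%:R - 1 - l%:R) i : C) : fps)).
  exact: conv_pointwise.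
by apply: convN; exact: conv_pointwise.
Qed.

Lemma zhu_recursion_coef (a : V) wt (u : W) d N s : weight_space V wt a -> piece W d u ->
  (forall r : int, N%:Z <= r -> mmode a r u = 0) ->
  F (residue a u N (binc wt%:R) s.+1) =
  fpsC (s == 0)%:R * (trace_au I a wt u d 0 : fps) +
  \sum_(i < N) lambert (zhu_coef wt s i) * F (mmode a i%:Z u).
Proof.
move=> awt ud auN; apply/funext => n.
rewrite (zhu_recursion Wh Mord I awt ud auN) fpsE fpsCM; congr (_ + _).
rewrite fps_sum; under [RHS]eq_bigr => i _ do rewrite -lambertM.
rewrite exchange_big; apply: eq_bigr => l _ /=.
have GE (j : int) : F (residue a u N (binc (wt%:R - 1 + j%:~R)) 0) =
    \sum_(i < N) fpsC (binc (wt%:R - 1 + j%:~R) i) * F (mmode a i%:Z u).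
  rewrite /residue addn0 (trace_series_sum Wh Mord); apply: eq_bigr => i _.
  by rewrite subr0.
have gGE (j : int) : (geom R l.+1 * F (residue a u N (binc (wt%:R - 1 + j%:~R)) 0)) n =
    \sum_(i < N) binc (wt%:R - 1 + j%:~R) i * (geom R l.+1 * F (mmode a i%:Z u)) n.
  rewrite GE big_distrr /= fps_sum; apply: eq_bigr => i _.
  by rewrite mulrCA fpsCM.
rewrite (gGE l.+1%:Z).
rewrite (gGE (- l.+1%:Z)).
rewrite [X in X - _]big_distrr.
rewrite [X in _ - X]big_distrr.
rewrite -sumrB.
apply: eq_bigr => i _ /=.
rewrite /zhu_coef rmorphN /= -pmulrn.
by ring.
Qed.

Section Span.
Variables (m : nat) (e : 'I_m -> W).

Definition conv_span (f : fps) : Prop :=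
  exists c : 'I_m -> fps, (forall j, conv (c j)) /\ f = \sum_j c j * F (e j).

Lemma conv_spanD (f g : fps) : conv_span f -> conv_span g -> conv_span (f + g).
Proof.
move=> [c [cc ->]] [d [cd ->]]; exists (fun j => c j + d j); split=> [j|].
  exact: convD.
by rewrite -big_split; apply: eq_bigr => j _; rewrite mulrDl.
Qed.

Lemma conv_spanM (k f : fps) : conv k -> conv_span f -> conv_span (k * f).
Proof.
move=> ck [c [cc ->]]; exists (fun j => k * c j); split=> [j|].
  exact: (convM ck (cc j)).
by rewrite mulr_sumr; apply: eq_bigr => j _; rewrite mulrA.
Qed.

Lemma conv_span0 : conv_span 0.
Proof.
exists (fun=> 0); split=> [j|]; first exact: conv0.
by rewrite big1 // => j _; rewrite mul0r.
Qed.

Lemma conv_spanN (f : fps) : conv_span f -> conv_span (- f).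
Proof.
move=> cf; rewrite -mulN1r -fpsC1 -rmorphN; apply: conv_spanM => //.
exact: conv_fpsC.
Qed.

Lemma conv_span_sum (J : Type) (r : seq J) (f : J -> fps) :
  (forall j, conv_span (f j)) -> conv_span (\sum_(j <- r) f j).
Proof. by move=> cf; elim/big_ind: _ => //; [exact: conv_span0|exact: conv_spanD]. Qed.

Lemma conv_span_generator j : conv_span (F (e j)).
Proof.
exists (fun i => fpsC (i == j)%:R); split=> [i|]; first exact: conv_fpsC.
rewrite (bigD1 j) //= eqxx fpsC1 mul1r big1 ?addr0 // => i /negPf ->.
by rewrite fpsC0 mul0r.
Qed.

Lemma conv_span_linear (X : lmodType C) (f : X -> W) (S : nat -> set X) : direct_sum S ->
  linear f -> (forall n x, S n x -> conv_span (F (f x))) -> forall x, conv_span (F (f x)).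
Proof.
move=> dS lf Sf x; have [N [_ ->]] := component_bound dS x.
have := linear_sumZ (fun=> 1) (fun n : 'I_N => component S n x) lf.
under eq_bigr do rewrite scale1r; move=> ->.
rewrite (trace_series_sum Wh Mord); apply: conv_span_sum => i.
apply: conv_spanM; first exact: conv_fpsC.
by apply: Sf; exact: component_piece.
Qed.

Variable U : set W.
Hypotheses (U_graded : graded_subspace U) (U_basis : is_basis U e).
Hypothesis U_C2 : forall x : W, exists u1 u2, [/\ U u1, C2 W u2 & x = u1 + u2].

Let dW := am_direct_sum W.

(** The case s = 1 has no zero mode term. Apart from a_(-2)u, of degree n = wt + d + 1, only a_(r)u
    with r >= -1 occur, and these have degree at most wt + d. *)
Lemma conv_span_C2_homog n (a : V) wt (u : W) d : weight_space V wt a -> piece W d u ->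
  n = (wt + d).+1 ->
  (forall k w, (k < n)%N -> piece W k w -> conv_span (F w)) ->
  conv_span (F (mmode a (-2) u)).
Proof.
move=> awt ud nE IH; have [N auN] := mode_bound a u.
have low (r : int) : -1 <= r -> conv_span (F (mmode a r u)).
  move=> r1; have := mmode_degree awt ud r.
  case zE: (wt%:Z + d%:Z - r - 1) => [k|k] /= ku; first by apply: IH ku; lia.
  by rewrite ku (trace_series0 Wh Mord); exact: conv_span0.
have zr := zhu_recursion_coef 1 awt ud auN.
have resE : residue a u N (binc wt%:R) 2 = mmode a (-2) u +
    \sum_(i < N.+1) binc wt%:R i.+1 *: mmode a (i%:Z - 1) u.
  rewrite /residue addnS addn1 big_ord_recl binc0 scale1r; congr (_ + _).
have -> : F (mmode a (-2) u) =
    (\sum_(i < N) lambert (zhu_coef wt 1 i) * F (mmode a i%:Z u)) -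
    \sum_(i < N.+1) fpsC (binc wt%:R i.+1) * F (mmode a (i%:Z - 1) u).
  apply/eqP; rewrite -subr_eq opprK -(trace_series_sum Wh Mord).
  rewrite -[F _]mul1r -fpsC1 -(trace_seriesP Wh Mord) scale1r -resE zr.
  by rewrite fpsC0 mul0r add0r.
apply: conv_spanD; last apply: conv_spanN.
  by apply: conv_span_sum => i; apply: conv_spanM; [exact: conv_zhu_coef | apply: low; lia].
by apply: conv_span_sum => i; apply: conv_spanM; [exact: conv_fpsC | apply: low; lia].
Qed.

Lemma conv_span_homog n (w : W) : piece W n w -> conv_span (F w).
Proof.
have [k] := ubnP n; elim: k n w => // k IHk n w /ltnSE nk nw.
have IH j x : (j < n)%N -> piece W j x -> conv_span (F x).
  by move=> jn; apply: IHk; exact: leq_trans nk.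
have lc := component_linear dW n.
have [u1 [u2 [u1U u2C wE]]] := U_C2 w.
rewrite -(component_id dW nw) wE (linearD_Prop lc) -[X in X + _]scale1r.
rewrite (trace_seriesP Wh Mord) fpsC1 mul1r; apply: conv_spanD.
  have [c ->] := basis_coord U_basis (proj2 U_graded n _ u1U).
  rewrite (trace_series_sum Wh Mord); apply: conv_span_sum => j.
  by apply: conv_spanM; [exact: conv_fpsC | exact: conv_span_generator].
(* Membership in the span C_2(W) is used through its minimality, with a condition on the degree n
   component only: generators a_(-2)v need not be homogeneous. *)
pose A := [set x : W | conv_span (F (component (piece W) n x))].
suff : A u2 by [].
apply: u2C; split=> [|_ [a [v ->]]].
  split=> [|c x y Ax Ay].
    by rewrite /A /= (component0 dW) (trace_series0 Wh Mord); exact: conv_span0.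
  rewrite /A /= lc (trace_seriesP Wh Mord); apply: conv_spanD => //.
  by apply: conv_spanM => //; exact: conv_fpsC.
have dV := voa_grading (voaP V).
apply: (conv_span_linear (f := fun a => component (piece W) n (mmode a (-2) v)) dV).
  by move=> c x y; rewrite mmode_linear_l lc.
move=> wt {}a awt.
apply: (conv_span_linear (f := fun v => component (piece W) n (mmode a (-2) v)) dW).
  by move=> c x y; rewrite mmode_linear_r lc.
move=> d {}v dv; have avd := mmode_degree awt dv (-2).
have [wd|wd] := eqVneq n%:Z (wt%:Z + d%:Z - -2 - 1); last first.
  rewrite (int_grading_component dW avd wd) (trace_series0 Wh Mord); exact: conv_span0.
rewrite -wd /= in avd; rewrite (component_id dW avd).
by apply: (conv_span_C2_homog (n := n) awt dv) => //; lia.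
Qed.

Lemma conv_span_all (w : W) : conv_span (F w).
Proof.
by apply: (conv_span_linear (f := id) dW) => // n x; exact: conv_span_homog.
Qed.

Definition fps_theta (f : fps) : fps := fun n => n%:R * f n.

Lemma conv_span_theta_homog d (u : W) : piece W d u -> conv_span (fps_theta (F u)).
Proof.
move=> ud; have omwt := voa_conf_weight (voaP V).
have [N auN] := mode_bound (conformal_vector V) u.
have zr := zhu_recursion_coef 0 omwt ud auN; rewrite fpsC1 mul1r in zr.
(* The zero mode of omega is L(0), which acts on M(n) as hM + n. *)
have TE : (trace_au I (conformal_vector V) 2 u d 0 : fps) = fpsC hM * F u + fps_theta (F u).
  apply/funext => n; rewrite fpsE fpsCM /fps_theta -mulrDl /trace_au.
  have dM := am_direct_sum M; have sM := piece_subspace dM n.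
  have po := o_int_preserves Wh Mord I u (n := n).
  have lo := o_int_linear_r I u.
  rewrite /trace_series /trace_coef -[RHS]addr0.
  rewrite -(trace_on0 sM (proj2 Mord n) (f := fun=> 0)) //; last first.
    by move=> k x y; rewrite scaler0 addr0.
  rewrite -(trace_onP sM (proj2 Mord n)) //; last 2 first.
  - by move=> k x y; rewrite scaler0 addr0.
  - by move=> x _; exact: subspace0 sM.
  apply: (eq_trace_on sM (proj2 Mord n)).
  - by move=> k x y /=; rewrite umode_linear amode_linear.
  - by move=> k x y; rewrite !addr0 lo scalerDr !scalerA mulrC.
  - exact: (au_preserves Wh Mord I omwt ud 0).
  move=> x nx; rewrite addr0 /= oppr0.
  have -> : umode I u d 0 x = o_int I u x.
    by rewrite (o_int_homog I x (D := d%:Z) ud) /umode addr0.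
  have := po _ nx; rewrite {1}(proj1 Mord) /= => <-.
  by rewrite /amode /Lop; congr (mmode _ _ _).
have -> : fps_theta (F u) =
    F (residue (conformal_vector V) u N (binc 2%:R) 1) -
    (\sum_(i < N) lambert (zhu_coef 2 0 i) * F (mmode (conformal_vector V) i%:Z u)) -
    fpsC hM * F u.
  by rewrite zr TE addrK addrAC subrr add0r.
apply: conv_spanD; last first.
  by apply/conv_spanN/conv_spanM; [exact: conv_fpsC | exact: conv_span_all].
apply: conv_spanD; first exact: conv_span_all.
apply/conv_spanN/conv_span_sum => i.
by apply: conv_spanM; [exact: conv_zhu_coef | exact: conv_span_all].
Qed.

Lemma conv_span_theta (w : W) : conv_span (fps_theta (F w)).
Proof.
have [N [_ ->]] := component_bound dW w.
rewrite (_ : fps_theta _ = \sum_(d < N) fps_theta (F (component (piece W) d w))).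
  by apply: conv_span_sum => d; apply: conv_span_theta_homog; exact: component_piece.
have := trace_series_sum Wh Mord I (index_enum 'I_N) (fun=> 1) (fun d => component (piece W) d w).
under eq_bigr do rewrite scale1r; move=> ->.
apply/funext => n; rewrite /fps_theta !fps_sum mulr_sumr; apply: eq_bigr => d _.
by rewrite fpsCM mul1r.
Qed.

Lemma conv_trace_basis (j : 'I_m) : conv (F (e j)).
Proof.
have H i : {A : 'I_m -> fps | (forall j, conv (A j)) /\
    fps_theta (F (e i)) = \sum_j A j * F (e j)}.
  by apply: cid; exact: conv_span_theta.
pose A i := sval (H i).
apply: (conv_regular_singular (A := A) (F := fun j => F (e j))) => [i k|i n].
  by have [h _] := svalP (H i); exact: h.
by have [_ /(congr1 (fun f : fps => f n))] := svalP (H i).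
Qed.

Lemma conv_trace_series (w : W) : conv (F w).
Proof.
have [c [cc ->]] := conv_span_all w; apply: conv_sum => j _.
by apply: convM => //; exact: conv_trace_basis.
Qed.

End Span.
End Convergence.

(** * Square brackets and Eisenstein series *)

Section SquareBrackets.
Variable R : realType.
Local Notation C := R[i].
Local Notation fps := (fps R).
Local Notation X := (fpsX R).
Local Notation ell := (@fps_ln1pz R : fps).
Local Notation tp := (twopii R).
Variables (V : voa R) (W M : admissible_module V) (hW hM : C).
Hypotheses (Wh : has_conformal_weight W hW) (Mord : ordinary M hM).
Variable I : intertwining W M hW.
Local Notation F := (trace_series I).

Lemma twopii_neq0 : tp != 0.
Proof.
suff : tp ^+ 2 != 0 by rewrite expf_eq0.
rewrite twopii_sqr oppr_eq0 fmorph_eq0 expf_neq0 //.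
by rewrite mulf_neq0 // gt_eqF // pi_gt0.
Qed.

Definition eisenstein_series (k : nat) : fps :=
  fpsC (2 * (zeta R (2 * k))%:C) +
  fpsC (2 * tp ^+ (2 * k) / (2 * k - 1)`!%:R) * lambert (fun l => l%:R ^+ (2 * k - 1)).

Lemma polar_regularE (b : fps) k p :
  polar_regular b k p = b (k + p).+1 * ('C(k + p, k) * k`!)%:R.
Proof.
rewrite /polar_regular addSn; congr (_ * _); rewrite bin_ffact ffact_prod natr_prod.
apply: eq_bigr => i _; rewrite natrB; last by rewrite (leq_trans (ltnW (ltn_ord i))) // leq_addr.
by rewrite -addn1 -[i.+1]addn1 !natrD; ring.
Qed.

(** Parity decides: for even k + p the sign factor vanishes, and so does the Bernoulli number, whose
    index k + p + 1 is odd and greater than 1. For odd k + p the weight k + p + 1 is even and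
    Euler's formula applies. *)
Lemma zhu_relation_coef k p : (0 < k)%N ->
  fpsC ((-1) ^+ k * tp ^+ (k + p).+1 / k`!%:R) *
   (fpsC ((1 - (-1) ^+ (k + p)) / p`!%:R) * lambert (fun l => l%:R ^+ (k + p))
    - fpsC (polar_regular (bernoulli_series R) k p)) =
  if odd (k + p) then
    fpsC ((-1) ^+ k * 'C(k + p, k)%:R) * eisenstein_series (k + p).+1./2
  else 0.
Proof.
move=> k0; rewrite polar_regularE -[(-1) ^+ (k + p)]signr_odd; case okp: (odd (k + p)); last first.
  rewrite expr0 subrr mul0r fpsC0 mul0r sub0r.
  by rewrite bernoulli_odd ?mul0r ?fpsC0 ?oppr0 ?mulr0 //= ?okp // ltnS addn_gt0 k0.
rewrite expr1 opprK; set h := (k + p).+1./2.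
have hE : (k + p).+1 = (2 * h)%N.
  by rewrite mul2n -[LHS]odd_double_half /= okp.
have [h' h'E] : exists h', h = h'.+1 by exists h.-1; lia.
rewrite /eisenstein_series -hE subn1 /= {2}hE h'E bernoulli_even -h'E -hE.
have kf0 n : n`!%:R != 0 :> C by rewrite pnatr_eq0 -lt0n fact_gt0.
have <- : 'C(k + p, k)%:R * (k`!%:R * p`!%:R) = (k + p)`!%:R :> C.
  by rewrite -!natrM -{2}(addKn k p) bin_fact // leq_addr.
have tp0 : tp ^+ (k + p).+1 != 0 by rewrite expf_neq0 // twopii_neq0.
have b0 : 'C(k + p, k)%:R != 0 :> C by rewrite pnatr_eq0 -lt0n bin_gt0 leq_addr.
rewrite natrM mulrBr mulrDr !mulrA -!(rmorphM (@fpsC R)) /= addrC; congr (_ + _).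
  rewrite -rmorphN /=; congr fpsC.
  move: tp0; move: (tp ^+ _) => t t0; move: (zeta _ _)%:C => z.
  move: (kf0 k); move: (k`!%:R) => x x0; move: ('C(k + p, k)%:R : C) => y; move: ((-1) ^+ k) => s.
  by field; rewrite x0 t0.
congr (fpsC _ * _).
move: tp0; move: (tp ^+ _) => t t0.
move: (kf0 k) (kf0 p) b0; move: (k`!%:R) (p`!%:R) ('C(k + p, k)%:R) => x y w x0 y0 w0.
by field; rewrite x0 y0 w0.
Qed.

Lemma sum_double (A : nmodType) (D : nat -> A) n :
  \sum_(j < n.*2) D j = \sum_(K < n) D K.*2 + \sum_(K < n) D K.*2.+1.
Proof.
elim: n => [|n IH]; first by rewrite !big_ord0 addr0.
by rewrite doubleS !big_ord_recr /= IH addrACA !addrA.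
Qed.

Section Homogeneous.
Variables (a : V) (wt : nat) (u : W) (d : nat) (N : nat).
Hypotheses (awt : weight_space V wt a) (ud : piece W d u).
Hypothesis (auN : forall r : int, N%:Z <= r -> mmode a r u = 0).

Local Notation res := (residue a u N).
Local Notation B := (binc (wt%:R - 1) : fps).

Lemma residueD (f g : fps) s : res (f + g) s = res f s + res g s.
Proof. by rewrite /residue -big_split; apply: eq_bigr => i _; rewrite fpsE scalerDl. Qed.

Lemma residueCM c (f : fps) s : res (fpsC c * f) s = c *: res f s.
Proof. by rewrite /residue scaler_sumr; apply: eq_bigr => i _; rewrite fpsCM scalerA. Qed.

Lemma residue_sum n (c : nat -> C) (f : nat -> fps) s :
  res (\sum_(i < n) fpsC (c i) * f i) s = \sum_(i < n) c i *: res (f i) s.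
Proof.
elim: n => [|n IH]; last by rewrite !big_ord_recr residueD residueCM IH.
by rewrite !big_ord0 /residue big1 // => i _; rewrite scale0r.
Qed.

Lemma residueXM (f : fps) s : res (X * f) s.+1 = res f s.
Proof.
rewrite /residue addnS big_ord_recl fpsXM0 scale0r add0r; apply: eq_bigr => i _.
by rewrite lift0 fpsXMS; congr (_ *: mmode _ _ _); lia.
Qed.

Lemma residueXnM k (f : fps) s : res (X ^+ k * f) (s + k) = res f s.
Proof.
elim: k => [|k IH]; first by rewrite mul1r addn0.
by rewrite exprS -mulrA addnS residueXM.
Qed.

Lemma eq_residue0 (f g : fps) : (forall i, (i < N)%N -> f i = g i) -> res f 0 = res g 0.
Proof. by move=> fg; rewrite /residue addn0; apply: eq_bigr => i _; rewrite fg. Qed.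

(** Only coefficients below degree N matter, and t^p starts in degree p, so the series in t may be
    cut at N. *)
Lemma residue_comp (c : fps) :
  res (fpscomp (fpslog R) c * B) 0 = \sum_(p < N) c p *: res (fpslog R ^+ p * B) 0.
Proof.
rewrite -(residue_sum N c (fun p => fpslog R ^+ p * B)); apply: eq_residue0 => i iN.
rewrite fps_sum fpsM.
under eq_bigr => j _ do rewrite (@fpscompE _ _ (fpslog0 R) _ N) ?(leq_ltn_trans _ iN) -1?ltnS // mulr_suml.
rewrite exchange_big; apply: eq_bigr => p _ /=.
rewrite fpsCM fpsM mulr_sumr; apply: eq_bigr => j _; exact: (esym (mulrA _ _ _)).
Qed.

Lemma bracket_homog_nat k :
  bracket_homog wt a k%:Z u = tp ^ (- k%:Z - 1) *: res (fpslog R ^+ k * B) 0.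
Proof.
rewrite /bracket_homog; congr (_ *: _).
rewrite (fsbig_nat (N := N)) => [|i Ni]; last by rewrite auN ?scaler0 //; lia.
rewrite /residue addn0.
pose G i := (fpslog R ^+ k * B) i *: mmode a (i%:Z - 0) u.
rewrite -[RHS](big_ord_extend (F := G) (N := k + N)) ?leq_addl // => [|i Ni]; last first.
  by rewrite /G auN ?scaler0 //; lia.
rewrite big_split_ord [X in _ = X + _]big1 ?add0r => [|i _]; last first.
  by rewrite /G exprMn -mulrA fpsXnM /= ltn_ord scale0r.
apply: eq_bigr => i _; rewrite /G exprMn -mulrA fpsXnM /= ltnNge leq_addr /= addKn.
congr (_ *: mmode _ _ _); last by lia.
rewrite /bracket_coef -(fps_pow_nat (fps_ln1pz0 R)); reflexivity.
Qed.

Lemma bracket_homog_opp k :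
  bracket_homog wt a (- k.+1%:Z) u =
  tp ^+ k *: res ((fps_pow ell (- k.+1%:R) : fps) * B) k.+1.
Proof.
rewrite /bracket_homog opprK (_ : k.+1%:Z - 1 = k%:Z); last by lia.
congr (_ *: _); rewrite (fsbig_nat (N := N + k.+1)) => [|i Ni]; last first.
  by rewrite auN ?scaler0 //; lia.
by apply: eq_bigr => i _; congr (_ *: mmode _ _ _).
Qed.

Lemma bracket_homog_large (r : int) : N%:Z <= r -> bracket_homog wt a r u = 0.
Proof.
move=> Nr; rewrite /bracket_homog (fsbig_nat (N := 0)) ?big_ord0 ?scaler0 // => i _.
by rewrite auN ?scaler0 //; lia.
Qed.

Lemma residue_log p :
  res (fpslog R ^+ p * B) 0 = tp ^+ p.+1 *: bracket_homog wt a p%:Z u.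
Proof.
rewrite bracket_homog_nat scalerA.
rewrite (_ : - p%:Z - 1 = - p.+1%:Z); last by lia.
by rewrite -exprnN mulfV ?scale1r // expf_neq0 // twopii_neq0.
Qed.

(** (1 + z)^j = e^(jt) expands the commutator terms in the brackets a[p]u, with coefficients j^p. *)
Lemma residue_exp (j : int) :
  res (binc (wt%:R - 1 + j%:~R)) 0 =
  \sum_(p < N) (j%:~R ^+ p / p`!%:R * tp ^+ p.+1) *: bracket_homog wt a p%:Z u.
Proof.
rewrite addrC bincD binc_exp residue_comp; apply: eq_bigr => p _.
by rewrite residue_log scalerA.
Qed.

Lemma trace_bracket0 : F (bracket_homog wt a 0 u) = 0.
Proof.
have := bracket_homog_nat 0; rewrite expr0 mul1r => ->.
rewrite (trace_seriesZ Wh Mord).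
have := trace_commutator0 Wh Mord I awt ud auN; rewrite addr0 => ->.
by rewrite mulr0.
Qed.

Lemma polar_coef0 k : (0 < k)%N -> polar_coef R k 0 = 0.
Proof. by case: k => // k _ /=; rewrite oppr0 mul0r. Qed.

Lemma residue_polar k :
  res (polar R k * B) k.+1 = \sum_(s < k.+1) polar_coef R k s *: res (binc wt%:R) s.+1.
Proof.
rewrite polarE mulr_suml.
rewrite (_ : \sum_(i < k.+1) _ = \sum_(i < k.+1) fpsC (polar_coef R k i) *
    (X ^+ (k - i) * ((1 + X) * B))); last by apply: eq_bigr => i _; rewrite !mulrA.
rewrite (residue_sum k.+1 (polar_coef R k) (fun i => X ^+ (k - i) * ((1 + X) * B))).
apply: eq_bigr => -[s /= sk] _; congr (_ *: _).
rewrite -binc_nat1 -bincD [1 + _]addrC subrK -(residueXnM (k - s) (binc wt%:R)).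
by rewrite addSn subnKC.
Qed.

(** Summed against [polar_coef], the binomials of the recursion become l^k and (-l)^k, and the
    exponentials e^(lt) and e^(-lt) contribute l^p and (-l)^p; the difference is l^(k+p) (1 -
    (-1)^(k+p)). The zero mode drops out, its coefficient being 0 for k > 0. *)
Lemma trace_residue_polar k : (0 < k)%N ->
  F (res (polar R k * B) k.+1) =
  \sum_(p < N) fpsC (tp ^+ p.+1 / p`!%:R * (1 - (-1) ^+ (k + p))) *
    (lambert (fun l => l%:R ^+ (k + p)) * F (bracket_homog wt a p%:Z u)).
Proof.
move=> k0; apply/funext => n; rewrite residue_polar (trace_series_sum Wh Mord) !fps_sum.
under [RHS]eq_bigr => p _ do rewrite fpsCM -lambertM mulr_sumr.
rewrite [RHS]exchange_big /=.
pose G (j : int) := F (res (binc (wt%:R - 1 + j%:~R)) 0).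
transitivity (\sum_(l < n) (l.+1%:R ^+ k * (geom R l.+1 * G l.+1%:Z) n -
    (- l.+1%:R) ^+ k * (geom R l.+1 * G (- l.+1%:Z)) n)).
  under eq_bigr => s _ do rewrite fpsCM (zhu_recursion Wh Mord I awt ud auN) mulrDr mulrA.
  rewrite big_split /= [X in X + _]big1 ?add0r => [|s _]; last first.
    by case: s => -[|s] ? /=; rewrite ?polar_coef0 ?mul0r ?mulr0 ?mul0r.
  under eq_bigr => s _ do rewrite mulr_sumr.
  rewrite exchange_big; apply: eq_bigr => l _ /=.
  under eq_bigr => s _ do rewrite mulrBr (mulrA _ (binc (- l.+1%:R) s)) (mulrA _ (binc l.+1%:R s)).
  by rewrite sumrB -!mulr_suml !polar_coef_binc opprK.
apply: eq_bigr => l _.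
have GE (j : int) : (geom R l.+1 * G j) n = \sum_(p < N) (j%:~R ^+ p / p`!%:R * tp ^+ p.+1) *
    (geom R l.+1 * F (bracket_homog wt a p%:Z u)) n.
  rewrite /G residue_exp (trace_series_sum Wh Mord) big_distrr /= fps_sum.
  by apply: eq_bigr => p _; rewrite mulrCA fpsCM.
rewrite (GE l.+1%:Z) (GE (- l.+1%:Z)).
rewrite [X in X - _]big_distrr [X in _ - X]big_distrr -sumrB; apply: eq_bigr => p _ /=.
move: ((geom R l.+1 * _) n) => g; move: (tp ^+ p.+1) (p`!%:R^-1) => t f.
have -> : (- l.+1%:Z)%:~R = - l.+1%:R :> C by rewrite rmorphN.
rewrite -[l.+1%:Z%:~R]/(l.+1%:R : C); move: (l.+1%:R : C) => x.
by rewrite !(exprNn x) !exprD; ring.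
Qed.

(** [polar_log_decomposition] is multiplied by (1 + z)^(wt-1), passed through residue and trace, and
    solved for the term t^(-k-1), which is the bracket a[-k-1]u. *)
Lemma zhu_relation k : (0 < k)%N ->
  F (bracket_homog wt a (- k.+1%:Z) u) =
  \sum_(p < N) fpsC ((-1) ^+ k * tp ^+ (k + p).+1 / k`!%:R) *
   (fpsC ((1 - (-1) ^+ (k + p)) / p`!%:R) * lambert (fun l => l%:R ^+ (k + p))
    - fpsC (polar_regular (bernoulli_series R) k p)) *
   F (bracket_homog wt a p%:Z u).
Proof.
move=> k0; rewrite bracket_homog_opp (trace_seriesZ Wh Mord).
have kf0 : k`!%:R != 0 :> C by rewrite pnatr_eq0 -lt0n fact_gt0.
have /(congr1 (fun f => F (res (f * B) k.+1))) :=
  polar_log_decomposition (bernoulli_expm1 R) k0.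
rewrite trace_residue_polar // mulrDl -(mulrA (fpsC _)) -(mulrA (X ^+ k.+1)).
rewrite residueD residueCM.
have := residueXnM k.+1 (fpscomp (fpslog R) (polar_regular (bernoulli_series R) k) * B) 0.
rewrite add0n => ->; rewrite residue_comp (trace_seriesP Wh Mord).
move: (F (res ((fps_pow ell (- k.+1%:R) : fps) * B) k.+1)) => T.
rewrite (trace_series_sum Wh Mord).
set c : C := (-1) ^+ k * k`!%:R => TE.
have c1 : (-1) ^+ k / k`!%:R * c = 1.
  by rewrite /c mulrACA -expr2 sqrr_sign mul1r mulVf.
have -> : T = fpsC ((-1) ^+ k / k`!%:R) * (fpsC c * T).
  by rewrite mulrA -rmorphM /= c1 fpsC1 mul1r.
have {TE}-> : fpsC c * T = \sum_(p < N) fpsC (tp ^+ p.+1) *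
    (fpsC ((1 - (-1) ^+ (k + p)) / p`!%:R) * lambert (fun l => l%:R ^+ (k + p))
    - fpsC (polar_regular (bernoulli_series R) k p)) * F (bracket_homog wt a p%:Z u).
  move/eqP: TE; rewrite -subr_eq => /eqP <-.
  rewrite -sumrB; apply: eq_bigr => p _; rewrite residue_log (trace_seriesZ Wh Mord I (tp ^+ p.+1)).
  rewrite [in RHS]mulrBr [in RHS]mulrBl; congr (_ - _).
    by rewrite !mulrA -!rmorphM /=; congr (fpsC _ * _ * _); ring.
  by rewrite mulrA [fpsC (polar_regular _ _ _) * _]mulrC.
rewrite !mulr_sumr; apply: eq_bigr => p _.
rewrite !mulrA -!rmorphM /=; congr (fpsC _ * _ * _).
by rewrite -addnS exprD; ring.
Qed.

Lemma eisenstein_relation k N' : (0 < k)%N -> (N + k.+1 <= N'.*2)%N ->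
  F (bracket_homog wt a (- k.+1%:Z) u) =
  \sum_(K < N') fpsC ((-1) ^+ k * 'C(2 * K - 1, k)%:R) *
    (eisenstein_series K * F (bracket_homog wt a ((2 * K)%:Z - k.+1%:Z) u)).
Proof.
move=> k0 NN'; rewrite zhu_relation //.
(* With j = k + 1 + p the parity condition selects j = 2K. The new terms j <= k have a zero
   binomial, and those beyond k + N a zero bracket, so the upper bound is free. *)
pose D j := (if odd j then 0 else fpsC ((-1) ^+ k * 'C(j.-1, k)%:R) * eisenstein_series j./2) *
  F (bracket_homog wt a (j%:Z - k.+1%:Z) u).
transitivity (\sum_(p < N) D (k.+1 + p)%N).
  apply: eq_bigr => p _; rewrite zhu_relation_coef // /D addSn /=.
  rewrite (_ : (k + p)%N.+1%:Z - k.+1%:Z = p%:Z); last by lia.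
  by case: odd.
transitivity (\sum_(j < k.+1 + N) D j).
  rewrite big_split_ord /= [X in _ = X + _]big1 ?add0r // => -[j /= jk] _; rewrite /D.
  case: ifP => oj; first by rewrite mul0r.
  by rewrite bin_small ?mulr0 ?fpsC0 ?mul0r //; lia.
rewrite -(big_ord_extend (F := D) (N := N'.*2)); last 2 first.
- by rewrite addnC.
- by move=> j Nj; rewrite /D bracket_homog_large ?(trace_series0 Wh Mord) ?mulr0 //; lia.
rewrite sum_double [X in _ + X]big1 ?addr0 => [|K _]; last first.
  by rewrite /D /= odd_double mul0r.
apply: eq_bigr => K _; rewrite /D odd_double doubleK -mulrA.
by rewrite -mul2n subn1.
Qed.

End Homogeneous.
End SquareBrackets.

(** * Eisenstein series at the nome *)

Section Nome.
Variable R : realType.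
Local Notation C := R[i].

Lemma cabs_expC (z : C) : cabs (expC z) = expR (complex.Re z).
Proof.
rewrite /expC cabsM -[RHS]mulr1; congr (_ * _).
  by apply: complexI; rewrite -cabsE ger0_norm // lecR expR_ge0.
by rewrite /cabs /= cos2Dsin2 sqrtr1.
Qed.

Lemma cabs_nome (tau : C) : 0 < complex.Im tau -> cabs (nome tau) < 1.
Proof.
case: tau => x y /= y0; rewrite /nome cabs_expC /= expR_lt1.
by rewrite mul0r sub0r oppr_lt0 !mulr_gt0 // pi_gt0.
Qed.

Lemma conv_lambert_exp p : conv (lambert (fun l => (l%:R : C) ^+ p)).
Proof.
apply: conv_lambert; rewrite (_ : (fun l => _) = (fun l => \prod_(j < p) (l%:R : C))).
  by apply: (@conv_prod R _ (fun _ l => l%:R)) => _; exact: conv_nat.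
by apply/funext => l; rewrite prodr_const card_ord.
Qed.

Lemma conv_eisenstein k : conv (eisenstein_series R k).
Proof.
apply: convD; first exact: conv_fpsC.
apply: convM; first exact: conv_fpsC.
exact: conv_lambert_exp.
Qed.

Lemma eisensteinE k (tau : C) : 0 < complex.Im tau ->
  eisenstein k tau = fps_eval (eisenstein_series R k) (nome tau).
Proof.
move=> /cabs_nome q1; set q := nome tau in q1 *.
pose lam := lambert (fun l => (l%:R : C) ^+ (2 * k - 1)).
have clam : conv lam by exact: conv_lambert_exp.
rewrite fps_evalD // ?fps_evalCM //; last 2 first.
- exact: conv_fpsC.
- by apply: convM => //; exact: conv_fpsC.
rewrite /eisenstein; congr (_ + _ * _).
  symmetry; apply: fps_eval_unique.
  have -> : 2 * (zeta R (2 * k))%:C = 0 + 2 * (zeta R (2 * k))%:C by rewrite add0r.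
  (* The empty partial sum is 0; from the next one on the sequence is constant. *)
  rewrite -cvg_shiftS /=.
  rewrite (_ : (fun N => _) = cst (0 + 2 * (zeta R (2 * k))%:C)); first exact: cvg_cst.
  apply/funext => N; rewrite /psum big_ord_recl big1 ?addr0 => [|i _].
    by rewrite /fpsC expr0 mulr1 mulr1n add0r.
  by rewrite /fpsC mulr0n mul0r.
apply: (cvg_lim (@norm_hausdorff _ _)).
(* A Lambert series has no constant term, so the shift by one matches the series of divisor sums,
   which starts at q. *)
have lam_cvg := psum_cvg clam q1; rewrite -cvg_shiftS in lam_cvg.
rewrite (_ : series _ = (fun N => psum lam N.+1 q)); first exact: lam_cvg.
apply/funext => N; rewrite /psum seriesEord big_ord_recl {1}/lam /lambert big_ord0 mul0r add0r.
by apply: eq_bigr => n _; rewrite /= -lambert_sigma.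
Qed.

End Nome.

Section Brackets.
Variables (R : realType) (V : voa R) (W : admissible_module V).
Local Notation C := R[i].

Lemma bracket_homog_bound (wt : nat) (a : V) (m : int) (v : W) (N : nat) :
  (forall r : int, N%:Z <= r -> mmode a r v = 0) -> forall n, (N + `|m| <= n)%N ->
  bracket_homog wt a m v =
  twopii R ^ (- m - 1) *: \sum_(i < n) bracket_coef R m wt i *: mmode a (m + i%:Z) v.
Proof.
move=> avN n Nn; rewrite /bracket_homog (fsbig_nat (N := n)) // => i ni.
by rewrite avN ?scaler0 //; lia.
Qed.

Lemma bracket_homog_linear_r wt (a : V) m : linear (@bracket_homog R V W wt a m).
Proof.
move=> k x y; have [N1 P1] := mode_bound a x; have [N2 P2] := mode_bound a y.
pose N := (N1 + N2)%N.
have xN (r : int) : N%:Z <= r -> mmode a r x = 0 by move=> h; apply: P1; rewrite /N in h; lia.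
have yN (r : int) : N%:Z <= r -> mmode a r y = 0 by move=> h; apply: P2; rewrite /N in h; lia.
have xyN (r : int) : N%:Z <= r -> mmode a r (k *: x + y) = 0.
  by move=> h; rewrite mmode_linear_r xN // yN // scaler0 addr0.
rewrite (bracket_homog_bound _ xN (leqnn _)) (bracket_homog_bound _ yN (leqnn _)).
rewrite (bracket_homog_bound _ xyN (leqnn _)) scalerA mulrC -scalerA -scalerDr.
congr (_ *: _); rewrite scaler_sumr -big_split; apply: eq_bigr => i _ /=.
by rewrite mmode_linear_r scalerDr !scalerA mulrC.
Qed.

Lemma bracket_homog_linear_l wt m (v : W) : linear (fun a : V => bracket_homog wt a m v).
Proof.
move=> k a b; have [N1 P1] := mode_bound a v; have [N2 P2] := mode_bound b v.
pose N := (N1 + N2)%N.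
have aN (r : int) : N%:Z <= r -> mmode a r v = 0 by move=> h; apply: P1; rewrite /N in h; lia.
have bN (r : int) : N%:Z <= r -> mmode b r v = 0 by move=> h; apply: P2; rewrite /N in h; lia.
have abN (r : int) : N%:Z <= r -> mmode (k *: a + b) r v = 0.
  by move=> h; rewrite mmode_linear_l aN // bN // scaler0 addr0.
rewrite (bracket_homog_bound _ aN (leqnn _)) (bracket_homog_bound _ bN (leqnn _)).
rewrite (bracket_homog_bound _ abN (leqnn _)) scalerA mulrC -scalerA -scalerDr.
congr (_ *: _); rewrite scaler_sumr -big_split; apply: eq_bigr => i _ /=.
by rewrite mmode_linear_l scalerDr !scalerA mulrC.
Qed.

Let dV := voa_grading (voaP V).

Lemma bracket_sum (a : V) m (v : W) N :
  (forall k, (N <= k)%N -> component (weight_space V) k a = 0) ->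
  bracket a m v = \sum_(k < N) bracket_homog k (component (weight_space V) k a) m v.
Proof.
move=> aN; apply: fsbig_nat => k Nk.
by rewrite aN // (linear0 (bracket_homog_linear_l _ _ _)).
Qed.

Lemma bracket_homogE wt (a : V) m (v : W) : weight_space V wt a ->
  bracket a m v = bracket_homog wt a m v.
Proof.
move=> awt; rewrite (@bracket_sum _ _ _ wt.+1) => [|k wk]; last first.
  by rewrite (component_homog dV _ awt) gtn_eqF.
rewrite big_ord_recr /= (component_id dV awt) big1 ?add0r // => i _.
rewrite (component_homog dV _ awt) ltn_eqF ?(ltn_ord i) //.
exact: (linear0 (bracket_homog_linear_l _ _ _)).
Qed.

Lemma bracket_linear_l m (v : W) : linear (fun a : V => bracket a m v).
Proof.
move=> k a b; have [N1 [P1 _]] := component_bound dV a.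
have [N2 [P2 _]] := component_bound dV b.
rewrite !(@bracket_sum _ _ _ (N1 + N2)).
- rewrite scaler_sumr -big_split; apply: eq_bigr => i _ /=.
  by rewrite (component_linear dV) bracket_homog_linear_l.
- by move=> i Ni; apply: P2; lia.
- by move=> i Ni; apply: P1; lia.
- by move=> i Ni; rewrite (component_linear dV) P1 ?P2 ?scaler0 ?addr0 //; lia.
Qed.

Lemma bracket_linear_r (a : V) m : linear (@bracket R V W a m).
Proof.
move=> k x y; have [N [P _]] := component_bound dV a.
rewrite !(@bracket_sum _ _ _ N) // scaler_sumr -big_split; apply: eq_bigr => i _ /=.
by rewrite bracket_homog_linear_r.
Qed.

Lemma bracket_bound (a : V) (v : W) :
  exists N : nat, forall r : int, N%:Z <= r -> bracket a r v = 0.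
Proof.
have [D [P _]] := component_bound dV a.
have [N NP] : exists N : nat, forall i, (i < D)%N -> forall r : int, N%:Z <= r ->
    bracket_homog i (component (weight_space V) i a) r v = 0.
  elim: D {P} => [|D [N NP]]; first by exists 0.
  have [N' h] := mode_bound (component (weight_space V) D a) v.
  exists (N + N')%N => i; rewrite ltnS leq_eqVlt => /predU1P[->|iD] r Nr.
    by apply: (bracket_homog_large D (N := N')) => //; lia.
  by apply: NP => //; lia.
exists N => r Nr; rewrite (@bracket_sum _ _ _ D) // big1 // => i _.
exact: NP.
Qed.

End Brackets.

(** * Trace functions on the coinvariant relations *)

Section TraceFunctional.
Variables (R : realType) (V : voa R) (W M : admissible_module V) (hW hM : R[i]).
Local Notation C := R[i].
Hypotheses (Wh : has_conformal_weight W hW) (Mord : ordinary M hM).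
Variable I : intertwining W M hW.
Local Notation F := (trace_series I).
Hypothesis F_conv : forall u, conv (F u).
Variable tau : C.
Hypothesis tau_upper : 0 < complex.Im tau.
Local Notation q := (nome tau).
Local Notation phi := (fun u : W => fps_eval (F u) q).

Let q1 : cabs q < 1 := cabs_nome tau_upper.
Let dV := voa_grading (voaP V).
Let dW := am_direct_sum W.

Lemma trace_eval_linear k (u v : W) : phi (k *: u + v) = k * phi u + phi v.
Proof.
rewrite /= (trace_seriesP Wh Mord) fps_evalD ?fps_evalCM //.
by apply: convM => //; exact: conv_fpsC.
Qed.

Lemma trace_eval_scalar : linear (phi : W -> C^o).
Proof. exact: trace_eval_linear. Qed.

Lemma trace_eval_bracket0 (a : V) (v : W) : phi (bracket a 0 v) = 0.
Proof.
have lphi := trace_eval_scalar.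
have la u : linear ((fun a : V => phi (bracket a 0 u)) : V -> C^o).
  by move=> k x y; rewrite bracket_linear_l trace_eval_linear.
have lv b : linear ((fun u : W => phi (bracket b 0 u)) : W -> C^o).
  by move=> k x y; rewrite bracket_linear_r trace_eval_linear.
apply: (component_linear_eq0 dV (la v)) => wt {}a awt.
apply: (component_linear_eq0 dW (lv a)) => d {}v vd.
have [N auN] := mode_bound a v.
by rewrite (bracket_homogE _ _ awt) (trace_bracket0 Wh Mord I awt vd auN) fps_eval0.
Qed.

(** The Eisenstein sum is cut at a fixed n, which makes the expression linear in [a] and in [v].
    Truncation bounds vary with the homogeneous components, so vanishing is shown for all large
    n. *)
Definition zhu_defect (m n : nat) (a : V) (v : W) : C :=
  phi (bracket a (- m%:Z) v) + (-1) ^+ m *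
  \sum_(k < n) 'C(2 * k - 1, m - 1)%:R * eisenstein k tau *
    phi (bracket a ((2 * k)%:Z - m%:Z) v).

Lemma linear_scaled_sum (X : lmodType C) n (c : nat -> C) (f : nat -> X -> C) (g : X -> C) s :
  linear (g : X -> C^o) -> (forall k, linear (f k : X -> C^o)) ->
  linear ((fun x => g x + s * \sum_(k < n) c k * f k x) : X -> C^o).
Proof.
move=> lg lf k x y; rewrite lg.
under eq_bigr => i _ do rewrite lf mulrDr.
rewrite big_split /= mulrDr addrACA scalerDr; congr (_ + _ + _).
rewrite -[k *: (_ * _)]/(k * (_ * _)) mulrCA; congr (_ * _); rewrite mulr_sumr.
by apply: eq_bigr => i _; rewrite -[k *: _]/(k * _) mulrCA.
Qed.

Lemma zhu_defect_linear_l m n v : linear ((fun a => zhu_defect m n a v) : V -> C^o).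
Proof.
have lb r : linear ((fun a : V => phi (bracket a r v)) : V -> C^o).
  by move=> k x y; rewrite bracket_linear_l trace_eval_linear.
exact: (linear_scaled_sum n (fun k => 'C(2 * k - 1, m - 1)%:R * eisenstein k tau) _ (lb _)
  (fun k => lb ((2 * k)%:Z - m%:Z))).
Qed.

Lemma zhu_defect_linear_r m n a : linear ((zhu_defect m n a) : W -> C^o).
Proof.
have lb r : linear ((fun v : W => phi (bracket a r v)) : W -> C^o).
  by move=> k x y; rewrite bracket_linear_r trace_eval_linear.
exact: (linear_scaled_sum n (fun k => 'C(2 * k - 1, m - 1)%:R * eisenstein k tau) _ (lb _)
  (fun k => lb ((2 * k)%:Z - m%:Z))).
Qed.

Lemma zhu_defect_homog m wt (a : V) d (v : W) : (1 < m)%N -> weight_space V wt a ->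
  piece W d v -> exists N, forall n, (N <= n)%N -> zhu_defect m n a v = 0.
Proof.
case: m => [|k] // k1 awt vd; have [N auN] := mode_bound a v.
exists (N + k.+1)%N => n Nn; rewrite /zhu_defect subn1 /=.
have k0 : (0 < k)%N by [].
rewrite (bracket_homogE _ _ awt).
rewrite (eisenstein_relation Wh Mord I awt vd auN (N' := n) k0); last by lia.
rewrite fps_eval_sum //; last first.
  move=> j; apply: convM; first exact: conv_fpsC.
  by apply: convM => //; exact: conv_eisenstein.
rewrite mulr_sumr -big_split big1 // => j _ /=.
have cE := conv_eisenstein j.
rewrite fps_evalCM //; last exact: convM.
rewrite fps_evalM // -eisensteinE // (bracket_homogE _ _ awt) exprS; ring.
Qed.

Lemma eventually0_linear (X : lmodType C) (S : nat -> set X) (f : nat -> X -> C) :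
  direct_sum S -> (forall n, linear (f n : X -> C^o)) ->
  (forall d x, S d x -> exists N, forall n, (N <= n)%N -> f n x = 0) ->
  forall x, exists N, forall n, (N <= n)%N -> f n x = 0.
Proof.
move=> dS lf Sf x; have [D [_ xE]] := component_bound dS x.
have [N NP] : exists N, forall i, (i < D)%N -> forall n, (N <= n)%N ->
    f n (component S i x) = 0.
  elim: D {xE} => [|D [N NP]]; first by exists 0.
  have [N' h] := Sf _ _ (component_piece dS D x).
  exists (N + N')%N => i; rewrite ltnS leq_eqVlt => /predU1P[->|iD] n Nn.
    by apply: h; lia.
  by apply: NP => //; lia.
exists N => n Nn; rewrite xE.
have := linear_sumZ (fun=> 1) (fun n : 'I_D => component S n x) (lf n).
under eq_bigr do rewrite scale1r; move=> ->; rewrite big1 // => i _.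
by rewrite NP ?scaler0.
Qed.

Lemma zhu_defect0 m (a : V) (v : W) : (1 < m)%N ->
  exists N, forall n, (N <= n)%N -> zhu_defect m n a v = 0.
Proof.
move=> m1.
apply: (eventually0_linear (f := fun n a => zhu_defect m n a v) dV) => [n|wt {}a awt].
  exact: zhu_defect_linear_l.
apply: (eventually0_linear (f := fun n v => zhu_defect m n a v) dW) => [n|d {}v vd].
  exact: zhu_defect_linear_r.
exact: (zhu_defect_homog m1 awt vd).
Qed.

Lemma trace_eval_relations (x : W) : coinvariant_relations W tau x -> phi x = 0.
Proof.
move=> [[a [v ->]]|[a [v [m [m2 ->]]]]]; first exact: trace_eval_bracket0.
have [N NP] := zhu_defect0 a v m2; have [N' bN] := bracket_bound a v.
pose n := (N + N' + m)%N.
rewrite (_ : \sum_(k \in _) _ = \sum_(k < n) ('C(2 * k - 1, m - 1)%:R * eisenstein k tau) *: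
    bracket a ((2 * k)%:Z - m%:Z) v); last first.
  rewrite fsbig_mkcond (fsbig_nat (N := n)) => [|k nk]; last first.
    by rewrite /patch bN ?scaler0 ?if_same //; move: nk; rewrite /n; lia.
  apply: eq_bigr => -[[|k] /= kn] _; last by rewrite /patch mem_set.
  (* The relation starts at k = 1; the extra term k = 0 has the binomial C(0, m - 1), which is 0 as
     m >= 2. *)
  by rewrite /patch memNset //= bin_small ?mul0r ?scale0r //; lia.
rewrite -(NP n) /zhu_defect; last by rewrite /n; lia.
rewrite addrC trace_eval_linear addrC; congr (_ + _ * _).
rewrite (linear_sumZ _ _ trace_eval_scalar).
by [].
Qed.

Lemma trace_eval_lspan (x : W) : lspan (coinvariant_relations W tau) x -> phi x = 0.
Proof.
move=> rx; apply: (rx [set y | phi y = 0]).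
split=> [|y]; last exact: trace_eval_relations.
split=> [|c y z y0 z0]; first by rewrite /= (trace_series0 Wh Mord) fps_eval0.
by rewrite /= trace_eval_linear y0 z0 mulr0 addr0.
Qed.

End TraceFunctional.

Theorem theorem5p25 (R : realType) (V : voa R) (W M : admissible_module V)
  (hW hM : R[i])
  (W_irr : irreducible W) (W_ord : ordinary W hW)
  (M_irr : irreducible M) (M_ord : ordinary M hM)
  (U : set W) (U_graded : graded_subspace U) (U_fin : fin_dim U)
  (U_C2 : direct_sum2 U (C2 W))
  (Lam : Type) (h : Lam -> R[i]) (v : Lam -> W)
  (v_hw : forall i, highest_weight_vector (h i) (v i))
  (U_vir : U `<=` virasoro_span v)
  (I : intertwining W M hW) :
  (forall u : W,
     cvg_locally_uniformly_on (unit_disc R) (trace_partial_sum I u)) /\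
  (forall tau : R[i], 0 < complex.Im tau ->
     (exists phi : {scalar coinvariants W tau},
        forall u : W,
          phi (coinvariant_class tau u) = trace_function I hM tau u) /\
     conformal_blocks W tau (trace_function I hM tau)).
Proof.
have [m [e U_basis]] := U_fin.
have F_conv u : conv (trace_series I u).
  exact: (conv_trace_series (proj1 W_ord) M_ord I U_graded U_basis (proj1 U_C2)).
split=> [u|tau tau0]; first exact: (conv_locally_uniform (F_conv u)).
(* For fixed tau the power q^(hM - c/24) is a single number, so linearity and vanishing pass from
   the evaluated series to the trace function. *)
pose E := expC (twopii R * tau * (hM - central_charge V / 24)).
have TE u : trace_function I hM tau u = E * fps_eval (trace_series I u) (nome tau) by [].
have T_lin : scalar (trace_function I hM tau).
  move=> k x y; rewrite !TE (trace_eval_linear (proj1 W_ord) M_ord F_conv tau0).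
  by rewrite mulrDr mulrCA.
have T0 x : lspan (coinvariant_relations W tau) x -> trace_function I hM tau x = 0.
  by move=> rx; rewrite TE (trace_eval_lspan (proj1 W_ord) M_ord F_conv tau0) ?mulr0.
split; last by split.
(* The value is taken at a representative; it differs from any other one by an element of the span
   of the relations, where the trace function vanishes. *)
pose f (c : coinvariants W tau) : R[i] := trace_function I hM tau (repr c).
have fE u : f (coinvariant_class tau u) = trace_function I hM tau u.
  have /T0 := @lspan_repr _ _ (coinvariant_relations W tau) u.
  rewrite addrC -scaleN1r T_lin mulN1r => /eqP; rewrite addrC subr_eq0 => /eqP.
  by [].
have f_lin : scalar f.
  move=> k c d; rewrite -[c]lclassK -[d]lclassK -lclass_linear.
  by rewrite -/(coinvariant_class _ _) !fE T_lin.
pose g := HB.pack f (GRing.isLinear.Build _ _ _ _ f f_lin) : {scalar coinvariants W tau}.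
by exists g.
Qed.
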